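(* Let $\Omega\subset\mathbb{R}^d$ ($d=2,3$) be a bounded Lipschitz domain, let $\nu,\lambda,\eta,M>0$, $\theta\in(1/2,1]$, $\epsilon\ge 0$, and let $\Delta t>0$ be arbitrary. Let $(\phi^n,q^n,u^n,p^n,\mu^n)$ be a sequence satisfying the time-discrete scheme (S1)–(S6) stated in the context, with starting data as described there. Then the method is unconditionally long-time stable, in the sense that for any $N\ge 2$ (with no restriction on $\Delta t$), writing $a_n=a^n$, $$ \begin{aligned} &\lambda \Vert \nabla \phi_{N}\Vert^2+\frac{\lambda\eta^2}{2} \Vert q_{N}\Vert^2+\Vert u_{N}\Vert^2 +\frac{\lambda}{2\theta+1} \sum_{n=1}^{N-1}\| \nabla(\phi_{n+1}- 2 \phi_n+\phi_{n-1})\|^2_F\\ &\quad+\frac{\lambda\eta^2}{2(2\theta+1)}\sum_{n=1}^{N-1} \| q_{n+1}- 2 q_n+q_{n-1}\|^2_F +\frac{1}{2\theta+1} \sum_{n=1}^{N-1}\| u_{n+1}- 2 u_n+u_{n-1}\|^2_F\\ &\quad+\frac{4 \Delta t\,\nu}{2\theta+1} \sum_{n=1}^{N-1}\Vert\nabla \mathcal{J}^{\epsilon}_{n+\theta}(u)\Vert^2 +\frac{4\Delta t\, M }{2\theta+1}\sum_{n=1}^{N-1} \Vert \nabla \mathcal{H}_{n+\theta}(\mu)\Vert^2\\ &\leq \left(\frac{2\theta-1}{2\theta+1}\right)^N \left( \lambda \Vert \nabla \phi_{0}\Vert^2+\frac{\lambda\eta^2}{2} \Vert q_{0}\Vert^2+\Vert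 u_{0}\Vert^2 \right)\\ &\quad+2\left(1-\left(\frac{2\theta-1}{2\theta+1}\right)^N\right) \left(\lambda \left\| \begin{bmatrix} \nabla \phi_{1}\\ \nabla \phi_{0} \end{bmatrix}\right\|^2_G+\frac{\lambda\eta^2}{2} \left\| \begin{bmatrix} q_{1}\\ q_{0} \end{bmatrix}\right\|^2_G+\left\| \begin{bmatrix} u_{1}\\ u_{0} \end{bmatrix}\right\|^2_G \right). \end{aligned} $$
   Context: Notation. $(\cdot,\cdot)$ and $\|\cdot\|$ are the $L^2(\Omega)$ inner product and norm for scalars, vectors and tensors; $n$ as a vector denotes the outward unit normal on $\partial\Omega$. Superscript and subscript time indices are used interchangeably: $a^n=a_n$ is the approximation at time level $n$ with time step $\Delta t$. For a sequence $(a_n)$ put $$\mathcal{J}_{n+\theta}^{\epsilon}(a)=\theta\frac{\nu+\epsilon}{\nu}a_{n+1}+\Big(1-\theta\frac{\nu+2\epsilon}{\nu}\Big)a_n+\theta\frac{\epsilon}{\nu}a_{n-1},\qquad \mathcal{H}_{n+\theta}(a)=(\theta+1)a_n-\theta a_{n-1}.$$ Unknowns: the phase function $\phi$, an auxiliary scalar $q$ (representing $\frac{1}{\eta^2}(\phi^2-1)$), the velocity $u$ ($\mathbb{R}^d$-valued), the pressure $p$, and the chemical potential $\mu$. Scheme. For each $n\ge1$, given $u^{n-1},u^n,p^{n-1},p^n,\phi^{n-1},\phi^n,q^{n-1},q^n,\mu^{n-1}$, the quantities $u^{n+1},p^{n+1},\phi^{n+1},q^{n+1},\mu^n$ satisfy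 in $\Omega$: (S1) $\displaystyle \frac{(\theta+\frac12)\phi^{n+1}-2\theta\phi^n+(\theta-\frac12)\phi^{n-1}}{\Delta t}+\nabla\cdot\big(\mathcal{H}_{n+\theta}(\phi)\,\mathcal{J}^{\epsilon}_{n+\theta}(u)\big)-M\Delta\mathcal{H}_{n+\theta}(\mu)=0,$ (S2) $\displaystyle \mathcal{H}_{n+\theta}(\mu)=\lambda\big(-\Delta\mathcal{J}^{\epsilon}_{n+\theta}(\phi)+\mathcal{H}_{n+\theta}(\phi)\,\mathcal{J}^{\epsilon}_{n+\theta}(q)\big),$ (S3) $\displaystyle \frac{(\theta+\frac12)q^{n+1}-2\theta q^n+(\theta-\frac12)q^{n-1}}{\Delta t}=\frac{2}{\eta^2}\mathcal{H}_{n+\theta}(\phi)\,\frac{(\theta+\frac12)\phi^{n+1}-2\theta\phi^n+(\theta-\frac12)\phi^{n-1}}{\Delta t},$ (S4) $\displaystyle \frac{(\theta+\frac12)u^{n+1}-2\theta u^n+(\theta-\frac12)u^{n-1}}{\Delta t}+\mathcal{H}_{n+\theta}(u)\cdot\nabla\mathcal{J}^{\epsilon}_{n+\theta}(u)-\nu\Delta\mathcal{J}^{\epsilon}_{n+\theta}(u)+\nabla\mathcal{J}^{\epsilon}_{n+\theta}(p)+\mathcal{H}_{n+\theta}(\phi)\nabla\mathcal{H}_{n+\theta}(\mu)=0,$ (S5) $\nabla\cdot u^{n+1}=0,$ (S6) $u^{n+1}|_{\partial\Omega}=0,\quad \nabla\phi^{n+1}\cdot n|_{\partial\Omega}=0,\quad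 \nabla\mu^{n}\cdot n|_{\partial\Omega}=0.$ Starting data. $\phi^0,\phi^1,q^0,q^1,u^0,u^1,p^0,p^1,\mu^0$ are given, and the starting values satisfy the same constraints: $\nabla\cdot u^0=\nabla\cdot u^1=0$, $u^0=u^1=0$ on $\partial\Omega$, $\nabla\phi^0\cdot n=\nabla\phi^1\cdot n=0$ and $\nabla\mu^0\cdot n=0$ on $\partial\Omega$. All fields are regular enough that the equations may be tested in $L^2(\Omega)$ and integrated by parts using these boundary conditions (for instance $\phi^n,\mu^n\in H^2(\Omega)$, $u^n\in H^2(\Omega)^d\cap H^1_0(\Omega)^d$, $p^n\in H^1(\Omega)$, $q^n\in L^2(\Omega)$). $F$-norm and $G$-norm. For a scalar- or vector-valued $L^2$ function $v$, $$\|v\|_F^2=\Big(\theta(2\theta-1)+\frac{4\theta^2\epsilon}{\nu}\Big)\|v\|^2 .$$ For a pair of $L^2$ functions $v,w$ of the same type, $$\left\|\begin{bmatrix} v \\ w \end{bmatrix}\right\|_G^2=g_{11}\|v\|^2+2g_{12}(v,w)+g_{22}\|w\|^2$$ (a quadratic form whose value may be negative), where $$g_{11}=\frac{\theta(2\theta+3)}{4}\frac{\nu+\epsilon}{\nu}-\frac{\theta(2\theta+1)}{4}\frac{\epsilon}{\nu},\qquad g_{12}=-\Big(\frac{(\theta+1)(2\theta-1)}{4}\frac{\nu+\epsilon}{\nu}+\frac{(1-\theta)(2\theta+1)}{4}\frac{\epsilon}{\nu}\Big),$$ $$g_{22}=\frac{\theta(2\theta-1)}{4}\frac{\nu+\epsilon}{\nu}+\frac{\theta(3-2\theta)}{4}\frac{\epsilon}{\nu}.$$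 *)

(* Defs.v *)
From HB Require Import structures.
From mathcomp Require Import all_boot all_order all_algebra.
From mathcomp Require Import all_classical all_reals all_analysis.
Set Implicit Arguments.
Unset Strict Implicit.
Unset Printing Implicit Defensive.
Import Order.TTheory GRing.Theory Num.Theory.
Import numFieldNormedType.Exports.
Local Open Scope classical_set_scope.
Local Open Scope ring_scope.

(* Lebesgue measure on R^d, built by iterating the product measure along      *)
(* R^(1+d) = R * R^d; the measurable sets are those of the product            *)
(* sigma-algebra.                                                             *)

Definition rV_display : measure_display.
Proof. exact: default_measure_display. Qed.

Section measurable_rV.
Variables (R : realType) (d : nat).

Definition rV_coord (i : 'I_d) (x : 'rV[R]_d) : measurableTypeR R := x 0 i.

Definition rV_measurable : set (set 'rV[R]_d) := g_sigma_preimage rV_coord.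

Let rV_set0 : rV_measurable set0.
Proof. exact: sigma_algebra0. Qed.

Let rV_setC A : rV_measurable A -> rV_measurable (~` A).
Proof. exact: sigma_algebraC. Qed.

Let rV_bigcup (F : _^nat) :
  (forall i, rV_measurable (F i)) -> rV_measurable (\bigcup_i (F i)).
Proof. exact: sigma_algebra_bigcup. Qed.

HB.instance Definition _ := @isMeasurable.Build rV_display
  'rV[R]_d rV_measurable rV_set0 rV_setC rV_bigcup.

End measurable_rV.

Section measurable_rV_theory.
Context {R : realType}.

Lemma measurable_rV_coord d (i : 'I_d) :
  measurable_fun [set: 'rV[R]_d] (@rV_coord R d i).
Proof.
move=> _ Y mY; rewrite setTI; apply: sub_sigma_algebra => /=.
rewrite -bigcup_seq/=; exists i => /=; first by rewrite mem_index_enum.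
by exists Y => //; rewrite setTI.
Qed.

Lemma measurable_rVP d disp (T : measurableType disp) (f : T -> 'rV[R]_d) :
  (forall i, measurable_fun [set: T] (@rV_coord R d i \o f)) ->
  measurable_fun [set: T] f.
Proof.
move=> mf _ A mA; rewrite setTI.
suff : @rV_measurable R d `<=` [set B | measurable (f @^-1` B)] by apply.
apply: smallest_sub.
  split=> [|B mB|F mF] /=; first by rewrite preimage_set0.
  - by rewrite setTD preimage_setC; exact: measurableC.
  - by rewrite preimage_bigcup; exact: bigcupT_measurable.
rewrite -bigcup_seq => B [i _ [Y mY <-]] /=.
by rewrite setTI -comp_preimage -[X in measurable X]setTI; exact: mf.
Qed.

Definition rV_cons d (p : measurableTypeR R * 'rV[R]_d) : 'rV[R]_d.+1 :=
  row_mx (\row_(j < 1) (p.1 : R)) p.2.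

Lemma measurable_rV_cons d :
  measurable_fun [set: measurableTypeR R * 'rV[R]_d] (@rV_cons d).
Proof.
apply: measurable_rVP => i.
rewrite (_ : _ \o _ = fun p => match fintype.split (i : 'I_(1 + d)) with
  | inl _ => p.1 | inr k => @rV_coord R d k p.2 end); last first.
  by apply/funext => p /=; rewrite /rV_coord /rV_cons mxE; case: fintype.split => k //;
    rewrite mxE.
case: fintype.split => k; first exact: measurable_fst.
by apply: measurableT_comp => //; exact: measurable_rV_coord.
Qed.

End measurable_rV_theory.

Section lebesgue_cons.
Context {R : realType} {d : nat}.
Variable m : {sigma_finite_measure set 'rV[R]_d -> \bar R}.

Definition lebesgue_cons : set 'rV[R]_d.+1 -> \bar R :=
  pushforward (@lebesgue_measure R \x m)%E (@rV_cons R d).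

Let lebesgue_cons0 : lebesgue_cons set0 = 0%E.
Proof. by rewrite /lebesgue_cons /pushforward preimage_set0 measure0. Qed.

Let lebesgue_cons_ge0 A : (0 <= lebesgue_cons A)%E.
Proof. exact: (measure_ge0 (@lebesgue_measure R \x m)%E). Qed.

Let lebesgue_cons_sigma_additive : semi_sigma_additive lebesgue_cons.
Proof.
move=> F mF tF mUF; rewrite /lebesgue_cons /pushforward preimage_bigcup.
have mc := @measurable_rV_cons R d.
apply: measure_semi_sigma_additive.
- by move=> n; rewrite -[X in measurable X]setTI; exact: mc.
- apply/trivIsetP => /= i j _ _ ij; rewrite -preimage_setI.
  by move/trivIsetP : tF => /(_ _ _ _ _ ij) ->//; rewrite preimage_set0.
- by rewrite -preimage_bigcup -[X in measurable X]setTI; exact: mc.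
Qed.

HB.instance Definition _ := isMeasure.Build _ _ _ lebesgue_cons
  lebesgue_cons0 lebesgue_cons_ge0 lebesgue_cons_sigma_additive.

Let uncons (v : 'rV[R]_d.+1) : measurableTypeR R * 'rV[R]_d :=
  (v 0 0, @rsubmx _ 1 1 d v).

Let consK : cancel (@rV_cons R d) uncons.
Proof.
move=> -[a v]; congr pair; last by rewrite /rV_cons row_mxKr.
have E : row_mx (\row_(j < 1) (a : R)) v 0 (lshift d 0) = a by rewrite row_mxEl mxE.
by rewrite -[RHS]E; congr (fun_of_matrix _ _ _); apply: val_inj.
Qed.

Let measurable_uncons : measurable_fun setT uncons.
Proof.
apply: measurable_fun_pair; first exact: (measurable_rV_coord (0 : 'I_d.+1)).
apply: measurable_rVP => i.
rewrite (_ : _ \o _ = @rV_coord R d.+1 (rshift 1 i)).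
  exact: measurable_rV_coord.
by apply/funext => v; rewrite /= /rV_coord mxE.
Qed.

Let lebesgue_cons_sigma_finite : sigma_finite setT lebesgue_cons.
Proof.
have /sigma_finiteP[F [TF ndF Foo]] := sigma_finiteT (@lebesgue_measure R).
have /sigma_finiteP[G [TG ndG Goo]] := sigma_finiteT m.
exists (fun n => uncons @^-1` (F n `*` G n)).
  rewrite -preimage_bigcup (_ : \bigcup_n _ = setT) ?preimage_setT//.
  rewrite -subTset => -[x y] _.
  have [n _ Fnx] : (\bigcup_n F n) x by rewrite -TF.
  have [k _ Gky] : (\bigcup_n G n) y by rewrite -TG.
  exists (maxn n k) => //; split => /=.
    by move: x Fnx; exact/subsetPset/ndF/leq_maxl.
  by move: y Gky; exact/subsetPset/ndG/leq_maxr.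
move=> n; have [mF Fn] := Foo n; have [mG Gn] := Goo n; split.
  rewrite -[X in measurable X]setTI; apply: measurable_uncons => //.
  exact: measurableX.
rewrite /lebesgue_cons /pushforward (_ : _ @^-1` _ = F n `*` G n).
  rewrite product_measure1E//.
  by apply: lte_mul_pinfty => //; rewrite ge0_fin_numE.
apply/funext => x.
by rewrite [LHS](_ : _ = (F n `*` G n) (uncons (rV_cons x)))// consK.
Qed.

HB.instance Definition _ := Measure_isSigmaFinite.Build _ _ _ lebesgue_cons
  lebesgue_cons_sigma_finite.

End lebesgue_cons.

Fixpoint lebesgue_rV (R : realType) (d : nat) :
    {sigma_finite_measure set 'rV[R]_d -> \bar R} :=
  match d with
  | 0 => \d_(0 : 'rV[R]_0)
  | k.+1 => lebesgue_cons (lebesgue_rV R k)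
  end.

Lemma lebesgue_rV_box (R : realType) (d : nat) (A : 'I_d -> set R) :
  (forall i, measurable (A i : set (measurableTypeR R))) ->
  lebesgue_rV R d [set x | forall i, A i (x 0 i)] =
  (\prod_(i < d) lebesgue_measure (A i : set (measurableTypeR R)))%E.
Proof.
elim: d A => [|d IH] A mA.
  by rewrite big_ord0 /= diracE mem_set// => -[].
rewrite big_ord_recl -IH; last by move=> i; exact: mA.
pose B := [set x : 'rV[R]_d | forall i, A (lift ord0 i) (x 0 i)].
have mB : measurable B.
  rewrite (_ : B = \bigcap_(i in [set: 'I_d])
    (@rV_coord R d i @^-1` A (lift ord0 i))); last first.
    by apply/seteqP; split => [x Bx i _|x Bx i]; [exact: Bx|exact: (Bx i I)].
  apply: fin_bigcap_measurable => // i _; rewrite -[X in measurable X]setTI.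
  exact: measurable_rV_coord.
rewrite -[RHS](product_measure1E _ _ (mA ord0) mB).
rewrite [LHS]/= /lebesgue_cons /pushforward; congr (_ _).
have E0 (p : measurableTypeR R * 'rV[R]_d) : rV_cons p 0 ord0 = p.1.
  have <- : row_mx (\row_(j < 1) (p.1 : R)) p.2 0 (lshift d 0) = p.1.
    by rewrite row_mxEl mxE.
  by congr (fun_of_matrix _ _ _); apply: val_inj.
have E1 (p : measurableTypeR R * 'rV[R]_d) i :
    rV_cons p 0 (lift ord0 i) = p.2 0 i.
  rewrite -(row_mxEr (\row_(j < 1) (p.1 : R)) p.2).
  by congr (fun_of_matrix _ _ _); apply: val_inj.
apply/seteqP; split => p.
  by move=> Ap; split => [|i /=]; rewrite -?E0 -?E1; exact: Ap.
move=> [Ap Bp] i; case: (unliftP ord0 i) => [k|] ->; first by rewrite E1; exact: Bp.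
by rewrite E0.
Qed.

Section sobolev.
Context {R : realType} {d : nat}.
Implicit Types (Omega : set 'rV[R]_d) (f g psi : 'rV[R]_d -> R).
Implicit Types (u w : 'rV[R]_d -> 'rV[R]_d).

Definition ae_in Omega (P : 'rV[R]_d -> Prop) : Prop :=
  {ae lebesgue_rV R d, forall x, Omega x -> P x}.

Definition inL2 Omega f : Prop :=
  measurable_fun Omega f /\
  (lebesgue_rV R d).-integrable Omega (fun x => (f x ^+ 2)%:E).

Definition ipL2 Omega f g : R :=
  \int[lebesgue_rV R d]_(x in Omega) (f x * g x).

(* Inner product of L^2 vector or tensor fields (Frobenius product of the     *)
(* values).                                                                   *)
Definition ipL2M Omega m n (F G : 'rV[R]_d -> 'M[R]_(m, n)) : R :=
  \sum_(i < m) \sum_(j < n)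
    ipL2 Omega (fun x => F x i j) (fun x => G x i j).

Definition L1loc Omega f : Prop :=
  measurable_fun Omega f /\
  forall K, compact K -> K `<=` Omega ->
    (lebesgue_rV R d).-integrable K (fun x => (f x)%:E).

Definition partial (i : 'I_d) psi : 'rV[R]_d -> R :=
  fun x => 'D_(delta_mx 0 i) psi x.

(* C^1_c(Omega). These test functions define the same weak derivatives of     *)
(* locally integrable functions, and the same H^1_0(Omega), as                *)
(* C^infty_c(Omega).                                                          *)
Definition test_fun Omega psi : Prop :=
  [/\ forall x, differentiable psi x,
      forall i, continuous (partial i psi),
      compact (closure [set x | psi x != 0]) &
      closure [set x | psi x != 0] `<=` Omega].

Definition is_wderiv Omega (i : 'I_d) f g : Prop :=
  [/\ L1loc Omega f, L1loc Omega g &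
      forall psi, test_fun Omega psi ->
        \int[lebesgue_rV R d]_(x in Omega) (f x * partial i psi x) =
        - \int[lebesgue_rV R d]_(x in Omega) (g x * psi x)].

(* The weak derivative is unique up to a null set; wderiv is a representative *)
(* if there is one, and 0 otherwise. The same holds for wdiv.                 *)
Definition wderiv Omega (i : 'I_d) f : 'rV[R]_d -> R :=
  xget (cst 0) [set g | is_wderiv Omega i f g].

Definition is_wdiv Omega w g : Prop :=
  [/\ forall i, L1loc Omega (fun x => w x 0 i), L1loc Omega g &
      forall psi, test_fun Omega psi ->
        \int[lebesgue_rV R d]_(x in Omega)
           (\sum_(i < d) w x 0 i * partial i psi x) =
        - \int[lebesgue_rV R d]_(x in Omega) (g x * psi x)].

Definition wdiv Omega w : 'rV[R]_d -> R :=
  xget (cst 0) [set g | is_wdiv Omega w g].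

Definition wgrad Omega f : 'rV[R]_d -> 'rV[R]_d :=
  fun x => \row_i wderiv Omega i f x.

(* Entry (i, j) is the i-th derivative of the j-th component, so that         *)
(* (v . nabla) u is the row vector v *m wgradv Omega u.                       *)
Definition wgradv Omega u : 'rV[R]_d -> 'M[R]_d :=
  fun x => \matrix_(i, j) wderiv Omega i (fun y => u y 0 j) x.

Definition wlap Omega f : 'rV[R]_d -> R := wdiv Omega (wgrad Omega f).

Definition wlapv Omega u : 'rV[R]_d -> 'rV[R]_d :=
  fun x => \row_j wlap Omega (fun y => u y 0 j) x.

Definition inH1 Omega f : Prop :=
  inL2 Omega f /\ forall i, exists2 g, inL2 Omega g & is_wderiv Omega i f g.

Definition inH2 Omega f : Prop :=
  inH1 Omega f /\ forall i, inH1 Omega (wderiv Omega i f).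

Definition sqnormH1 Omega f : R :=
  ipL2 Omega f f + ipL2M Omega (wgrad Omega f) (wgrad Omega f).

Definition inH10 Omega f : Prop :=
  inH1 Omega f /\
  forall e : R, 0 < e ->
    exists2 psi, test_fun Omega psi & sqnormH1 Omega (f \- psi) < e.

(* The trace of w . n for a square-integrable field w with square-integrable  *)
(* divergence, as the linear form on H^1(Omega) given by Green's formula: for *)
(* regular w it is psi |-> the integral of (w . n) psi over the boundary.     *)
Definition normal_trace Omega w psi : R :=
  ipL2M Omega w (wgrad Omega psi) + ipL2 Omega (wdiv Omega w) psi.

Definition zero_neumann Omega f : Prop :=
  forall psi, inH1 Omega psi -> normal_trace Omega (wgrad Omega f) psi = 0.

(* Near each boundary point, and in suitable orthonormal coordinates, Omega   *)
(* is the strict epigraph of a Lipschitz function of d - 1 coordinates.       *)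
Definition lipschitz_boundary Omega : Prop :=
  forall x, closure Omega x -> ~ Omega x ->
    exists (U : set 'rV[R]_d) (Q : 'M[R]_d) (i : 'I_d)
           (gamma : 'rV[R]_d.-1 -> R),
      [/\ nbhs x U, Q *m Q^T = 1%:M, lipschitz gamma &
          forall y, U y ->
            (Omega y <-> gamma (col' i (y *m Q)) < (y *m Q) 0 i)].

Definition bounded_lipschitz_domain Omega : Prop :=
  [/\ open Omega, connected Omega, Omega !=set0, bounded_set Omega &
      lipschitz_boundary Omega].

End sobolev.

Section time_stepping.
Context {R : realType}.

Definition Jop (nu eps theta : R) (V : lmodType R) (a : nat -> V) (n : nat) : V :=
  (theta * ((nu + eps) / nu)) *: a n.+1
  + (1 - theta * ((nu + 2 * eps) / nu)) *: a n
  + (theta * (eps / nu)) *: a n.-1.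

Definition Hop (theta : R) (V : lmodType R) (a : nat -> V) (n : nat) : V :=
  (theta + 1) *: a n - theta *: a n.-1.

Definition Dop (theta dt : R) (V : lmodType R) (a : nat -> V) (n : nat) : V :=
  dt^-1 *: ((theta + 2^-1) *: a n.+1 - (2 * theta) *: a n
            + (theta - 2^-1) *: a n.-1).

Definition diff2 (V : lmodType R) (a : nat -> V) (n : nat) : V :=
  a n.+1 - 2 *: a n + a n.-1.

(* In sqF and sqG, ip is the L^2 inner product of the fields at hand (ipL2 or *)
(* ipL2M).                                                                    *)
Definition sqF (nu eps theta : R) (V : Type) (ip : V -> V -> R) (v : V) : R :=
  (theta * (2 * theta - 1) + 4 * theta ^+ 2 * eps / nu) * ip v v.

Definition g11 (nu eps theta : R) : R :=
  theta * (2 * theta + 3) / 4 * ((nu + eps) / nu)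
  - theta * (2 * theta + 1) / 4 * (eps / nu).

Definition g12 (nu eps theta : R) : R :=
  - ((theta + 1) * (2 * theta - 1) / 4 * ((nu + eps) / nu)
     + (1 - theta) * (2 * theta + 1) / 4 * (eps / nu)).

Definition g22 (nu eps theta : R) : R :=
  theta * (2 * theta - 1) / 4 * ((nu + eps) / nu)
  + theta * (3 - 2 * theta) / 4 * (eps / nu).

Definition sqG (nu eps theta : R) (V : Type) (ip : V -> V -> R) (v w : V) : R :=
  g11 nu eps theta * ip v v + 2 * g12 nu eps theta * ip v w
  + g22 nu eps theta * ip w w.

End time_stepping.

(* Main.v *)
Require Import Defs.
From HB Require Import structures.
From mathcomp Require Import all_boot all_order all_algebra.
From mathcomp Require Import all_classical all_reals all_analysis measurable_realfun.
From mathcomp Require Import ring lra.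
Import Order.TTheory GRing.Theory Num.Theory.
Import numFieldNormedType.Exports.
Local Open Scope classical_set_scope.
Local Open Scope ring_scope.
Set Implicit Arguments.
Unset Strict Implicit.
Unset Printing Implicit Defensive.

(** The estimate is the discrete energy law of the scheme, turned into a geometric
recursion.

Write D for the difference quotient in time. Testing the phase equation with H(mu),
the potential equation with D(phi), the auxiliary equation with J(q) and the momentum
equation with J(u), all the coupling terms cancel, and what is left is
[energy_balance]:
  lambda (grad D(phi), grad J(phi)) + lambda eta^2/2 (D(q), J(q)) + (D(u), J(u))
    + nu |grad J(u)|^2 + M |grad H(mu)|^2 = 0.
In any inner product, dt (D(a), J(a)) is the increment of the G-form of two consecutive
values plus a quarter of the F-norm of the second difference ([G_identity]), so that
the total G-energy decreases by the dissipation. Since g12 <= 0, the G-form of (v, w)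
is at least (2 theta + 1)/4 |v|^2 - (2 theta - 1)/4 |w|^2 ([sqG_lower]), and the energy
at one step is bounded by (2 theta - 1)/(2 theta + 1) times the energy at the previous
step plus a constant ([energy_recursion]).

The analysis lies in the cancellations, where products of three fields occur that
are not known to be bounded.

The convective term: test functions satisfy the Ladyzhenskaya inequality in dimensions
2 and 3, proved by slicing, and by Fatou's lemma functions in H^1_0 are in L^4
([H10_L4]). Hence the trilinear convection form is continuous on H^1_0; it is
antisymmetric on test functions, so it vanishes on the diagonal ([transport_self]).

The capillary terms: the two integrals of H(phi) grad H(mu) . J(u) and of
H(mu) grad H(phi) . J(u) must be opposite. Both integrands are integrable because the
momentum and phase equations express them by integrable terms, but the product
f g = H(phi) H(mu) is not known to be in H^1. It is replaced by T(f) T(g) with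
T(a) = a/(1 + c a^2); the solenoidal field J(u) is orthogonal to the gradient of this
product, and c tends to 0 by dominated convergence
([solenoidal_orthogonal_product]). The chain rule behind it
([truncated_product_wderiv]) is proved with difference quotients: for functions with two
integrable weak derivatives these converge in L^1 on compact sets at a linear rate, by
Steklov's formula f(x + h e_i) - f(x) = int_0^h (d_i f)(x + s e_i) ds ([steklov]).

The remaining terms use integration by parts between H^1 and H^1_0, by density
([integration_by_parts_H10]), and the almost everywhere uniqueness of weak derivatives,
which follows from the uniqueness of measures given on boxes ([fundamental_lemma]). *)

(** * Boxes *)

Section rV_boxes.
Context {R : realType} {d : nat}.
Local Notation mu := (lebesgue_rV R d).

Definition obox (a b : 'rV[R]_d) : set 'rV[R]_d :=
  [set x | forall i, a 0 i < x 0 i < b 0 i].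

Definition cbox (a b : 'rV[R]_d) : set 'rV[R]_d :=
  [set x | forall i, a 0 i <= x 0 i <= b 0 i].

Lemma coord_le_norm (x : 'rV[R]_d) i : `|x 0 i| <= `|x|.
Proof. 
rewrite [leRHS]/Num.norm /= mx_normrE.
exact: (le_bigmax _ (fun ij : 'I_1 * 'I_d => `|x ij.1 ij.2|) (0, i)).
Qed.

Lemma norm_delta_le1 (i : 'I_d) : `|delta_mx 0 i : 'rV[R]_d| <= 1.
Proof.
rewrite /Num.norm/= mx_normrE; apply: bigmax_le => //= -[a b] _ /=.
by rewrite mxE; case: (_ && _); rewrite ?normr1 ?normr0.
Qed.

Lemma norm_lt_coord (x : 'rV[R]_d) e :
  0 < e -> (forall i, `|x 0 i| < e) -> `|x| < e.
Proof.
move=> e0 xe; rewrite [ltLHS]/Num.norm /= mx_normrE.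
by apply/bigmax_ltP; split=> // -[i j] _ /=; rewrite ord1.
Qed.

Lemma openP (U : set 'rV[R]_d) : open U <->
  forall x, U x -> exists2 e : R, 0 < e & forall y, `|x - y| < e -> U y.
Proof.
split=> [oU x Ux|H].
  have /nbhs_ballP[e e0 xe] := open_nbhs_nbhs (conj oU Ux).
  by exists e => // y xy; apply: xe; rewrite -ball_normE.
rewrite openE => x /H[e e0 xe]; apply/nbhs_ballP; exists e => // y.
by rewrite -ball_normE => /xe.
Qed.

Lemma obox_setI a b a' b' : obox a b `&` obox a' b' =
  obox (\row_i Num.max (a 0 i) (a' 0 i)) (\row_i Num.min (b 0 i) (b' 0 i)).
Proof.
apply/seteqP; split => x /=.
  move=> [xab xab'] i; rewrite !mxE gt_max lt_min.
  by have /andP[-> ->] := xab i; have /andP[-> ->] := xab' i.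
move=> H; split => i; have := H i; rewrite !mxE gt_max lt_min => /andP[/andP[? ?] /andP[? ?]];
  by apply/andP.
Qed.

Definition oboxes : set (set 'rV[R]_d) := [set B | exists a b, B = obox a b].

Lemma obox_sub_cbox a b : obox a b `<=` cbox a b.
Proof. by move=> x H i; have /andP[/ltW -> /ltW ->] := H i. Qed.

(** Corners with rational coordinates leave countably many boxes. The closed boxes
are required to stay inside the open set so that they are compact subsets of it,
on which locally integrable functions are integrable. *)
Lemma open_bigcup_obox (U : set 'rV[R]_d) : open U ->
  exists F : nat -> set 'rV[R]_d,
    (forall n, (exists a b, F n = obox a b /\ cbox a b `<=` U) \/ F n = set0)
    /\ U = \bigcup_n F n.
Proof.
move=> /openP oU.
pose B (p : 'rV[rat]_d * 'rV[rat]_d) := obox (map_mx ratr p.1) (map_mx ratr p.2).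
pose K (p : 'rV[rat]_d * 'rV[rat]_d) := cbox (map_mx ratr p.1) (map_mx ratr p.2).
exists (fun n => if @unpickle ('rV[rat]_d * 'rV[rat]_d)%type n is Some p then
   if `[< K p `<=` U >] then B p else set0 else set0).
split.
  move=> n; case: unpickle => [p|]; last by right.
  by case: asboolP => BU; [left; exists (map_mx ratr p.1), (map_mx ratr p.2)|right].
apply/seteqP; split => x; last first.
  move=> [n _]; case: unpickle => [p|//]; case: asboolP => // + /obox_sub_cbox Bx.
  exact.
move=> /[dup] Ux /oU[e e0 xe].
have /choice[l hl] : forall i, exists q : rat, ratr q \in `]x 0 i - e, x 0 i[.
  by move=> i; apply: rat_in_itvoo; rewrite ltrBlDr ltrDl.
have /choice[r hr] : forall i, exists q : rat, ratr q \in `]x 0 i, x 0 i + e[.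
  by move=> i; apply: rat_in_itvoo; rewrite ltrDl.
exists (pickle (\row_i l i, \row_i r i)) => //.
rewrite pickleK; case: asboolP => [_|[]].
  move=> i; rewrite !mxE; have := hl i; have := hr i; rewrite !in_itv /=.
  by move=> /andP[-> _] /andP[_ ->].
move=> y By; apply: xe; apply: norm_lt_coord => // i.
rewrite !mxE ltr_norml; have := By i; rewrite !mxE; have := hl i; have := hr i; rewrite !in_itv /=.
by move=> /andP[? ?] /andP[? ?] /andP[? ?]; lra.
Qed.

Lemma measurable_box (A : 'I_d -> set R) :
  (forall i, measurable (A i : set (measurableTypeR R))) ->
  measurable [set x : 'rV[R]_d | forall i, A i (x 0 i)].
Proof.
move=> mA; rewrite (_ : [set x | _] = \bigcap_(i in [set: 'I_d])
    (@rV_coord R d i @^-1` A i)); last first.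
  by apply/seteqP; split => [x Bx i _|x Bx i]; [exact: Bx|exact: (Bx i I)].
apply: fin_bigcap_measurable => // i _; rewrite -[X in measurable X]setTI.
exact: measurable_rV_coord.
Qed.

Lemma oboxE a b : obox a b = [set x | forall i, `]a 0 i, b 0 i[%classic (x 0 i)].
Proof. by apply/seteqP; split => x H i; have := H i; rewrite /= in_itv. Qed.

Lemma cboxE a b : cbox a b = [set x | forall i, `[a 0 i, b 0 i]%classic (x 0 i)].
Proof. by apply/seteqP; split => x H i; have := H i; rewrite /= in_itv. Qed.

Lemma measurable_obox a b : measurable (obox a b).
Proof.
rewrite oboxE; apply: (@measurable_box (fun i => `]a 0 i, b 0 i[%classic)) => i.
exact: measurable_itv.
Qed.

Lemma measurable_cbox a b : measurable (cbox a b).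
Proof.
rewrite cboxE; apply: (@measurable_box (fun i => `[a 0 i, b 0 i]%classic)) => i.
exact: measurable_itv.
Qed.

Lemma compact_cbox a b : compact (cbox a b).
Proof.
rewrite cboxE; apply: (@rV_compact _ _ (fun i => `[a 0 i, b 0 i]%classic)) => i.
exact: segment_compact.
Qed.

Lemma lebesgue_obox a b : mu (obox a b) =
  (\prod_(i < d) (if (a 0%R i < b 0%R i)%R then (b 0%R i - a 0%R i)%R%:E else 0))%E.
Proof.
rewrite oboxE (lebesgue_rV_box (A := fun i => `]a 0 i, b 0 i[%classic)); last by move=> i; exact: measurable_itv.
by apply: eq_bigr => i _; rewrite lebesgue_measure_itv /= lte_fin EFinB.
Qed.

Lemma lebesgue_cbox_fin a b : (mu (cbox a b) < +oo)%E.
Proof.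
rewrite cboxE (lebesgue_rV_box (A := fun i => `[a 0 i, b 0 i]%classic)); last by move=> i; exact: measurable_itv.
suff : ((\prod_(i < d) lebesgue_measure (`[a 0%R i, b 0%R i]%classic : set (measurableTypeR R)))%E \is a fin_num).
  by rewrite ge0_fin_numE//; apply: prode_ge0.
apply: prode_fin_num => i _; rewrite lebesgue_measure_itv /=.
by case: ifP.
Qed.

Lemma oboxes_generate : @measurable _ 'rV[R]_d = <<s oboxes>>.
Proof.
apply/seteqP; split; last first.
  apply: smallest_sub; first exact: sigma_algebra_measurable.
  by move=> _ [a [b ->]]; exact: measurable_obox.
have openG (U : set 'rV[R]_d) : open U -> <<s oboxes>> U.
  move=> /open_bigcup_obox[F [FB ->]].
  apply: sigma_algebra_bigcup => n; have [[a [b [-> _]]]|->] := FB n.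
    by apply: sub_sigma_algebra; exists a, b.
  exact: sigma_algebra0.
apply: smallest_sub; first exact: smallest_sigma_algebra.
rewrite -bigcup_seq => _ [i _ [Y mY <-]] /=; rewrite setTI.
move: mY; rewrite /measurable /= => mY.
suff : (@ocitv R).-sigma.-measurable `<=` [set Y | <<s oboxes>> (@rV_coord R d i @^-1` Y)] by exact.
rewrite RGenOInfty.measurableE; apply: smallest_sub.
  split=> [|B mB|F mF] /=.
  - by rewrite preimage_set0; exact: sigma_algebra0.
  - by rewrite setTD preimage_setC; exact: sigma_algebraC.
  - by rewrite preimage_bigcup; exact: sigma_algebra_bigcup.
move=> _ [r ->] /=; apply: openG.
apply: (@open_comp _ _ (fun x : 'rV[R]_d => x 0 i)); last exact: interval_open.
by move=> x _; exact: coord_continuous.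
Qed.

End rV_boxes.

(** * Lebesgue measure on row vectors *)

Section rV_measure.
Context {R : realType} {d : nat}.
Local Notation mu := (lebesgue_rV R d).

Lemma open_measurable_rV (U : set 'rV[R]_d) : open U -> measurable U.
Proof.
move=> /open_bigcup_obox[F [FB ->]]; apply: bigcupT_measurable => n.
by have [[a [b [-> _]]]|->] := FB n; [exact: measurable_obox|exact: measurable0].
Qed.

Lemma closed_measurable_rV (F : set 'rV[R]_d) : closed F -> measurable F.
Proof.
move=> cF; rewrite -[F]setCK; apply: measurableC; apply: open_measurable_rV.
exact: closed_openC.
Qed.

Lemma compact_measurable_rV (K : set 'rV[R]_d) : compact K -> measurable K.
Proof.
by move=> cK; apply: closed_measurable_rV; apply: compact_closed => //.
Qed.

Lemma compact_sub_cbox (K : set 'rV[R]_d) : compact K ->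
  exists M : R, 0 < M /\ K `<=` cbox (const_mx (- M)) (const_mx M).
Proof.
move=> /compact_bounded[M [_ HM]]; exists (`|M| + 1); split.
  by rewrite ltr_wpDl.
move=> x Kx i; rewrite !mxE -ler_norml.
apply: le_trans (coord_le_norm x i) _; apply: HM => //.
by rewrite (le_lt_trans (ler_norm M))// ltrDl.
Qed.

Lemma compact_lebesgue_fin (K : set 'rV[R]_d) : compact K -> (mu K < +oo)%E.
Proof.
move=> cK; have [M [_ KM]] := compact_sub_cbox cK.
apply: le_lt_trans (lebesgue_cbox_fin (const_mx (- M)) (const_mx M)).
by apply: le_measure => //; rewrite inE; [exact: compact_measurable_rV|exact: measurable_cbox].
Qed.

Lemma continuous_measurable_rV (f : 'rV[R]_d -> R) :
  continuous f -> measurable_fun [set: 'rV[R]_d] f.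
Proof.
move=> cf; apply: (measurability _ (RGenOpens.measurableE R)).
move=> _ [_ [x [y ->]] <-]; rewrite setTI; apply: open_measurable_rV.
by apply: open_comp => //; exact: interval_open.
Qed.

Lemma lebesgue_obox_fin (a b : 'rV[R]_d) : (mu (obox a b) < +oo)%E.
Proof.
apply: le_lt_trans (lebesgue_cbox_fin a b).
by apply: le_measure; rewrite ?inE; [exact: measurable_obox|exact: measurable_cbox|
  exact: obox_sub_cbox].
Qed.

(** Open boxes form a pi-system that generates the measurable sets, and R^d is a
countable union of boxes of finite measure. *)
Lemma rV_measure_unique (m1 m2 : {measure set 'rV[R]_d -> \bar R}) :
  (forall a b, m1 (obox a b) = m2 (obox a b)) ->
  (forall a b, (m1 (obox a b) < +oo)%E) ->
  forall A, measurable A -> m1 A = m2 A.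
Proof.
move=> mE moo A mA.
pose g n := obox (const_mx (- n%:R)) (const_mx n%:R) : set 'rV[R]_d.
apply: (measure_unique (@oboxes R d) g) => //.
- exact: oboxes_generate.
- by move=> _ _ [a [b ->]] [a' [b' ->]]; rewrite obox_setI; do 2 eexists.
- by move=> n; do 2 eexists.
- rewrite -subTset => x _; exists (Num.truncn `|x|).+1 => //= i.
  rewrite !mxE -ltr_norml (le_lt_trans (coord_le_norm x i))//.
  exact: truncnS_gt.
- by move=> _ [a [b ->]].
- by move=> n; exact: moo.
Qed.

Lemma measurable_shift (v : 'rV[R]_d) :
  measurable_fun [set: 'rV[R]_d] (fun x : 'rV[R]_d => x + v).
Proof.
apply: measurable_rVP => i.
rewrite (_ : _ \o _ = fun x : 'rV[R]_d => x 0 i + v 0 i); last first.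
  by apply/funext => x; rewrite /= /rV_coord mxE.
by apply: measurable_funD => //; exact: measurable_rV_coord.
Qed.

Lemma preimage_shift_obox (v a b : 'rV[R]_d) :
  (fun x : 'rV[R]_d => x + v) @^-1` obox a b = obox (a - v) (b - v).
Proof.
by apply/seteqP; split => x H i; have := H i; rewrite !mxE ltrBlDr ltrBrDr.
Qed.

(** Translations preserve the volume of boxes, hence the measure. *)
Lemma lebesgue_shift (v : 'rV[R]_d) (A : set 'rV[R]_d) : measurable A ->
  pushforward mu (fun x : 'rV[R]_d => x + v) A = mu A.
Proof.
pose ms := isMeasurableFun.Build _ _ _ _ _ (measurable_shift v).
pose sh : {mfun 'rV[R]_d >-> 'rV[R]_d} := HB.pack (fun x : 'rV[R]_d => x + v) ms.
apply: (rV_measure_unique (m1 := pushforward mu sh)); last first.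
  move=> a b; rewrite /= /pushforward preimage_shift_obox; exact: lebesgue_obox_fin.
move=> a b; rewrite /= /pushforward preimage_shift_obox.
rewrite !lebesgue_obox; apply: eq_bigr => i _; rewrite !mxE.
by rewrite ltrD2r opprD opprK addrACA addNr addr0.
Qed.

Lemma ge0_integral_shift (v : 'rV[R]_d) (f : 'rV[R]_d -> \bar R) :
  measurable_fun setT f -> (forall x, 0 <= f x)%E ->
  (\int[mu]_x f (x + v)%R = \int[mu]_x f x)%E.
Proof.
move=> mf f0; have := ge0_integral_pushforward (measurable_shift v) mu measurableT mf.
rewrite preimage_setT => <- //.
apply: eq_measure_integral; last by move=> mv A mA _; exact: lebesgue_shift.
exact: measurable_shift.
Qed.

Lemma integral_shift (v : 'rV[R]_d) (f : 'rV[R]_d -> \bar R) :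
  measurable_fun setT f -> (\int[mu]_x f (x + v)%R = \int[mu]_x f x)%E.
Proof.
move=> mf; rewrite [LHS]integralE [RHS]integralE; congr (_ - _)%E.
  rewrite -(ge0_integral_shift v (f := f^\+%E)) //; first by under eq_integral do rewrite funepos_comp.
  exact: measurable_funepos.
rewrite -(ge0_integral_shift v (f := f^\-%E)) //; first by under eq_integral do rewrite funeneg_comp.
exact: measurable_funeneg.
Qed.

Lemma integrable_shift (v : 'rV[R]_d) (f : 'rV[R]_d -> \bar R) :
  mu.-integrable setT f -> mu.-integrable setT (fun x : 'rV[R]_d => f (x + v)).
Proof.
move=> /integrableP[mf foo]; apply/integrableP; split.
  by apply: measurableT_comp => //; exact: measurable_shift.
rewrite (integral_shift v (f := fun x => `|f x|%E))//.
exact: measurableT_comp.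
Qed.

End rV_measure.

(** * Integrable and square integrable functions *)

Section real_integrals.
Context {R : realType} {dT : measure_display} {T : measurableType dT}.
Variables (mu : {measure set T -> \bar R}) (D : set T).
Hypothesis mD : measurable D.
Implicit Types f g : T -> R.

Definition L1 (f : T -> R) := mu.-integrable D (EFin \o f).
(** When [mu] is the Lebesgue measure on row vectors, this unfolds to [inL2]. *)
Definition L2 (f : T -> R) :=
  measurable_fun D f /\ mu.-integrable D (fun x => (f x ^+ 2)%:E).

Lemma L1_measurable f : L1 f -> measurable_fun D f.
Proof. by move=> /integrableP[/measurable_EFinP]. Qed.

Lemma L2_measurable f : L2 f -> measurable_fun D f.
Proof. by case. Qed.

Lemma L1_le f g : measurable_fun D f -> L1 g ->
  (forall x, D x -> `|f x| <= g x) -> L1 f.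
Proof.
move=> mf ig fg; apply: le_integrable ig => //; first exact/measurable_EFinP.
by move=> x Dx /=; rewrite lee_fin (le_trans (fg x Dx))// ler_norm.
Qed.

Lemma L1_eq f g : {in D, f =1 g} -> L1 f -> L1 g.
Proof.
move=> fg; apply: eq_integrable => // x xD.
by rewrite /= fg.
Qed.

Lemma L1D f g : L1 f -> L1 g -> L1 (fun x => f x + g x).
Proof.
move=> If Ig; have := integrableD mD If Ig.
by apply: eq_integrable.
Qed.

Lemma L1Z c f : L1 f -> L1 (fun x => c * f x).
Proof.
move=> If; have := integrableZl mD c If.
by apply: eq_integrable.
Qed.

Lemma L1N f : L1 f -> L1 (fun x => - f x).
Proof.
move=> /(L1Z (-1)); apply: L1_eq => x _; by rewrite mulN1r.
Qed.

Lemma L1B f g : L1 f -> L1 g -> L1 (fun x => f x - g x).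
Proof. by move=> If Ig; apply: L1D => //; apply: L1N. Qed.

Lemma L1_norm f : L1 f -> L1 (fun x => `|f x|).
Proof. by move=> /integrable_abse; apply: eq_integrable. Qed.

Lemma L1_0 : L1 (fun=> 0).
Proof. by have := integrable0 mu D; apply: eq_integrable. Qed.

Lemma L1_indic (K : set T) : measurable K -> (mu K < +oo)%E ->
  mu.-integrable setT (fun x => (\1_K x)%:E).
Proof.
move=> mK Koo; apply/integrableP; split.
  by apply/measurable_EFinP; exact: measurable_indic.
under eq_integral do rewrite gee0_abs ?lee_fin//.
by rewrite integral_indic// setIT.
Qed.

Lemma L1_sum I (s : seq I) (P : pred I) (h : I -> T -> R) :
  (forall i, P i -> L1 (h i)) -> L1 (fun x => \sum_(i <- s | P i) h i x).
Proof.
move=> H; elim: s => [|i s IH].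
  by apply: L1_eq L1_0 => x _; rewrite big_nil.
have [Pi|Pi] := boolP (P i).
  by apply: L1_eq (L1D (H i Pi) IH) => x _; rewrite big_cons Pi.
by apply: L1_eq IH => x _; rewrite big_cons (negbTE Pi).
Qed.

Lemma Rintegral_sum I (s : seq I) (P : pred I) (h : I -> T -> R) :
  (forall i, P i -> L1 (h i)) ->
  \int[mu]_(x in D) (\sum_(i <- s | P i) h i x) =
  \sum_(i <- s | P i) \int[mu]_(x in D) h i x.
Proof.
move=> H; elim: s => [|i s IH].
  rewrite big_nil; under eq_Rintegral do rewrite big_nil.
  by rewrite Rintegral_cst// mul0r.
rewrite big_cons; have [Pi|Pi] := boolP (P i).
  under eq_Rintegral do rewrite big_cons Pi.
  by rewrite RintegralD ?IH//; [exact: H|exact: L1_sum].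
by under eq_Rintegral do rewrite big_cons (negbTE Pi).
Qed.

Lemma L1_ae f g : {ae mu, forall x, D x -> f x = g x} ->
  measurable_fun D g -> L1 f -> L1 g.
Proof.
move=> fg mg /integrableP[mf foo]; apply/integrableP; split.
  exact/measurable_EFinP.
rewrite (ae_eq_integral (fun x => `|(EFin \o f) x|%E)) //.
- by apply: measurableT_comp => //; exact/measurable_EFinP.
- by apply: measurableT_comp.
- by apply: filterS fg => x fg Dx; rewrite /= fg.
Qed.

Lemma Rintegral_ae f g : {ae mu, forall x, D x -> f x = g x} ->
  measurable_fun D f -> measurable_fun D g ->
  \int[mu]_(x in D) f x = \int[mu]_(x in D) g x.
Proof.
move=> fg mf mg; congr fine; apply: ae_eq_integral => //.
- exact/measurable_EFinP.
- exact/measurable_EFinP.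
- by apply: filterS fg => x fg Dx; rewrite fg.
Qed.

Lemma L2_L1 f : L2 f -> L1 (fun x => f x ^+ 2).
Proof. by case. Qed.

Lemma L2M_L1 f g : L2 f -> L2 g -> L1 (fun x => f x * g x).
Proof.
move=> [mf f2] [mg g2].
apply: (@L1_le _ (fun x => f x ^+ 2 + g x ^+ 2)); first exact: measurable_funM.
  exact: L1D.
move=> x _; rewrite ler_norml; apply/andP; split; nra.
Qed.

Lemma L2_le f g : measurable_fun D f -> L2 g ->
  (forall x, D x -> `|f x| <= `|g x|) -> L2 f.
Proof.
move=> mf [mg g2] fg; split=> //.
apply: (@L1_le (fun x => f x ^+ 2) _ _ g2).
  exact: measurable_funX.
move=> x Dx; rewrite normrX -[leRHS]real_normK ?num_real//.
by rewrite ler_sqr ?nnegrE// fg.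
Qed.

Lemma L2_eq f g : {in D, f =1 g} -> L2 f -> L2 g.
Proof.
move=> fg [mf f2]; split.
  by apply: eq_measurable_fun mf.
by apply: eq_integrable f2 => // x xD; rewrite fg.
Qed.

Lemma L2D f g : L2 f -> L2 g -> L2 (fun x => f x + g x).
Proof.
move=> Hf Hg; split; first by apply: measurable_funD; apply: L2_measurable.
have := L1D (L1D (L2_L1 Hf) (L2_L1 Hg)) (L1Z 2 (L2M_L1 Hf Hg)).
apply: L1_eq => x _; ring.
Qed.

Lemma L2Z c f : L2 f -> L2 (fun x => c * f x).
Proof.
move=> Hf; split; first by apply: measurable_funM => //; exact: L2_measurable.
by have := L1Z (c ^+ 2) (L2_L1 Hf); apply: L1_eq => x _; ring.
Qed.

Lemma L2N f : L2 f -> L2 (fun x => - f x).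
Proof. by move=> /(L2Z (-1)); apply: L2_eq => x _; rewrite mulN1r. Qed.

Lemma L2B f g : L2 f -> L2 g -> L2 (fun x => f x - g x).
Proof. by move=> Hf Hg; apply: L2D => //; apply: L2N. Qed.

Lemma L2_0 : L2 (fun=> 0).
Proof.
split => //; apply: L1_eq L1_0 => x _; by rewrite /= expr0n.
Qed.

Lemma L2_sum I (s : seq I) (P : pred I) (h : I -> T -> R) :
  (forall i, P i -> L2 (h i)) -> L2 (fun x => \sum_(i <- s | P i) h i x).
Proof.
move=> H; elim: s => [|i s IH].
  by apply: L2_eq L2_0 => x _; rewrite big_nil.
have [Pi|Pi] := boolP (P i).
  by apply: L2_eq (L2D (H i Pi) IH) => x _; rewrite big_cons Pi.
by apply: L2_eq IH => x _; rewrite big_cons (negbTE Pi).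
Qed.

Lemma L2_bounded C f g : measurable_fun D g -> (forall x, D x -> `|g x| <= C) ->
  L2 f -> L2 (fun x => g x * f x).
Proof.
move=> mg gC Hf; apply: (L2_le _ (L2Z C Hf)).
  by apply: measurable_funM => //; exact: L2_measurable.
move=> x Dx; rewrite !normrM ler_wpM2r// (le_trans (gC _ Dx))//.
exact: ler_norm.
Qed.

Lemma L1_bounded C f g : measurable_fun D g -> (forall x, D x -> `|g x| <= C) ->
  L1 f -> L1 (fun x => g x * f x).
Proof.
move=> mg gC Hf; apply: (L1_le _ (L1Z C (L1_norm Hf))).
  by apply: measurable_funM => //; exact: L1_measurable.
by move=> x Dx; rewrite normrM ler_wpM2r// (le_trans (gC _ Dx)).
Qed.

Lemma L2_ae f g : {ae mu, forall x, D x -> f x = g x} ->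
  measurable_fun D g -> L2 f -> L2 g.
Proof.
move=> fg mg Hf; split => //.
apply: (L1_ae _ _ (L2_L1 Hf)); last exact: measurable_funX.
by apply: filterS fg => x fg Dx; rewrite fg.
Qed.

Lemma Rintegral_sqr_ge0 f : 0 <= \int[mu]_(x in D) f x ^+ 2.
Proof. by apply: Rintegral_ge0 => x _; exact: sqr_ge0. Qed.

Lemma quadratic_discriminant (a b c : R) : 0 <= a ->
  (forall t, 0 <= a * t ^+ 2 + 2 * b * t + c) -> b ^+ 2 <= a * c.
Proof.
move=> a0 H; have [a_eq0|a_neq0] := eqVneq a 0.
  have [->|b0] := eqVneq b 0; first by rewrite expr0n /= a_eq0 mul0r.
  have := H (- (c + 1) / (2 * b)); rewrite a_eq0 mul0r add0r.
  have -> : 2 * b * (- (c + 1) / (2 * b)) = - (c + 1).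
    by rewrite mulrC divfK// mulf_neq0// pnatr_eq0.
  lra.
have a_gt0 : 0 < a by rewrite lt0r a_neq0.
have := H (- b / a).
have -> : a * (- b / a) ^+ 2 + 2 * b * (- b / a) + c = (a * c - b ^+ 2) / a by field.
by rewrite pmulr_lge0 ?invr_gt0// subr_ge0.
Qed.

(** The integral of the square of t f + g is a nonnegative quadratic polynomial in t,
so its discriminant is not positive. *)
Lemma cauchy_schwarz f g : L2 f -> L2 g ->
  (\int[mu]_(x in D) (f x * g x)) ^+ 2 <=
  \int[mu]_(x in D) f x ^+ 2 * \int[mu]_(x in D) g x ^+ 2.
Proof.
move=> Hf Hg; apply: quadratic_discriminant; first exact: Rintegral_sqr_ge0.
move=> t; rewrite [leRHS](_ : _ = \int[mu]_(x in D) (t * f x + g x) ^+ 2).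
  exact: Rintegral_sqr_ge0.
have I1 := L2_L1 Hf; have I2 := L2_L1 Hg; have I3 := L2M_L1 Hf Hg.
under [RHS]eq_Rintegral => x _.
  rewrite (_ : (t * f x + g x) ^+ 2 = t ^+ 2 * f x ^+ 2 + 2 * t * (f x * g x) + g x ^+ 2); last by ring.
  over.
rewrite RintegralD//; last by apply: L1D; apply: L1Z.
rewrite RintegralD//; [|exact: L1Z..].
rewrite !RintegralZl//; ring.
Qed.

Lemma le_Rintegral_ae f g : L1 f -> L1 g ->
  {ae mu, forall x, D x -> f x <= g x} ->
  \int[mu]_(x in D) f x <= \int[mu]_(x in D) g x.
Proof.
move=> If Ig fg; rewrite -subr_ge0 -RintegralB//.
rewrite (@Rintegral_ae _ (fun x => `|g x - f x|)).
- by apply: Rintegral_ge0.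
- by apply: filterS fg => x fg Dx; rewrite ger0_norm// subr_ge0 fg.
- by apply: L1_measurable; exact: L1B.
- by apply: measurableT_comp => //; apply: L1_measurable; exact: L1B.
Qed.

Lemma Rintegral_subset_le (E : set T) f : measurable E -> E `<=` D -> L1 f ->
  (forall x, D x -> 0 <= f x) ->
  \int[mu]_(x in E) f x <= \int[mu]_(x in D) f x.
Proof.
move=> mE ED If f0; have IE : mu.-integrable E (EFin \o f) by exact: integrableS If.
rewrite -lee_fin !fineK; try exact: integrable_fin_num.
by apply: ge0_subset_integral => //; have /integrableP[] := If.
Qed.

Lemma Rintegral_dominated (f_ : nat -> T -> R) f g :
  (forall n, measurable_fun D (f_ n)) -> measurable_fun D f ->
  {ae mu, forall x, D x -> f_ n x @[n --> \oo] --> f x} ->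
  L1 g -> (forall x n, D x -> `|f_ n x| <= g x) ->
  L1 f /\ \int[mu]_(x in D) f_ n x @[n --> \oo] --> \int[mu]_(x in D) f x.
Proof.
move=> mf_ mf ff Ig fg.
have [] := @dominated_convergence _ T R mu D mD (fun n => EFin \o f_ n) (EFin \o f) (EFin \o g) _ _ _ Ig.
- by move=> n; exact/measurable_EFinP.
- exact/measurable_EFinP.
- apply: filterS ff => x ff Dx; apply: cvg_EFin; first exact: nearW.
  exact: ff.
- by apply: aeW => x n Dx; rewrite /= lee_fin fg.
move=> If _ cv; split=> //.
apply: (fine_cvg (a := \int[mu]_(x in D) f x)); rewrite fineK; last exact: integrable_fin_num.
exact: cv.
Qed.

End real_integrals.

(** * Test functions *)

Section test_functions.
Context {R : realType} {d : nat}.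
Local Notation mu := (lebesgue_rV R d).
Implicit Types (O : set 'rV[R]_d) (f g psi : 'rV[R]_d -> R) (i : 'I_d).

(** The regularity of test functions, without the condition on the support. *)
Definition C1 f := (forall x, differentiable f x) /\
  forall i, continuous (partial i f).

Lemma C1_continuous f : C1 f -> continuous f.
Proof. by move=> [df _] x; exact: differentiable_continuous. Qed.

Lemma C1_derivable f x v : C1 f -> derivable f x v.
Proof. by move=> [df _]; exact: diff_derivable. Qed.

Lemma test_C1 O psi : test_fun O psi -> C1 psi.
Proof. by case. Qed.

Lemma partialB f g i : C1 f -> C1 g ->
  partial i (f \- g) = partial i f \- partial i g.
Proof. by move=> Cf Cg; apply/funext => x; rewrite /partial deriveB //; exact: C1_derivable. Qed.

Lemma partialM f g i : C1 f -> C1 g ->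
  partial i (f \* g) = fun x => f x * partial i g x + g x * partial i f x.
Proof.
move=> Cf Cg; apply/funext => x; rewrite /partial deriveM //; exact: C1_derivable.
Qed.

Lemma partial_cst c i : partial i (cst c : 'rV[R]_d -> R) = cst 0.
Proof. by apply/funext => x; rewrite /partial derive_cst. Qed.

Lemma C1_cst c : C1 (cst c).
Proof.
split=> [x|i]; first exact: differentiable_cst.
by rewrite partial_cst; exact: cst_continuous.
Qed.

Lemma C1B f g : C1 f -> C1 g -> C1 (f \- g).
Proof.
move=> Cf Cg; split=> [x|i].
  by apply: differentiableB; [exact: Cf.1|exact: Cg.1].
rewrite partialB// => x.
apply: (@continuousB _ _ _ (partial i f) (partial i g)); [exact: (Cf.2 i x)|exact: (Cg.2 i x)].
Qed.

Lemma C1M f g : C1 f -> C1 g -> C1 (f \* g).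
Proof.
move=> Cf Cg; split=> [x|i].
  by apply: differentiableM; [exact: Cf.1|exact: Cg.1].
rewrite partialM// => x.
apply: (@continuousD _ _ _ (f \* partial i g) (g \* partial i f)); apply: continuousM.
- exact: (C1_continuous Cf).
- exact: (Cg.2 i x).
- exact: (C1_continuous Cg).
- exact: (Cf.2 i x).
Qed.

Lemma C1_prod I (s : seq I) (F : I -> 'rV[R]_d -> R) :
  (forall j, C1 (F j)) -> C1 (fun x => \prod_(i <- s) F i x).
Proof.
move=> CF; elim: s => [|j s IH].
  by under eq_fun do rewrite big_nil; exact: C1_cst.
by under eq_fun do rewrite big_cons; exact: C1M.
Qed.

Lemma test_out O psi x : test_fun O psi -> ~ O x -> psi x = 0.
Proof.
move=> [_ _ _ sO] Ox; apply/eqP/negPn/negP => psi0; apply: Ox; apply: sO.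
exact: subset_closure.
Qed.

Lemma partial_out psi x i : ~ closure [set x | psi x != 0] x ->
  partial i psi x = 0.
Proof.
move=> /= xS; rewrite /partial (near_eq_derive (g := cst 0)) ?derive_cst//.
have : nbhs x (~` closure [set x | psi x != 0]).
  apply: open_nbhs_nbhs; split=> //; apply: closed_openC; exact: closed_closure.
apply: filterS => y yS; apply/eqP/negPn/negP => psi0; apply: yS.
exact: subset_closure.
Qed.

Lemma test_partial_out O psi x i : test_fun O psi -> ~ O x ->
  partial i psi x = 0.
Proof. by move=> [_ _ _ sO] Ox; apply: partial_out => /sO. Qed.

Lemma bounded_compact_support f (K : set 'rV[R]_d) : continuous f -> compact K ->
  (forall x, ~ K x -> f x = 0) -> exists2 C, 0 <= C & forall x, `|f x| <= C.
Proof.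
move=> cf cK fK.
have /compact_bounded[M [_ HM]] : compact (f @` K).
  by apply: continuous_compact => //; exact: continuous_subspaceT.
exists (`|M| + 1) => [|x]; first by rewrite addr_ge0.
have [Kx|/fK ->] := pselect (K x); last by rewrite normr0 addr_ge0.
apply: HM; last by exists x.
by rewrite (le_lt_trans (ler_norm M))// ltrDl.
Qed.

Lemma support_out psi x : ~ closure [set x | psi x != 0] x -> psi x = 0.
Proof.
by move=> xS; apply/eqP/negPn/negP => psi0; apply: xS; exact: subset_closure.
Qed.

Lemma test_bounded O psi : test_fun O psi ->
  exists2 C, 0 <= C & forall x, `|psi x| <= C.
Proof.
move=> tp; have [_ _ cK _] := tp.
apply: (bounded_compact_support _ cK); first exact/C1_continuous/test_C1/tp.
exact: support_out.
Qed.

Lemma test_partial_bounded O psi i : test_fun O psi ->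
  exists2 C, 0 <= C & forall x, `|partial i psi x| <= C.
Proof.
move=> tp; have [_ cp cK _] := tp.
apply: (bounded_compact_support (cp i) cK) => x; exact: partial_out.
Qed.

Lemma bounded_compact_support_L2 f (K D : set 'rV[R]_d) C :
  measurable D -> measurable_fun setT f -> compact K ->
  (forall x, ~ K x -> f x = 0) -> (forall x, `|f x| <= C) -> L2 mu D f.
Proof.
move=> mD mf cK fK fC.
have mK := compact_measurable_rV cK.
have I1 : L1 mu D (\1_K).
  apply: (integrableS measurableT) => //.
  have := compact_lebesgue_fin cK; exact: L1_indic.
apply: (L2_le mD (g := fun x => C * \1_K x)); first exact: measurable_funTS.
  apply: (L2Z mD); split; first exact: (L1_measurable I1).
  by apply: (L1_eq mD _ I1) => x _ /=; rewrite indicE; case: (_ \in _); rewrite ?expr1n ?expr0n.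
move=> x _; rewrite indicE; case: (boolP (x \in K)) => [_|/negP].
  by rewrite mulr1 (le_trans (fC x))// ler_norm.
by rewrite inE => /fK ->; rewrite normr0.
Qed.

Lemma bounded_compact_support_L1 f (K D : set 'rV[R]_d) C :
  measurable D -> measurable_fun setT f -> compact K ->
  (forall x, ~ K x -> f x = 0) -> (forall x, `|f x| <= C) -> L1 mu D f.
Proof.
move=> mD mf cK fK fC.
have mK := compact_measurable_rV cK.
have I1 : L1 mu D (\1_K).
  apply: (integrableS measurableT) => //.
  have := compact_lebesgue_fin cK; exact: L1_indic.
apply: (L1_le mD (g := fun x => C * \1_K x)); first exact: measurable_funTS.
  exact: (L1Z mD).
move=> x _; rewrite indicE; case: (boolP (x \in K)) => [_|/negP].
  by rewrite mulr1.
by rewrite inE => /fK ->; rewrite normr0 mulr0.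
Qed.

Lemma test_measurable O psi D : test_fun O psi -> measurable_fun D psi.
Proof.
move=> tp; apply: measurable_funTS; apply: continuous_measurable_rV.
exact/C1_continuous/test_C1/tp.
Qed.

Lemma test_partial_measurable O psi D i : test_fun O psi ->
  measurable_fun D (partial i psi).
Proof.
move=> [_ cp _ _]; apply: measurable_funTS; exact: continuous_measurable_rV.
Qed.

Lemma test_L2 O psi D : measurable D -> test_fun O psi -> L2 mu D psi.
Proof.
move=> mD tp; have [C _ bp] := test_bounded tp.
have [_ _ cK _] := tp.
apply: (bounded_compact_support_L2 mD _ cK) bp; first exact: test_measurable tp.
exact: support_out.
Qed.

Lemma test_partial_L2 O psi i D : measurable D -> test_fun O psi ->
  L2 mu D (partial i psi).
Proof.
move=> mD tp; have [C _ bp] := test_partial_bounded i tp.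
have [_ _ cK _] := tp.
apply: (bounded_compact_support_L2 mD _ cK) bp; first exact: test_partial_measurable tp.
by move=> x; exact: partial_out.
Qed.

(** The practical way of recognizing a test function: it is enough to know some
compact set outside which it vanishes. *)
Lemma test_sub_support O (K : set 'rV[R]_d) psi : C1 psi -> compact K ->
  closed K -> K `<=` O -> (forall x, ~ K x -> psi x = 0) -> test_fun O psi.
Proof.
move=> [dp cp] cK clK KO psiK.
have sK : closure [set x | psi x != 0] `<=` K.
  rewrite [X in _ `<=` X](closure_id K).1//; apply: closureS => x /= psi0.
  by apply: contrapT => /psiK; move/eqP: psi0.
split=> //; last exact: subset_trans KO.
by apply: subclosed_compact sK => //; exact: closed_closure.
Qed.

Lemma testM O psi f : test_fun O psi -> C1 f -> test_fun O (psi \* f).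
Proof.
move=> tp Cf; have [_ _ cK KO] := tp.
apply: (test_sub_support _ cK _ KO); first by apply: C1M => //; exact: test_C1 tp.
  exact: closed_closure.
by move=> x /support_out /= ->; rewrite mul0r.
Qed.

Lemma testB O psi f : test_fun O psi -> test_fun O f -> test_fun O (psi \- f).
Proof.
move=> tp tf; have [_ _ cK KO] := tp; have [_ _ cL LO] := tf.
apply: (@test_sub_support _ (closure [set x | psi x != 0] `|` closure [set x | f x != 0])).
- by apply: C1B; [exact: test_C1 tp|exact: test_C1 tf].
- exact: compactU.
- by apply: closedU; exact: closed_closure.
- by move=> x [/KO|/LO].
- by move=> x /not_orP[/support_out /= -> /support_out ->]; rewrite subrr.
Qed.

Lemma test0 O : test_fun O (cst 0).
Proof.
apply: (@test_sub_support _ set0) => //; [exact: C1_cst|exact: compact0|exact: closed0].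
Qed.

Lemma testW O O' psi : O `<=` O' -> test_fun O psi -> test_fun O' psi.
Proof. by move=> OO' [? ? ? KO]; split=> //; exact: subset_trans OO'. Qed.

End test_functions.

(** * Bump functions *)

Section positive_part_square.
Context {R : realType}.

(** The square of the positive part is C^1, which is all that is asked of test
functions, so that bumps need no exponential. *)
Definition sqp (y : R) : R := Num.max 0 y ^+ 2.

(** A quadratic bound on the remainder gives the derivative at every point at once,
without separating the point where the positive part has a corner. *)
Lemma is_derive_quadratic (f : R -> R) (y c : R) :
  (forall k, `|f (k + y) - f y - c * k| <= k ^+ 2) -> is_derive y 1 f c.
Proof.
move=> H.
suff Hc : h^-1 *: ((f \o shift y) (h *: 1) - f y) @[h --> 0^'] --> c.
  split; first by apply/cvg_ex; exists c.
  exact/cvg_lim.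
apply/cvgrPdist_le => e e0; near=> h.
have h0 : h != 0 by near: h; exact: nbhs_dnbhs_neq.
have he : `|h| <= e.
  by near: h; apply: dnbhs0_le.
rewrite /= scaler1 distrC.
rewrite (_ : h^-1 *: _ - c = h^-1 * (f (h + y) - f y - c * h)); last first.
  by rewrite /GRing.scale /=; field.
rewrite normrM normfV ler_pdivrMl ?normr_gt0//.
apply: le_trans (H h) _; rewrite -real_normK ?num_real// expr2.
by rewrite ler_wpM2l.
Unshelve. all: by end_near. Qed.

Lemma is_derive_sqp (y : R) : is_derive y 1 sqp (2 * Num.max 0 y).
Proof.
apply: is_derive_quadratic => k; rewrite /sqp ler_norml.
have [] := leP 0 y; have [] := leP 0 (k + y); move=> ? ?; apply/andP; split; nra.
Qed.

Lemma continuous_maxr0 : continuous (fun y : R => Num.max 0 y).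
Proof.
move=> y; apply: continuous_max; [exact: cvg_cst|exact: cvg_id].
Qed.

End positive_part_square.

Section bumps.
Context {R : realType} {d : nat}.
Local Notation mu := (lebesgue_rV R d).
Implicit Types (O : set 'rV[R]_d) (f g psi : 'rV[R]_d -> R) (i : 'I_d) (a b : 'rV[R]_d).

Lemma C1_coord j : C1 (fun x : 'rV[R]_d => x 0 j).
Proof.
have dc x : differentiable (fun x : 'rV[R]_d => x 0 j) x by exact: differentiable_coord.
split=> // i.
rewrite (_ : partial i _ = cst ((delta_mx 0 i : 'rV[R]_d) 0 j)); first exact: cst_continuous.
apply/funext => x; rewrite /partial.
apply: cvg_lim => //; apply: cvg_near_cst; near=> h.
rewrite /= !mxE addrK.
have h0 : h != 0 by near: h; exact: nbhs_dnbhs_neq.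
by rewrite /GRing.scale /= mulKf.
Unshelve. all: by end_near. Qed.

Lemma C1_sqp f : C1 f -> C1 (fun x => sqp (f x)).
Proof.
move=> Cf.
have dsqp y : differentiable (@sqp R) y.
  by apply/derivable1_diffP; have [] := is_derive_sqp y.
have pE i : partial i (fun x => sqp (f x)) = fun x => 2 * Num.max 0 (f x) * partial i f x.
  apply/funext => x; rewrite /partial deriveE; last exact: differentiable_comp (Cf.1 x) (dsqp _).
  rewrite (diff_comp (f := f) (g := @sqp R)) //=; last exact: Cf.1.
  rewrite -(deriveE (f := f)); last exact: Cf.1.
  rewrite -[X in 'd _ _ X]mulr1 [LHS]linearZ /= -deriveE//.
  by have [_ ->] := is_derive_sqp (f x); rewrite /GRing.scale /= mulrC.
split=> [x|i]; first exact: differentiable_comp (Cf.1 x) (dsqp _).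
rewrite pE => x.
apply: (@continuousM _ _ (fun x => 2 * Num.max 0 (f x)) (partial i f)); last exact: (Cf.2 i x).
apply: (@continuousM _ _ (cst 2) (fun x => Num.max 0 (f x))); first by apply: cst_continuous.
apply: continuous_comp; first exact: (C1_continuous Cf).
exact: continuous_maxr0.
Qed.

Definition box_bump (a b : 'rV[R]_d) (x : 'rV[R]_d) : R :=
  \prod_(i < d) sqp ((x 0 i - a 0 i) * (b 0 i - x 0 i)).

Lemma C1_box_bump a b : C1 (box_bump a b).
Proof.
rewrite /box_bump; apply: C1_prod => j; apply: C1_sqp.
apply: (C1M (f := fun x : 'rV[R]_d => x 0 j - a 0 j) (g := fun x : 'rV[R]_d => b 0 j - x 0 j)).
  by apply: (C1B (C1_coord j) (C1_cst (a 0 j))).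
by apply: (C1B (C1_cst (b 0 j)) (C1_coord j)).
Qed.

Lemma box_bump_ge0 a b x : 0 <= box_bump a b x.
Proof. by apply: prodr_ge0 => i _; exact: sqr_ge0. Qed.

Lemma box_bump_gt0 a b x : obox a b x -> 0 < box_bump a b x.
Proof.
move=> H; apply: prodr_gt0 => i _; rewrite exprn_gt0// lt_max.
have /andP[? ?] := H i; apply/orP; right; apply: mulr_gt0; lra.
Qed.

Lemma box_bump_out a b x : (forall i, a 0 i <= b 0 i) ->
  ~ obox a b x -> box_bump a b x = 0.
Proof.
move=> ab /existsNP[i xi]; apply/eqP/prodf_eq0; exists i => //.
rewrite /sqp expf_eq0 /=; apply/eqP/max_idPl.
move/negP: xi; rewrite negb_and -!leNgt => /orP[] h; have := ab i; nra.
Qed.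

Lemma test_box_bump O a b : (forall i, a 0 i <= b 0 i) -> cbox a b `<=` O ->
  test_fun O (box_bump a b).
Proof.
move=> ab abO; apply: (test_sub_support (C1_box_bump a b) (@compact_cbox _ _ a b)) => //.
  by apply: compact_closed => //; exact: compact_cbox.
move=> x xab; apply: box_bump_out => // /obox_sub_cbox; exact: xab.
Qed.

(** If P is positive and at most 1 on the box and vanishes outside, then 1 - (1 - P)^n
increases to the indicator of the box, and its support stays in the closed box. *)
Lemma test_indicator_obox O a b : cbox a b `<=` O ->
  exists psi_ : nat -> 'rV[R]_d -> R,
   [/\ forall n, test_fun O (psi_ n),
       forall n x, `|psi_ n x| <= \1_(obox a b) x &
       forall x, psi_ n x @[n --> \oo] --> (\1_(obox a b) x : R)].
Proof.
move=> abO.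
have [ab|/existsNP[i /negP abi]] := pselect (forall i, a 0 i <= b 0 i); last first.
  have -> : obox a b = set0.
    rewrite -subset0 => x /(_ i) /andP[ai bi]; move: abi; rewrite -ltNge; lra.
  exists (fun=> cst 0); split => [n|n x|x]; first exact: test0.
    by rewrite indic0 normr0.
  by rewrite indic0; exact: cvg_cst.
have tP := test_box_bump ab abO.
have [C C0 PC] := test_bounded tP.
pose P x := (C + 1)^-1 * box_bump a b x.
have P01 x : 0 <= P x <= 1.
  rewrite mulr_ge0 ?box_bump_ge0 ?invr_ge0 ?addr_ge0//=.
  rewrite ler_pdivrMl ?ltr_wpDl// mulr1 (le_trans (ler_norm _))// (le_trans (PC x))//.
  by rewrite lerDl.
have tP' : test_fun O P.
  rewrite (_ : P = box_bump a b \* cst (C + 1)^-1); last by apply/funext => x /=; rewrite mulrC.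
  by apply: testM => //; exact: C1_cst.
exists (fun n x => 1 - (1 - P x) ^+ n); split.
- elim=> [|n IH].
    rewrite (_ : (fun=> _) = cst 0); first exact: test0.
    by apply/funext => x; rewrite expr0 subrr.
  rewrite (_ : (fun=> _) = (fun x => 1 - (1 - P x) ^+ n) \- ((P \* (fun x => 1 - (1 - P x) ^+ n)) \- P)).
    by apply: testB => //; apply: testB => //; apply: testM => //; exact: test_C1 IH.
  by apply/funext => x /=; rewrite exprS; ring.
- move=> n x; have /andP[P0 P1] := P01 x.
  have H0 : 0 <= (1 - P x) ^+ n by rewrite exprn_ge0// subr_ge0.
  have H1 : (1 - P x) ^+ n <= 1 by rewrite exprn_ile1// ?subr_ge0// gerBl.
  rewrite indicE; case: (boolP (x \in obox a b)) => [_|/negP].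
    by rewrite mulr1n ler_norml; apply/andP; split; lra.
  rewrite inE => /(box_bump_out ab) Px.
  by rewrite /P Px mulr0 subr0 expr1n subrr normr0.
- move=> x; rewrite indicE; case: (boolP (x \in obox a b)) => [|/negP]; rewrite inE.
    move=> /box_bump_gt0 Px; rewrite -[X in _ --> X]subr0.
    apply: cvgB; first exact: cvg_cst.
    apply: cvg_expr; have /andP[P0 P1] := P01 x.
    rewrite ger0_norm ?subr_ge0// ltrBlDr ltrDl mulr_gt0// invr_gt0.
    by rewrite ltr_wpDl.
  move=> /(box_bump_out ab) Px.
  rewrite (_ : (fun=> _) = cst 0); first exact: cvg_cst.
  by apply/funext => n; rewrite /P Px mulr0 subr0 expr1n subrr.
Qed.

End bumps.

(** * The fundamental lemma of the calculus of variations *)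

Section density_measure.
Context {R : realType} {dT : measure_display} {T : measurableType dT}.
(** The two hypotheses are arguments of the definition so that the measure structure
can be attached to it. *)
Definition density (mu : {measure set T -> \bar R}) (h : T -> \bar R)
  & measurable_fun setT h & (forall x, (0 <= h x)%E) :=
  fun A : set T => (\int[mu]_(x in A) h x)%E.

Variables (mu : {measure set T -> \bar R}) (h : T -> \bar R).
Hypotheses (mh : measurable_fun setT h) (h0 : forall x, (0 <= h x)%E).
Local Notation dens := (density mu mh h0).

Let density0 : dens set0 = 0%E.
Proof. by rewrite /density integral_set0. Qed.

Let density_ge0 A : (0 <= dens A)%E.
Proof. exact: integral_ge0. Qed.

Let density_sigma_additive : semi_sigma_additive dens.
Proof.
move=> F mF tF mUF; rewrite /density ge0_integral_bigcup//; last first.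
  exact: measurable_funTS.
by apply: is_cvg_nneseries => n _ _; exact: density_ge0.
Qed.

HB.instance Definition _ := isMeasure.Build _ _ _ dens
  density0 density_ge0 density_sigma_additive.

End density_measure.

Section fundamental_lemma.
Context {R : realType} {d : nat}.
Local Notation mu := (lebesgue_rV R d).
Implicit Types (O : set 'rV[R]_d) (f g h psi : 'rV[R]_d -> R) (a b : 'rV[R]_d).

(** The measures of density h^+ and h^- agree on boxes, hence on all measurable sets. *)
Lemma L1_null_of_boxes h : L1 mu setT h ->
  (forall a b, \int[mu]_(x in obox a b) h x = 0) ->
  {ae mu, forall x, h x = 0}.
Proof.
move=> Ih h0.
have mh : measurable_fun setT (EFin \o h) by case/integrableP: Ih.
have mp := measurable_funepos mh; have mn := measurable_funeneg mh.
have Ip : mu.-integrable setT (EFin \o h)^\+%E by exact: integrable_funepos.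
have In : mu.-integrable setT (EFin \o h)^\-%E by exact: integrable_funeneg.
pose m1 : {measure set _ -> \bar R} := density mu mp (funepos_ge0 (EFin \o h)).
pose m2 : {measure set _ -> \bar R} := density mu mn (funeneg_ge0 (EFin \o h)).
have m1fin A : measurable A -> m1 A \is a fin_num.
  move=> mA; apply: integrable_fin_num => //.
  exact: (integrableS measurableT).
have m2fin A : measurable A -> m2 A \is a fin_num.
  move=> mA; apply: integrable_fin_num => //.
  exact: (integrableS measurableT).
have m12 A : measurable A -> m1 A = m2 A.
  apply: rV_measure_unique => a b; last first.
    by have := m1fin _ (measurable_obox a b); rewrite ge0_fin_numE.
  have mB := measurable_obox a b.
  have := h0 a b; rewrite /Rintegral integralE => H.
  have := m1fin _ mB; have := m2fin _ mB; rewrite /m1 /m2 /= /density => f2 f1.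
  move: H; rewrite fineB// => /eqP; rewrite subr_eq0 => /eqP H.
  by rewrite -[LHS]fineK// H fineK.
have /= : ae_eq mu setT (EFin \o h) (cst 0%E).
  apply: integral_ae_eq => // E _ mE.
  rewrite integral0 integralE; have := m12 _ mE; rewrite /m1 /m2 /= /density => ->.
  by rewrite subee//; exact: m2fin.
by apply: filterS => x /(_ I) [].
Qed.

Lemma L1loc_restrict O g (K : set 'rV[R]_d) : open O -> L1loc O g ->
  compact K -> K `<=` O -> L1 mu O (fun x => \1_K x * g x).
Proof.
move=> oO [mg Ig] cK KO.
have mO := open_measurable_rV oO; have mK := compact_measurable_rV cK.
have := Ig K cK KO; rewrite -{1}(setIidr KO) => /(integrable_restrict mu mK mO).
apply: eq_integrable => // x _; rewrite /= patchE indicE.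
by case: (x \in K); rewrite ?mul1r ?mul0r.
Qed.

Lemma L1loc_test O g psi C : open O -> L1loc O g ->
  forall K, compact K -> K `<=` O -> measurable_fun O psi ->
  (forall x, `|psi x| <= C * \1_K x) -> L1 mu O (fun x => g x * psi x).
Proof.
move=> oO lg K cK KO mpsi bpsi; have mO := open_measurable_rV oO.
have IK := L1loc_restrict oO lg cK KO.
apply: (L1_le mO _ (L1Z mO C (L1_norm mO IK))).
  by apply: measurable_funM => //; case: lg.
move=> x _; rewrite !normrM; have := bpsi x; rewrite !indicE.
case: (x \in K) => /=.
  rewrite mulr1 => H; rewrite normr1 mul1r mulrC; apply: ler_wpM2r => //.
rewrite mulr0 => H; have -> : `|psi x| = 0 by apply/eqP; rewrite eq_le H normr_ge0.
by rewrite mulr0 normr0 mul0r mulr0.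
Qed.

(** On a box whose closure lies in the open set, test functions converge boundedly to
the indicator, so g has integral zero over each such box; countably many of these
boxes cover the open set. *)
Lemma fundamental_lemma O g : open O -> L1loc O g ->
  (forall psi, test_fun O psi -> \int[mu]_(x in O) (g x * psi x) = 0) ->
  ae_in O (fun x => g x = 0).
Proof.
move=> oO lg H; have mO := open_measurable_rV oO; have [mg Ig] := lg.
have box0 a b : cbox a b `<=` O -> \int[mu]_(x in obox a b) g x = 0.
  move=> abO.
  have [psi_ [tpsi bpsi cpsi]] := test_indicator_obox abO.
  have mob := measurable_obox a b.
  have obO : obox a b `<=` O by apply: subset_trans abO; exact: obox_sub_cbox.
  have Ic : L1 mu (cbox a b) g by apply: Ig => //; exact: compact_cbox.
  have Iob : L1 mu (obox a b) g.
    by apply: (integrableS _ _ _ Ic) => //; [exact: measurable_cbox|exact: obox_sub_cbox].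
  have I1 : L1 mu O (fun x => \1_(obox a b) x * g x).
    move: Iob; rewrite /L1 -{1}(setIidr obO) => /(integrable_restrict mu mob mO).
    apply: eq_integrable => // x _; rewrite /= patchE indicE.
    by case: (x \in obox a b); rewrite ?mul1r ?mul0r.
  have [] := @Rintegral_dominated _ _ _ mu O mO (fun n x => g x * psi_ n x)
    (fun x => \1_(obox a b) x * g x) (fun x => `|\1_(obox a b) x * g x|).
  - by move=> n; apply: measurable_funM => //; apply: test_measurable (tpsi n).
  - exact: L1_measurable I1.
  - apply: aeW => x _; rewrite mulrC; apply: cvgM; first exact: cvg_cst.
    exact: cpsi.
  - exact: L1_norm.
  - move=> x n _; rewrite !normrM mulrC ler_wpM2r// (le_trans (bpsi n x))//.
    exact: ler_norm.
  move=> _; rewrite (_ : (fun n => _) = cst 0); last first.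
    by apply/funext => n; exact: H.
  move=> /cvg_lim -/(_ (@Rhausdorff R)); rewrite lim_cst// => /esym.
  move=> H0; rewrite -{1}(setIidr obO) Rintegral_mkcondr.
  rewrite -[RHS]H0; apply: eq_Rintegral => x _; rewrite patchE indicE.
  by case: (x \in obox a b); rewrite ?mul1r ?mul0r.
have [F [FB ->]] := open_bigcup_obox oO.
suff : {ae mu, forall x, forall n, F n x -> g x = 0}.
  by apply: filterS => x Hx [n _ Fnx]; exact: Hx Fnx.
apply/ae_foralln => n.
have [[a [b [-> abO]]]|->] := FB n; last exact: aeW.
have mob := measurable_obox a b.
have Iob : L1 mu (obox a b) g.
  have Ic : L1 mu (cbox a b) g by apply: Ig => //; exact: compact_cbox.
  by apply: (integrableS _ _ _ Ic) => //; [exact: measurable_cbox|exact: obox_sub_cbox].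
have : {ae mu, forall x, \1_(obox a b) x * g x = 0}.
  apply: L1_null_of_boxes.
    apply: eq_integrable ((integrable_mkcond (EFin \o g) mob).1 Iob) => // x _.
    by rewrite /= patchE indicE; case: (x \in obox a b); rewrite ?mul1r ?mul0r.
  move=> a' b'; rewrite [LHS](_ : _ = \int[mu]_(x in obox a' b') (g \_ (obox a b)) x).
    rewrite -Rintegral_mkcondr obox_setI; apply: box0.
    apply: subset_trans abO => x Hx i; have := Hx i; rewrite !mxE.
    rewrite ge_max le_min => /andP[/andP[? ?] /andP[? ?]]; exact/andP.
  apply: eq_Rintegral => x _.
  by rewrite patchE indicE; case: (x \in obox a b); rewrite ?mul1r ?mul0r.
by apply: filterS => x + xab; rewrite indicE mem_set// mul1r.
Qed.

End fundamental_lemma.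

(** * Integrals of partial derivatives *)

Section integral_of_partial.
Context {R : realType} {d : nat}.
Local Notation mu := (lebesgue_rV R d).
Implicit Types (O : set 'rV[R]_d) (f g h psi : 'rV[R]_d -> R) (i : 'I_d).

Lemma line_growth psi (x v : 'rV[R]_d) (s : R) :
  (fun h : R => h^-1 *: (((fun t => psi (x + t *: v)) \o shift s) (h *: 1) - psi (x + s *: v)))
  = (fun h : R => h^-1 *: ((psi \o shift (x + s *: v)) (h *: v) - psi (x + s *: v))).
Proof.
apply/funext => h /=; congr (_ *: (psi _ - _)).
by rewrite scaler1 scalerDl addrCA.
Qed.

Lemma is_derive_line psi (x v : 'rV[R]_d) (s : R) :
  derivable psi (x + s *: v) v ->
  is_derive s 1 (fun t => psi (x + t *: v)) ('D_v psi (x + s *: v)).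
Proof.
by move=> dp; split; rewrite /derivable /derive line_growth.
Qed.

Lemma C1_line_lipschitz psi i (x : 'rV[R]_d) (h C : R) : C1 psi ->
  (forall y, `|partial i psi y| <= C) ->
  `|psi (x + h *: delta_mx 0 i) - psi x| <= C * `|h|.
Proof.
move=> Cp bC; set v := delta_mx 0 i.
pose F t := psi (x + t *: v).
have dF (s : R) : is_derive s 1 F (partial i psi (x + s *: v)) by apply: is_derive_line; exact: C1_derivable.
have cF (a b : R) : {within `[a, b], continuous F}.
  apply: continuous_subspaceT => s; apply: differentiable_continuous.
  by apply/derivable1_diffP; have [] := dF s.
have H (a b : R) : a <= b -> `|F b - F a| <= C * (b - a).
  move=> ab; have [c _ ->] := MVT_segment ab (fun s _ => dF s) (cF a b).
  by rewrite normrM (ger0_norm (x := b - a)) ?subr_ge0// ler_wpM2r ?subr_ge0.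
have -> : psi x = F 0 by rewrite /F scale0r addr0.
rewrite -/(F h); have [h0|h0] := leP 0 h.
  by have := H _ _ h0; rewrite subr0 (ger0_norm h0).
by have := H _ _ (ltW h0); rewrite sub0r distrC (ltr0_norm h0).
Qed.

(** Sequences rather than limits at 0 are used because dominated convergence is stated
for sequences. *)
Lemma difference_quotient_cvg psi i (x : 'rV[R]_d) (u_ : nat -> R) : C1 psi ->
  (forall n, u_ n != 0) -> u_ n @[n --> \oo] --> (0 : R) ->
  ((u_ n)^-1 * (psi (x + u_ n *: delta_mx 0 i) - psi x)) @[n --> \oo] --> partial i psi x.
Proof.
move=> Cp un0 u0; have := @C1_derivable _ _ psi x (delta_mx 0 i) Cp.
move=> /cvg_ex[/= l Hl]; have lE : partial i psi x = l by apply: cvg_lim.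
rewrite lE.
have Hn : u_ n @[n --> \oo] --> (0 : R)^'.
  move=> A HA; have : \forall n \near \oo, u_ n != 0 -> A (u_ n) by exact: (u0 _ HA).
  by apply: filterS => n; apply.
have := cvg_comp _ _ Hn Hl; apply: cvg_trans.
apply: near_eq_cvg; apply: nearW => n /=.
by rewrite [X in psi X - _]addrC.
Qed.

Lemma Rintegral_shift (v : 'rV[R]_d) f : measurable_fun setT f ->
  \int[mu]_x f (x + v) = \int[mu]_x f x.
Proof.
move=> mf; congr fine; rewrite -(integral_shift v (f := EFin \o f))//.
exact/measurable_EFinP.
Qed.

(** The difference quotients have integral zero because the measure is invariant by
translation, and they converge to the derivative within a bounded set. *)
Lemma integral_partial0 psi i : test_fun setT psi ->
  \int[mu]_x partial i psi x = 0.
Proof.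
move=> tp; have Cp := test_C1 tp; have [C C0 bC] := test_partial_bounded i tp.
have [_ _ cK _] := tp.
have [M [M0 KM]] := compact_sub_cbox cK.
pose B : set 'rV[R]_d := cbox (const_mx (- (M + 1))) (const_mx (M + 1)).
have mp : measurable_fun setT psi by exact: test_measurable tp.
have Ip : L1 mu setT psi.
  have [D _ bD] := test_bounded tp.
  by apply: (bounded_compact_support_L1 measurableT mp cK _ bD) => x; exact: support_out.
have msh (v : 'rV[R]_d) : measurable_fun setT (fun x : 'rV[R]_d => psi (x + v)).
  by apply: measurableT_comp => //; exact: measurable_shift.
have IB : L1 mu setT (fun x => C * \1_B x).
  apply: L1Z => //; apply: L1_indic => //; first exact: measurable_cbox.
  exact: lebesgue_cbox_fin.
have un0 n : (n.+1%:R : R)^-1 != 0 by rewrite invr_eq0 pnatr_eq0.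
have [] := @Rintegral_dominated _ _ _ mu setT measurableT
  (fun n x => (n.+1%:R^-1)^-1 * (psi (x + n.+1%:R^-1 *: delta_mx 0 i) - psi x))
  (partial i psi) (fun x => C * \1_B x).
- by move=> n; apply: measurable_funM => //; apply: measurable_funB.
- exact: test_partial_measurable tp.
- by apply: aeW => x _; apply: (@difference_quotient_cvg psi i x (fun n => n.+1%:R^-1) Cp un0);
    exact: cvg_harmonic.
- exact: IB.
- move=> x n _; rewrite invrK indicE; have [xB|xB] := pselect (B x).
    rewrite mem_set// mulr1 normrM ger0_norm// mulrC -ler_pdivlMr//.
    apply: le_trans (C1_line_lipschitz _ _ Cp bC) _.
    by rewrite ger0_norm ?invr_ge0.
  rewrite memNset//= mulr0.
  have S y : `|x - y| <= 1 -> psi y = 0.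
    move=> xy; apply: support_out => /KM Ky; apply: xB => j.
    have := Ky j; rewrite !mxE; have := le_trans (coord_le_norm _ j) xy.
    by rewrite !mxE ler_norml => /andP[? ?] /andP[? ?]; apply/andP; split; lra.
  rewrite !S ?subrr ?normr0 ?mulr0 ?normr0//.
  rewrite opprD addNKr normrN normrZ ger0_norm ?invr_ge0//.
  by rewrite mulr_ile1// ?invr_ge0 ?norm_delta_le1// invf_le1// ler1n.
move=> _; rewrite (_ : (fun n => _) = cst 0); last first.
  apply/funext => n; rewrite RintegralZl//; last first.
    apply: L1B => //; apply: integrable_shift (EFin \o psi) _.
    exact: Ip.
  rewrite RintegralB//; first by rewrite Rintegral_shift// subrr mulr0.
  exact: integrable_shift (EFin \o psi) Ip.
by move=> /cvg_lim -/(_ (@Rhausdorff R)); rewrite lim_cst.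
Qed.

End integral_of_partial.

(** * Weak derivatives *)

Section weak_derivatives.
Context {R : realType} {d : nat}.
Local Notation mu := (lebesgue_rV R d).
Variables (O : set 'rV[R]_d) (oO : open O).
Implicit Types (f g h psi : 'rV[R]_d -> R) (i : 'I_d) (w : 'rV[R]_d -> 'rV[R]_d).

Let mO : measurable O := open_measurable_rV oO.

Lemma ae_inS (P Q : 'rV[R]_d -> Prop) :
  (forall x, O x -> P x -> Q x) -> ae_in O P -> ae_in O Q.
Proof. by move=> PQ; rewrite /ae_in; apply: filterS => x Px Ox; exact: PQ (Px Ox). Qed.

Lemma ae_inI (P Q : 'rV[R]_d -> Prop) :
  ae_in O P -> ae_in O Q -> ae_in O (fun x => P x /\ Q x).
Proof.
by rewrite /ae_in; apply: filterS2 => x Px Qx Ox; split; [exact: Px|exact: Qx].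
Qed.

Lemma ae_in_all I (s : seq I) (P : I -> 'rV[R]_d -> Prop) :
  (forall j, ae_in O (P j)) -> ae_in O (fun x => forall n, (n < size s)%N ->
     forall j0, P (nth j0 s n) x).
Proof.
move=> HP; elim: s => [|j s IH]; first exact: aeW.
have := ae_inI (HP j) IH; apply: ae_inS => x _ [Pj Ps] [|n] // ns j0; exact: Ps.
Qed.

Lemma ae_in_forall (I : finType) (P : I -> 'rV[R]_d -> Prop) :
  (forall j, ae_in O (P j)) -> ae_in O (fun x => forall j, P j x).
Proof.
move=> /(ae_in_all (enum I)); apply: ae_inS => x _ H j.
have := H (index j (enum I)); rewrite index_mem mem_enum => /(_ isT j).
by rewrite nth_index ?mem_enum.
Qed.

Lemma L2_L1loc f : L2 mu O f -> L1loc O f.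
Proof.
move=> Hf; have mf := L2_measurable Hf; split=> // K cK KO.
have mK := compact_measurable_rV cK.
apply: (L1_le mK (g := fun x => 1 + f x ^+ 2)); first exact: measurable_funS mf.
  apply: (L1D mK); last exact: integrableS (L2_L1 Hf).
  apply: (@L1_eq _ _ _ mu K mK (\1_K)).
    by move=> x xK; rewrite indicE xK.
  apply: (integrableS measurableT) => //; apply: L1_indic => //.
  exact: (compact_lebesgue_fin cK).
by move=> x _; rewrite ler_norml; apply/andP; split; nra.
Qed.

Lemma L1_L1loc f : L1 mu O f -> L1loc O f.
Proof.
move=> If; split; first exact: L1_measurable If.
by move=> K cK KO; apply: integrableS If => //; exact: compact_measurable_rV.
Qed.

Lemma L1locD f g : L1loc O f -> L1loc O g -> L1loc O (fun x => f x + g x).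
Proof.
move=> [mf If] [mg Ig]; split; first exact: measurable_funD.
move=> K cK KO; have mK := compact_measurable_rV cK.
by apply: (L1D mK); [exact: If|exact: Ig].
Qed.

Lemma L1locZ c f : L1loc O f -> L1loc O (fun x => c * f x).
Proof.
move=> [mf If]; split; first exact: measurable_funM.
move=> K cK KO; have mK := compact_measurable_rV cK.
by apply: (L1Z mK); exact: If.
Qed.

Lemma L1loc0 : L1loc O (fun=> 0).
Proof. by apply: L1_L1loc; exact: L1_0. Qed.

Lemma L1loc_sum I (s : seq I) (F : I -> 'rV[R]_d -> R) :
  (forall j, L1loc O (F j)) -> L1loc O (fun x => \sum_(j <- s) F j x).
Proof.
move=> HF; elim: s => [|j s IH].
  by under eq_fun do rewrite big_nil; exact: L1loc0.
by under eq_fun do rewrite big_cons; exact: L1locD.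
Qed.

Lemma L1loc_eq f g : (forall x, O x -> f x = g x) -> L1loc O f -> L1loc O g.
Proof.
move=> fg [mf If]; split.
  by apply: eq_measurable_fun mf => x; rewrite inE; exact: fg.
move=> K cK KO; apply: eq_integrable (If K cK KO); first exact: compact_measurable_rV.
by move=> x; rewrite inE => /KO /fg /= ->.
Qed.

Lemma L1loc_test_L1 f psi : L1loc O f -> test_fun O psi ->
  L1 mu O (fun x => f x * psi x).
Proof.
move=> lf tp; have [C _ bp] := test_bounded tp; have [_ _ cK KO] := tp.
apply: (L1loc_test (C := C) oO lf cK KO); first exact: test_measurable tp.
move=> x; rewrite indicE; case: (boolP (x \in _)) => [_|/negP].
  by rewrite mulr1.
by rewrite inE => /support_out ->; rewrite normr0 mulr0.
Qed.

Lemma L1loc_partial_L1 f psi i : L1loc O f -> test_fun O psi ->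
  L1 mu O (fun x => f x * partial i psi x).
Proof.
move=> lf tp; have [C _ bp] := test_partial_bounded i tp; have [_ _ cK KO] := tp.
apply: (L1loc_test (C := C) oO lf cK KO); first exact: test_partial_measurable tp.
move=> x; rewrite indicE; case: (boolP (x \in _)) => [_|/negP].
  by rewrite mulr1.
by rewrite inE => /(partial_out i) ->; rewrite normr0 mulr0.
Qed.

(** The representative picked by [wderiv] is only determined up to a null set: this is
what turns every identity between weak derivatives into an identity almost
everywhere. *)
Lemma weak_unique g h : L1loc O g -> L1loc O h ->
  (forall psi, test_fun O psi ->
    \int[mu]_(x in O) (g x * psi x) = \int[mu]_(x in O) (h x * psi x)) ->
  ae_in O (fun x => g x = h x).
Proof.
move=> lg lh gh.
have lgh : L1loc O (fun x => g x - h x).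
  apply: L1loc_eq (L1locD lg (L1locZ (-1) lh)) => x _; by rewrite mulN1r.
have := fundamental_lemma oO lgh.
move=> H; have /H : forall psi, test_fun O psi -> \int[mu]_(x in O) ((g x - h x) * psi x) = 0.
  move=> psi tp; under eq_Rintegral do rewrite mulrBl.
  by rewrite RintegralB//; [rewrite gh// subrr|exact: L1loc_test_L1..].
by apply: ae_inS => x _ gh0; apply/eqP; rewrite -subr_eq0 gh0.
Qed.

Lemma wderivP i f g : is_wderiv O i f g ->
  is_wderiv O i f (wderiv O i f) /\ ae_in O (fun x => wderiv O i f x = g x).
Proof.
move=> H; have W : is_wderiv O i f (wderiv O i f).
  rewrite /wderiv; case: xgetP => [h -> //|/(_ g)]; by [].
split=> //; case: H => _ lg Hg; case: W => _ lw Hw.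
by apply: weak_unique => // psi tp; apply: oppr_inj; rewrite -Hg// -Hw.
Qed.

Lemma wdivP w g : is_wdiv O w g ->
  is_wdiv O w (wdiv O w) /\ ae_in O (fun x => wdiv O w x = g x).
Proof.
move=> H; have W : is_wdiv O w (wdiv O w).
  rewrite /wdiv; case: xgetP => [h -> //|/(_ g)]; by [].
split=> //; case: H => _ lg Hg; case: W => _ lw Hw.
by apply: weak_unique => // psi tp; apply: oppr_inj; rewrite -Hg// -Hw.
Qed.

Lemma is_wderivD i f f' g g' : is_wderiv O i f g -> is_wderiv O i f' g' ->
  is_wderiv O i (fun x => f x + f' x) (fun x => g x + g' x).
Proof.
move=> [lf lg H] [lf' lg' H']; split; [exact: L1locD..|] => psi tp.
under eq_Rintegral do rewrite mulrDl.
under [in RHS]eq_Rintegral do rewrite mulrDl.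
rewrite RintegralD//; [|exact: L1loc_partial_L1..].
rewrite RintegralD//; [|exact: L1loc_test_L1..].
by rewrite H// H'// opprD.
Qed.

Lemma is_wderivZ i c f g : is_wderiv O i f g ->
  is_wderiv O i (fun x => c * f x) (fun x => c * g x).
Proof.
move=> [lf lg H]; split; [exact: L1locZ..|] => psi tp.
under eq_Rintegral do rewrite -mulrA.
under [in RHS]eq_Rintegral do rewrite -mulrA.
rewrite RintegralZl//; last exact: L1loc_partial_L1.
rewrite RintegralZl//; last exact: L1loc_test_L1.
by rewrite H// mulrN.
Qed.

(** The converse fails: a field can have a weak divergence without its components
having weak derivatives. *)
Lemma is_wdiv_sum w (g : 'I_d -> 'rV[R]_d -> R) :
  (forall i, is_wderiv O i (fun x => w x 0 i) (g i)) ->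
  is_wdiv O w (fun x => \sum_i g i x).
Proof.
move=> H; split.
- by move=> i; have [] := H i.
- by apply: L1loc_sum => i; have [] := H i.
move=> psi tp; rewrite Rintegral_sum//; last first.
  by move=> i _; apply: L1loc_partial_L1 => //; have [] := H i.
under [in RHS]eq_Rintegral do rewrite mulr_suml.
rewrite Rintegral_sum//; last first.
  by move=> i _; apply: L1loc_test_L1 => //; have [] := H i.
by rewrite -sumrN; apply: eq_bigr => i _; have [_ _ ->] := H i.
Qed.

Lemma inH1P f i : inH1 O f -> L2 mu O f /\ L2 mu O (wderiv O i f) /\
  is_wderiv O i f (wderiv O i f).
Proof.
move=> [Lf H]; have [g Lg W] := H i; have [W' E] := wderivP W.
split=> //; split=> //; apply: (L2_ae mO _ _ Lg).
  by apply: ae_inS E.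
by have [_ []] := W'.
Qed.

Lemma inH1_L2 f : inH1 O f -> L2 mu O f.
Proof. by case. Qed.

Lemma inH1_L2_wderiv f i : inH1 O f -> L2 mu O (wderiv O i f).
Proof. by move=> /(@inH1P f i)[_ []]. Qed.

Lemma inH1_wderiv f i : inH1 O f -> is_wderiv O i f (wderiv O i f).
Proof. by move=> /(@inH1P f i)[_ []]. Qed.

Lemma inH1I f (g : 'I_d -> 'rV[R]_d -> R) : L2 mu O f -> (forall i, L2 mu O (g i)) ->
  (forall i, is_wderiv O i f (g i)) -> inH1 O f.
Proof. by move=> Lf Lg W; split=> // i; exists (g i); [exact: Lg|exact: W]. Qed.

Lemma inH1D f g : inH1 O f -> inH1 O g -> inH1 O (fun x => f x + g x).
Proof.
move=> Hf Hg; apply: (@inH1I _ (fun i x => wderiv O i f x + wderiv O i g x)).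
- by apply: L2D => //; exact: inH1_L2.
- by move=> i; apply: L2D => //; exact: inH1_L2_wderiv.
- by move=> i; apply: is_wderivD; exact: inH1_wderiv.
Qed.

Lemma inH1Z c f : inH1 O f -> inH1 O (fun x => c * f x).
Proof.
move=> Hf; apply: (@inH1I _ (fun i x => c * wderiv O i f x)).
- by apply: L2Z => //; exact: inH1_L2.
- by move=> i; apply: L2Z => //; exact: inH1_L2_wderiv.
- by move=> i; apply: is_wderivZ; exact: inH1_wderiv.
Qed.

Lemma wderivD i f g : inH1 O f -> inH1 O g ->
  ae_in O (fun x => wderiv O i (fun y => f y + g y) x = wderiv O i f x + wderiv O i g x).
Proof.
move=> Hf Hg; by have [] := wderivP (is_wderivD (inH1_wderiv i Hf) (inH1_wderiv i Hg)).
Qed.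

Lemma wderivZ i c f : inH1 O f ->
  ae_in O (fun x => wderiv O i (fun y => c * f y) x = c * wderiv O i f x).
Proof.
by move=> Hf; have [] := wderivP (is_wderivZ c (inH1_wderiv i Hf)).
Qed.

Lemma is_wderiv_test psi i : test_fun O psi -> is_wderiv O i psi (partial i psi).
Proof.
move=> tp; split.
- by apply: L2_L1loc; exact: test_L2 tp.
- by apply: L2_L1loc; exact: test_partial_L2 tp.
move=> rho tr; apply/eqP; rewrite -addr_eq0 -RintegralD//; last first.
- by apply: L2M_L1 => //; [exact: test_partial_L2 tp|exact: test_L2 tr].
- by apply: L2M_L1 => //; [exact: test_L2 tp|exact: test_partial_L2 tr].
have tpr := testM tp (test_C1 tr).
rewrite (_ : Rintegral _ _ _ = \int[mu]_x partial i (psi \* rho) x).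
  by rewrite integral_partial0//; exact: testW tpr.
rewrite Rintegral_mkcond; apply: eq_Rintegral => x _.
rewrite patchE; case: ifPn => [_|].
  by rewrite partialM ?(mulrC (rho x))//; [exact: test_C1 tp|exact: test_C1 tr].
by rewrite notin_setE => Ox; rewrite (test_partial_out i tpr).
Qed.

Lemma test_inH1 psi : test_fun O psi -> inH1 O psi.
Proof.
move=> tp; apply: (@inH1I _ (fun i => partial i psi)).
- exact: test_L2 tp.
- by move=> i; exact: test_partial_L2 tp.
- by move=> i; exact: is_wderiv_test.
Qed.

Lemma wderiv_test psi i : test_fun O psi ->
  ae_in O (fun x => wderiv O i psi x = partial i psi x).
Proof. by move=> tp; have [] := wderivP (is_wderiv_test i tp). Qed.

(** Tested with rho, this is the definition of the weak derivative of f tested with the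
product psi rho. *)
Lemma inH1_mul_test f psi : inH1 O f -> test_fun O psi ->
  inH1 O (fun x => f x * psi x) /\ forall i,
  is_wderiv O i (fun x => f x * psi x) (fun x => wderiv O i f x * psi x + f x * partial i psi x).
Proof.
move=> Hf tp; have [C _ bp] := test_bounded tp.
have L i : L2 mu O (fun x => wderiv O i f x * psi x + f x * partial i psi x).
  have [D _ bp'] := test_partial_bounded i tp.
  apply: L2D => //.
    under eq_fun do rewrite mulrC.
    apply: (L2_bounded mO (C := C)) => //; first exact: test_measurable tp.
    exact: inH1_L2_wderiv.
  under eq_fun do rewrite mulrC.
  apply: (L2_bounded mO (C := D)) => //; first exact: test_partial_measurable tp.
  exact: inH1_L2.
have Lf : L2 mu O (fun x => f x * psi x).
  under eq_fun do rewrite mulrC.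
  apply: (L2_bounded mO (C := C)) => //; first exact: test_measurable tp.
  exact: inH1_L2.
have W i : is_wderiv O i (fun x => f x * psi x) (fun x => wderiv O i f x * psi x + f x * partial i psi x).
  split; [exact: L2_L1loc..|] => rho tr.
  have tpr := testM tp (test_C1 tr).
  have [lf lg /(_ _ tpr)] := inH1_wderiv i Hf.
  have Cp := test_C1 tp; have Cr := test_C1 tr.
  rewrite partialM//.
  under eq_Rintegral => x _.
    rewrite (_ : f x * _ = f x * psi x * partial i rho x + f x * partial i psi x * rho x); last by ring.
    over.
  have [D _ bp'] := test_partial_bounded i tp.
  have lp : L1loc O (fun x => f x * partial i psi x).
    apply: L2_L1loc; under eq_fun do rewrite mulrC.
    apply: (L2_bounded mO (C := D)) => //; first exact: test_partial_measurable tp.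
    exact: inH1_L2.
  rewrite RintegralD//; last 2 first.
  - by apply: (@L1loc_partial_L1 (fun x => f x * psi x)) => //; exact: L2_L1loc.
  - exact: (@L1loc_test_L1 (fun x => f x * partial i psi x)).
  move=> /eqP; rewrite eq_sym -subr_eq => /eqP <-.
  under [in RHS]eq_Rintegral do rewrite mulrDl.
  rewrite RintegralD//; last 2 first.
  - under eq_fun do rewrite -mulrA.
    exact: (@L1loc_test_L1 (wderiv O i f) (psi \* rho)).
  - exact: (@L1loc_test_L1 (fun x => f x * partial i psi x)).
  rewrite opprD; congr (- _ - _); apply: eq_Rintegral => x _ /=; by rewrite mulrA.
split=> //; exact: inH1I L W.
Qed.

End weak_derivatives.

(** * The space H^1_0 *)

Section H10.
Context {R : realType} {d : nat}.
Local Notation mu := (lebesgue_rV R d).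
Variables (O : set 'rV[R]_d) (oO : open O).
Implicit Types (f g h p v psi : 'rV[R]_d -> R) (i : 'I_d) (w : 'rV[R]_d -> 'rV[R]_d).

Let mO : measurable O := open_measurable_rV oO.

Lemma sqnormH1E f : sqnormH1 O f =
  \int[mu]_(x in O) f x ^+ 2 + \sum_i \int[mu]_(x in O) wderiv O i f x ^+ 2.
Proof.
rewrite /sqnormH1 /ipL2M /ipL2 big_ord1; congr (_ + _).
apply: eq_bigr => i _; apply: eq_Rintegral => x _.
by rewrite /wgrad !mxE expr2.
Qed.

Lemma sqnormH1_ge0 f : 0 <= sqnormH1 O f.
Proof.
rewrite sqnormH1E addr_ge0 ?Rintegral_sqr_ge0//.
by apply: sumr_ge0 => i _; exact: Rintegral_sqr_ge0.
Qed.

Lemma sqnormH1_fun f : \int[mu]_(x in O) f x ^+ 2 <= sqnormH1 O f.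
Proof.
rewrite sqnormH1E lerDl; apply: sumr_ge0 => i _; exact: Rintegral_sqr_ge0.
Qed.

Lemma sqnormH1_wderiv i f :
  \int[mu]_(x in O) wderiv O i f x ^+ 2 <= sqnormH1 O f.
Proof.
rewrite sqnormH1E (bigD1 i)//= addrCA lerDl addr_ge0 ?Rintegral_sqr_ge0//.
by apply: sumr_ge0 => j _; exact: Rintegral_sqr_ge0.
Qed.

Lemma Rintegral_sqr_ae f g : L2 mu O f -> L2 mu O g -> ae_in O (fun x => f x = g x) ->
  \int[mu]_(x in O) f x ^+ 2 = \int[mu]_(x in O) g x ^+ 2.
Proof.
move=> [mf _] [mg _] fg; apply: Rintegral_ae => //; [|exact: measurable_funX..].
by apply: ae_inS fg => x _ ->.
Qed.

Lemma sqnormH1Z c f : inH1 O f ->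
  sqnormH1 O (fun x => c * f x) = c ^+ 2 * sqnormH1 O f.
Proof.
move=> Hf; rewrite !sqnormH1E mulrDr mulr_sumr; congr (_ + _).
  under eq_Rintegral do rewrite exprMn.
  by rewrite RintegralZl//; exact/L2_L1/inH1_L2.
apply: eq_bigr => i _; rewrite (Rintegral_sqr_ae _ _ (wderivZ oO i c Hf)).
- under eq_Rintegral do rewrite exprMn.
  by rewrite RintegralZl//; exact/L2_L1/inH1_L2_wderiv.
- by apply: inH1_L2_wderiv => //; exact: inH1Z.
- by apply: L2Z => //; exact: inH1_L2_wderiv.
Qed.

Lemma sqr_addr_le2 (a b : R) : (a + b) ^+ 2 <= 2 * a ^+ 2 + 2 * b ^+ 2.
Proof.
by rewrite -subr_ge0 (_ : _ - _ = (a - b) ^+ 2) ?sqr_ge0//; ring.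
Qed.

Lemma Rintegral_sqrD_le f g : L2 mu O f -> L2 mu O g ->
  \int[mu]_(x in O) (f x + g x) ^+ 2 <=
  2 * \int[mu]_(x in O) f x ^+ 2 + 2 * \int[mu]_(x in O) g x ^+ 2.
Proof.
move=> Lf Lg; have If := L2_L1 Lf; have Ig := L2_L1 Lg.
rewrite -RintegralZl// -RintegralZl// -RintegralD//; [|exact: L1Z..].
apply: le_Rintegral => //; first by have /L2_L1 := L2D mO Lf Lg.
  by apply: L1D => //; exact: L1Z.
by move=> x _; exact: sqr_addr_le2.
Qed.

Lemma sqnormH1D f g : inH1 O f -> inH1 O g ->
  sqnormH1 O (fun x => f x + g x) <= 2 * sqnormH1 O f + 2 * sqnormH1 O g.
Proof.
have aux (a b A B C D : R) : a <= 2 * A + 2 * B -> b <= 2 * C + 2 * D ->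
  a + b <= 2 * (A + C) + 2 * (B + D) by lra.
have aux_sum (a A B : 'I_d -> R) : (forall i, a i <= 2 * A i + 2 * B i) ->
    \sum_i a i <= 2 * (\sum_i A i) + 2 * (\sum_i B i).
  by move=> H; rewrite !mulr_sumr -big_split; apply: ler_sum => i _; exact: H.
move=> Hf Hg; rewrite !sqnormH1E; apply: aux.
  by apply: Rintegral_sqrD_le; exact: inH1_L2.
apply: aux_sum => i; rewrite (Rintegral_sqr_ae _ _ (wderivD oO i Hf Hg)).
- by apply: Rintegral_sqrD_le; exact: inH1_L2_wderiv.
- by apply: inH1_L2_wderiv => //; exact: inH1D.
- by apply: L2D => //; exact: inH1_L2_wderiv.
Qed.

Lemma inH10_inH1 f : inH10 O f -> inH1 O f.
Proof. by case. Qed.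

Lemma subfunE f g : f \- g = fun x => f x + -1 * g x.
Proof. by apply/funext => x; rewrite mulN1r. Qed.

Lemma inH1B f g : inH1 O f -> inH1 O g -> inH1 O (f \- g).
Proof. move=> Hf Hg; rewrite subfunE; exact (inH1D oO Hf (inH1Z oO (-1) Hg)). Qed.

Lemma wderivB i f g : inH1 O f -> inH1 O g ->
  ae_in O (fun x => wderiv O i (f \- g) x = wderiv O i f x - wderiv O i g x).
Proof.
move=> Hf Hg; rewrite subfunE; have Hg' := inH1Z oO (-1) Hg.
have := ae_inI (wderivD oO i Hf Hg') (wderivZ oO i (-1) Hg).
by apply: ae_inS => x _ [-> ->]; rewrite mulN1r.
Qed.

Lemma inH10D f g : inH10 O f -> inH10 O g -> inH10 O (fun x => f x + g x).
Proof.
move=> [Hf df] [Hg dg]; split; first exact: inH1D.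
move=> e e0; have e4 : 0 < e / 4 by rewrite divr_gt0.
have [psi tp lp] := df _ e4; have [rho tr lr] := dg _ e4.
exists (psi \- (cst 0 \- rho)).
  by apply: testB => //; apply: testB => //; exact: test0.
rewrite (_ : _ \- _ = fun x => (f \- psi) x + (g \- rho) x); last first.
  by apply/funext => x /=; ring.
apply: le_lt_trans (sqnormH1D _ _) _; [by apply: inH1B => //; exact: test_inH1..|].
move: lp lr; generalize (sqnormH1 O (f \- psi)) (sqnormH1 O (g \- rho)) => A B; lra.
Qed.

Lemma inH10Z c f : inH10 O f -> inH10 O (fun x => c * f x).
Proof.
move=> [Hf df]; split; first exact: inH1Z.
move=> e e0; have e4 : 0 < e / (c ^+ 2 + 1) by rewrite divr_gt0// ltr_wpDl ?sqr_ge0.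
have [psi tp lp] := df _ e4.
exists (psi \* cst c); first by apply: testM => //; exact: C1_cst.
rewrite (_ : _ \- _ = fun x => c * (f \- psi) x); last first.
  by apply/funext => x /=; ring.
rewrite sqnormH1Z; last by apply: inH1B => //; exact: test_inH1.
move: lp; rewrite ltr_pdivlMr ?ltr_wpDl ?sqr_ge0//; apply: le_lt_trans.
by rewrite mulrC ler_wpM2l ?sqnormH1_ge0// lerDl.
Qed.

Lemma inH10_test psi : test_fun O psi -> inH10 O psi.
Proof.
move=> tp; split; first exact: test_inH1.
move=> e e0; exists psi => //; rewrite (_ : _ \- _ = fun x => 0 * psi x).
  by rewrite sqnormH1Z ?expr0n ?mul0r//; exact: test_inH1.
by apply/funext => x /=; rewrite subrr mul0r.
Qed.

Lemma inH10B f g : inH10 O f -> inH10 O g -> inH10 O (f \- g).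
Proof. move=> Hf Hg; rewrite subfunE; exact (inH10D Hf (inH10Z (-1) Hg)). Qed.

(** A functional that is bounded by the H^1 norm and vanishes on test functions vanishes
on their closure. Additivity is only asked where it is used, for the difference
between the given function and its approximations. *)
Lemma inH10_density (L : ('rV[R]_d -> R) -> R) (C : R) f : inH10 O f ->
  (forall psi, test_fun O psi -> L psi = 0) ->
  (forall psi, test_fun O psi -> L (f \- psi) = L f - L psi) ->
  (forall h, inH10 O h -> L h ^+ 2 <= C * sqnormH1 O h) ->
  L f = 0.
Proof.
move=> Hf L0 LB LC; apply/eqP; rewrite -sqrf_eq0; apply/eqP/le_anti.
rewrite sqr_ge0 andbT; apply/ler_addgt0Pr => e e0; rewrite add0r.
have C1 : 0 < `|C| + 1 by rewrite ltr_wpDl.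
have [psi tp lp] := Hf.2 _ (divr_gt0 e0 C1).
have := LC _ (inH10B Hf (inH10_test tp)).
rewrite LB// (L0 _ tp) subr0 => /le_trans; apply.
move: lp; rewrite ltr_pdivlMr// => /ltW; apply: le_trans.
rewrite mulrC ler_wpM2l ?sqnormH1_ge0//.
by rewrite (le_trans (ler_norm _))// lerDl.
Qed.

(** For a test function v this is the definition of the weak derivative of p, and both
sides are continuous in v for the H^1 norm. *)
Lemma integration_by_parts_H10 p v i : inH1 O p -> inH10 O v ->
  \int[mu]_(x in O) (p x * wderiv O i v x) =
  - \int[mu]_(x in O) (wderiv O i p x * v x).
Proof.
move=> Hp Hv; apply/eqP; rewrite -addr_eq0; apply/eqP.
have Lp := inH1_L2 Hp; have Ldp := inH1_L2_wderiv oO i Hp.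
have aux (a b A A' B B' S : R) : a <= A * A' -> A' <= S -> 0 <= A ->
    b <= B * B' -> B' <= S -> 0 <= B -> 2 * a + 2 * b <= (2 * A + 2 * B) * S by nra.
pose C := 2 * \int[mu]_(x in O) p x ^+ 2 + 2 * \int[mu]_(x in O) wderiv O i p x ^+ 2.
apply: (@inH10_density (fun v => \int[mu]_(x in O) (p x * wderiv O i v x) +
  \int[mu]_(x in O) (wderiv O i p x * v x)) C _ Hv).
- move=> psi tp.
  rewrite (@Rintegral_ae _ _ _ mu O mO _ (fun x => p x * partial i psi x)).
  + by have [_ _ ->] := inH1_wderiv oO i Hp => //; rewrite addrC subrr.
  + by apply: ae_inS (wderiv_test oO i tp) => x _ ->.
  + apply: (@L1_measurable _ _ _ mu); apply: L2M_L1 => //.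
    by apply: inH1_L2_wderiv => //; exact: test_inH1.
  + by apply: (@L1_measurable _ _ _ mu); apply: L2M_L1 => //; exact: test_partial_L2 tp.
- move=> psi tp; have Hpsi := test_inH1 oO tp; have Hv1 := inH10_inH1 Hv.
  have Lv := inH1_L2_wderiv oO i Hv1; have Lpsi := inH1_L2_wderiv oO i Hpsi.
  rewrite (@Rintegral_ae _ _ _ mu O mO _ (fun x => p x * wderiv O i v x - p x * wderiv O i psi x)).
  + under [X in _ + X]eq_Rintegral do rewrite /= mulrBr.
    rewrite !RintegralB//; first by rewrite opprD addrACA.
    * by apply: L2M_L1 => //; exact: inH1_L2.
    * by apply: L2M_L1 => //; exact: inH1_L2.
    * exact: L2M_L1.
    * exact: L2M_L1.
  + by apply: ae_inS (wderivB i Hv1 Hpsi) => x _ ->; rewrite mulrBr.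
  + apply: (@L1_measurable _ _ _ mu); apply: L2M_L1 => //; apply: inH1_L2_wderiv => //.
    exact: inH1B.
  + by apply: (@L1_measurable _ _ _ mu); apply: L1B => //; exact: L2M_L1.
- move=> h /inH10_inH1 Hh.
  have Lh := inH1_L2 Hh; have Ldh := inH1_L2_wderiv oO i Hh.
  apply: le_trans (sqr_addr_le2 _ _) _; apply: aux.
  + exact: (cauchy_schwarz mO Lp Ldh).
  + exact: sqnormH1_wderiv.
  + exact: Rintegral_sqr_ge0.
  + exact: (cauchy_schwarz mO Ldp Lh).
  + exact: sqnormH1_fun.
  + exact: Rintegral_sqr_ge0.
Qed.

(** Tested with psi, the product rule is integration by parts between v and f psi. *)
Lemma product_rule_H10 f v i : inH1 O f -> inH10 O v ->
  is_wderiv O i (fun x => f x * v x) (fun x => wderiv O i f x * v x + f x * wderiv O i v x).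
Proof.
move=> Hf Hv; have Hv1 := inH10_inH1 Hv.
have Lf := inH1_L2 Hf; have Ldf := inH1_L2_wderiv oO i Hf.
have Lv := inH1_L2 Hv1; have Ldv := inH1_L2_wderiv oO i Hv1.
have I1 : L1 mu O (fun x => f x * v x) by exact: L2M_L1.
have I2 : L1 mu O (fun x => wderiv O i f x * v x) by exact: L2M_L1.
have I3 : L1 mu O (fun x => f x * wderiv O i v x) by exact: L2M_L1.
split; [exact: L1_L1loc|by apply: L1_L1loc => //; exact: L1D|] => psi tp.
have [Hfp Wfp] := inH1_mul_test oO Hf tp.
have := integration_by_parts_H10 i Hfp Hv.
rewrite (@Rintegral_ae _ _ _ mu O mO (fun x => wderiv O i (fun x0 => f x0 * psi x0) x * v x)
   (fun x => (wderiv O i f x * v x) * psi x + (f x * v x) * partial i psi x)); first last.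
- apply: (@L1_measurable _ _ _ mu); apply: L1D => //.
    exact: L1loc_test_L1 (L1_L1loc oO I2) tp.
  exact: L1loc_partial_L1 (L1_L1loc oO I1) tp.
- apply: (@L1_measurable _ _ _ mu); apply: L2M_L1 => //; exact: inH1_L2_wderiv.
- apply: ae_inS (wderivP oO (Wfp i)).2 => x _ ->; ring.
rewrite RintegralD//; last 2 first.
- exact: L1loc_test_L1 (L1_L1loc oO I2) tp.
- exact: L1loc_partial_L1 (L1_L1loc oO I1) tp.
move=> E; under [in RHS]eq_Rintegral do rewrite mulrDl.
rewrite RintegralD//; last 2 first.
- exact: L1loc_test_L1 (L1_L1loc oO I2) tp.
- exact: L1loc_test_L1 (L1_L1loc oO I3) tp.
rewrite (_ : \int[mu]_(x in O) (f x * wderiv O i v x * psi x) =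
  \int[mu]_(x in O) (f x * psi x * wderiv O i v x)).
  by rewrite E; ring.
by apply: eq_Rintegral => x _; ring.
Qed.

End H10.

(** * Slices of R^(d+1) *)

Section ladyzhenskaya.
Context {R : realType}.
Local Notation leb := (@lebesgue_measure R).

Lemma FTC_line (F f : R -> R) (a b : R) : a <= b ->
  (forall s : R, is_derive s 1 F (f s)) -> continuous f ->
  (\int[leb]_(s in `[a, b]) (f s)%:E = (F b)%:E - (F a)%:E)%E.
Proof.
rewrite le_eqVlt => /predU1P[-> dF cf|ab dF cf].
  by rewrite set_itv1 integral_set1 subee.
have cF : continuous F.
  move=> s; apply: differentiable_continuous.
  by apply/derivable1_diffP; have [] := dF s.
apply: continuous_FTC2 => //; first exact: continuous_subspaceT.
  split; [by move=> s _; have [] := dF s| |].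
    exact: cvg_at_right_filter (cF a).
  exact: cvg_at_left_filter (cF b).
by move=> s _; rewrite derive1E; have [_ ->] := dF s.
Qed.

(** The Lebesgue measure in dimension d + 1 is by construction an image measure under
[rV_cons]; this is the same map with real arguments. *)
Definition vcons d (s : R) (y : 'rV[R]_d) : 'rV[R]_d.+1 :=
  rV_cons ((s : measurableTypeR R), y).

Lemma vcons_head d s (y : 'rV[R]_d) : vcons s y 0 ord0 = s.
Proof.
have E : row_mx (\row_(j < 1) s) y 0 (lshift d 0) = s by rewrite row_mxEl mxE.
by rewrite -[RHS]E; congr (fun_of_matrix _ _ _); apply: val_inj.
Qed.

Lemma vcons_tail d s (y : 'rV[R]_d) i : vcons s y 0 (lift ord0 i) = y 0 i.
Proof.
rewrite -(row_mxEr (\row_(j < 1) s) y).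
by congr (fun_of_matrix _ _ _); apply: val_inj.
Qed.

Lemma vcons_ext d (x z : 'rV[R]_d.+1) : x 0 ord0 = z 0 ord0 ->
  (forall i, x 0 (lift ord0 i) = z 0 (lift ord0 i)) -> x = z.
Proof.
move=> h t; apply/rowP => k; by case: (unliftP ord0 k) => [j|] ->.
Qed.

Lemma vcons_shift_head d s t (y : 'rV[R]_d) :
  vcons (s + t) y = vcons s y + t *: delta_mx 0 ord0.
Proof.
apply: vcons_ext => [|i].
  by rewrite [RHS]mxE [X in _ = _ + X]mxE [X in _ = _ + _ * X]mxE !vcons_head !eqxx mulr1.
rewrite [RHS]mxE [X in _ = _ + X]mxE [X in _ = _ + _ * X]mxE !vcons_tail eqxx.
by rewrite (_ : (lift ord0 i == ord0) = false) ?mulr0 ?addr0//; apply/negbTE.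
Qed.

Lemma vcons_shift_tail d s t (y : 'rV[R]_d) i :
  vcons s (t *: delta_mx 0 i + y) = t *: delta_mx 0 (lift ord0 i) + vcons s y.
Proof.
apply: vcons_ext => [|j].
  by rewrite [RHS]mxE [X in _ = X + _]mxE [X in _ = _ * X + _]mxE !vcons_head mulr0 add0r.
rewrite [RHS]mxE [X in _ = X + _]mxE [X in _ = _ * X + _]mxE !vcons_tail !mxE.
by rewrite (inj_eq lift_inj).
Qed.

Lemma vcons_surj d (x : 'rV[R]_d.+1) : x = vcons (x 0 ord0) (\row_i x 0 (lift ord0 i)).
Proof.
by apply: vcons_ext => [|i]; rewrite ?vcons_head// vcons_tail mxE.
Qed.

Lemma vcons_norm_le d s (y : 'rV[R]_d) : `|s| <= `|vcons s y|.
Proof. by rewrite -{1}(vcons_head s y); exact: coord_le_norm. Qed.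

Lemma vcons_norm_tail_le d s (y : 'rV[R]_d) : `|y| <= `|vcons s y|.
Proof.
apply/ler_addgt0Pr => e e0; apply: ltW; apply: norm_lt_coord.
  by rewrite ltr_wpDl.
move=> i; rewrite -(vcons_tail s y); apply: le_lt_trans (coord_le_norm _ _) _.
by rewrite ltrDl.
Qed.

Lemma continuous_vcons_head d (y : 'rV[R]_d) : continuous (fun s => vcons s y).
Proof.
move=> s; apply/cvgrPdist_lt => e e0; near=> t.
apply: norm_lt_coord => // k; rewrite mxE [X in _ + X]mxE.
case: (unliftP ord0 k) => [j|] ->; first by rewrite !vcons_tail subrr normr0.
rewrite !vcons_head; near: t; exact: cvgr_dist_lt.
Unshelve. all: by end_near. Qed.

Lemma continuous_vcons_tail d (s : R) : continuous (fun y : 'rV[R]_d => vcons s y).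
Proof.
move=> y U /nbhs_ballP[e e0 eU]; apply/nbhs_ballP; exists e => // t.
rewrite -ball_normE /= => yt; apply: eU; rewrite -ball_normE /=.
apply: norm_lt_coord => // k; rewrite mxE [X in _ + X]mxE.
case: (unliftP ord0 k) => [j|] ->; last by rewrite !vcons_head subrr normr0.
rewrite !vcons_tail; apply: le_lt_trans yt.
by have := coord_le_norm (y - t) j; rewrite !mxE.
Qed.

Section integral_cons.
Variable d : nat.
Variable f : 'rV[R]_d.+1 -> \bar R.
Hypotheses (mf : measurable_fun setT f) (f0 : forall x, (0 <= f x)%E).

Let mfc : measurable_fun [set: measurableTypeR R * 'rV[R]_d] (fun p => f (vcons p.1 p.2)).
Proof.
rewrite (_ : (fun _ => _) = f \o (@rV_cons R d)); last by apply/funext => -[].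
by apply: measurableT_comp => //; exact: measurable_rV_cons.
Qed.

Lemma integral_cons_prod : (\int[lebesgue_rV R d.+1]_x f x =
  \int[leb \x lebesgue_rV R d]_p f (vcons p.1 p.2))%E.
Proof.
have := ge0_integral_pushforward (@measurable_rV_cons R d) (leb \x lebesgue_rV R d)%E measurableT mf.
move=> /(_ _)/wrap[//|]; rewrite preimage_setT => E.
transitivity (\int[pushforward (leb \x lebesgue_rV R d)%E (@rV_cons R d)]_y f y)%E.
  apply: eq_measure_integral => //; exact: measurable_rV_cons.
by rewrite E; apply: eq_integral => -[].
Qed.

Lemma integral_cons : (\int[lebesgue_rV R d.+1]_x f x =
  \int[leb]_s \int[lebesgue_rV R d]_y f (vcons s y))%E.
Proof. by rewrite integral_cons_prod fubini_tonelli1. Qed.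

Lemma integral_cons_swap : (\int[lebesgue_rV R d.+1]_x f x =
  \int[lebesgue_rV R d]_y \int[leb]_s f (vcons s y))%E.
Proof. by rewrite integral_cons_prod fubini_tonelli2. Qed.

Lemma measurable_integral_head :
  measurable_fun setT (fun y => \int[leb]_s f (vcons s y))%E.
Proof.
by apply: (measurable_fun_fubini_tonelli_G (m1 := leb)
  (fun p : measurableTypeR R * 'rV[R]_d => f (vcons p.1 p.2))).
Qed.

Lemma measurable_integral_tail :
  measurable_fun [set: measurableTypeR R] (fun s => \int[lebesgue_rV R d]_y f (vcons s y))%E.
Proof.
by apply: (measurable_fun_fubini_tonelli_F (m2 := lebesgue_rV R d)
  (fun p : measurableTypeR R * 'rV[R]_d => f (vcons p.1 p.2))).
Qed.

End integral_cons.

End ladyzhenskaya.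

(** * Slices of compactly supported functions *)

Section Cc.
Context {R : realType}.
Local Notation leb := (@lebesgue_measure R).
Local Notation mu d := (lebesgue_rV R d).

(** Only the derivatives along the axes enter, so that freezing the first coordinate
keeps a function in this class: the difference quotients of the slice are those of
the function. *)
Definition Cc d (psi : 'rV[R]_d -> R) :=
  [/\ continuous psi, forall x i, derivable psi x (delta_mx 0 i),
      forall i, continuous (partial i psi) &
      exists M : R, forall x, M < `|x| -> psi x = 0].

Lemma test_Cc d (psi : 'rV[R]_d -> R) O : test_fun O psi -> Cc psi.
Proof.
move=> tp; have Cp := test_C1 tp; split.
- exact: C1_continuous.
- by move=> x i; exact: C1_derivable.
- exact: Cp.2.
have [_ _ /compact_bounded[M [_ HM]] _] := tp; exists (M + 1) => x Mx.
apply: support_out => Kx; have := HM (M + 1); rewrite ltrDl ltr01 => /(_ isT x Kx).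
by rewrite /= leNgt Mx.
Qed.

Lemma Cc_compact d (psi : 'rV[R]_d -> R) : Cc psi ->
  exists2 K : set 'rV[R]_d, compact K & forall x, ~ K x ->
    psi x = 0 /\ forall i, partial i psi x = 0.
Proof.
move=> [cp dp cdp [M HM]].
have far x : M < `|x| -> forall i, partial i psi x = 0.
  move=> Mx i; rewrite /partial (near_eq_derive (g := cst 0)) ?derive_cst//.
  have : nbhs x [set y : 'rV[R]_d | M < `|y|].
    apply: open_nbhs_nbhs; split=> //.
    apply: (@open_comp _ _ (fun y : 'rV[R]_d => `|y|) [set t | M < t]).
      by move=> y _; exact: norm_continuous.
    exact: open_gt.
  by apply: filterS => y; exact: HM.
exists (cbox (const_mx (- M)) (const_mx M)); first exact: compact_cbox.
move=> x /existsNP[i]; rewrite !mxE -ler_norml => /negP; rewrite -ltNge => Mx.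
have {}Mx : M < `|x| by apply: lt_le_trans Mx (coord_le_norm _ _).
by split; [exact: HM|exact: far].
Qed.

Lemma Cc_measurable d (psi : 'rV[R]_d -> R) : Cc psi -> measurable_fun setT psi.
Proof. by move=> [cp _ _ _]; exact: continuous_measurable_rV. Qed.

Lemma Cc_measurable_partial d (psi : 'rV[R]_d -> R) i : Cc psi ->
  measurable_fun setT (partial i psi).
Proof. by move=> [_ _ cp _]; exact: continuous_measurable_rV. Qed.

Lemma Cc_L2 d (psi : 'rV[R]_d -> R) : Cc psi -> L2 (mu d) setT psi.
Proof.
move=> Cp; have [K cK HK] := Cc_compact Cp; have [cp _ _ _] := Cp.
have [C _ bC] := bounded_compact_support cp cK (fun x Kx => (HK x Kx).1).
exact: (bounded_compact_support_L2 measurableT (Cc_measurable Cp) cK (fun x Kx => (HK x Kx).1) bC).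
Qed.

Lemma Cc_L2_partial d (psi : 'rV[R]_d -> R) i : Cc psi -> L2 (mu d) setT (partial i psi).
Proof.
move=> Cp; have [K cK HK] := Cc_compact Cp; have [_ _ cp _] := Cp.
have [C _ bC] := bounded_compact_support (cp i) cK (fun x Kx => (HK x Kx).2 i).
exact: (bounded_compact_support_L2 measurableT (Cc_measurable_partial i Cp) cK (fun x Kx => (HK x Kx).2 i) bC).
Qed.

Lemma slice_growth d (psi : 'rV[R]_d.+1 -> R) s i y :
  (fun h : R => h^-1 *: (((fun z : 'rV[R]_d => psi (vcons s z)) \o shift y)
      (h *: delta_mx 0 i) - psi (vcons s y))) =
  (fun h : R => h^-1 *: ((psi \o shift (vcons s y)) (h *: delta_mx 0 (lift ord0 i))
      - psi (vcons s y))).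
Proof. by apply/funext => h /=; rewrite vcons_shift_tail. Qed.

Lemma partial_slice d (psi : 'rV[R]_d.+1 -> R) s i y :
  partial i (fun z : 'rV[R]_d => psi (vcons s z)) y =
  partial (lift ord0 i) psi (vcons s y).
Proof. by rewrite /partial /derive slice_growth. Qed.

Lemma Cc_slice d (psi : 'rV[R]_d.+1 -> R) s : Cc psi ->
  Cc (fun y : 'rV[R]_d => psi (vcons s y)).
Proof.
move=> [cp dp cdp [M HM]]; split.
- move=> y; apply: (@continuous_comp _ _ _ (fun z : 'rV[R]_d => vcons s z) psi); [exact: continuous_vcons_tail|exact: cp].
- by move=> y i; rewrite /derivable slice_growth; exact: dp.
- move=> i; rewrite (_ : partial i _ = (partial (lift ord0 i) psi) \o vcons s).
    move=> y; apply: (@continuous_comp _ _ _ (fun z : 'rV[R]_d => vcons s z) (partial (lift ord0 i) psi)); [exact: continuous_vcons_tail|exact: cdp].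
  by apply/funext => y; exact: partial_slice.
- exists M => x Mx; apply: HM; apply: lt_le_trans Mx _.
  exact: vcons_norm_tail_le.
Qed.

(** The absolute value of the i-th partial derivative of psi^2. *)
Definition gradprod d (i : 'I_d) (psi : 'rV[R]_d -> R) (x : 'rV[R]_d) : R :=
  `|2 * psi x * partial i psi x|.

Lemma measurable_gradprod d (i : 'I_d) (psi : 'rV[R]_d -> R) : Cc psi ->
  measurable_fun setT (EFin \o gradprod i psi).
Proof.
move=> Cp; apply/measurable_EFinP; apply: measurableT_comp => //.
apply: measurable_funM; last exact: Cc_measurable_partial.
by apply: measurable_funM => //; exact: Cc_measurable.
Qed.

Lemma gradprod_ge0 d (i : 'I_d) (psi : 'rV[R]_d -> R) x :
  (0 <= (EFin \o gradprod i psi) x)%E.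
Proof. by rewrite lee_fin normr_ge0. Qed.

(** psi^2 vanishes far away on the line, so its value is the integral of its derivative
over a half-line. *)
Lemma sqr_le_line_integral d (psi : 'rV[R]_d.+1 -> R) s (y : 'rV[R]_d) : Cc psi ->
  ((psi (vcons s y) ^+ 2)%:E <=
   \int[leb]_t (gradprod ord0 psi (vcons t y))%:E)%E.
Proof.
move=> [cp dp cdp [M HM]].
pose F t := psi (vcons t y) ^+ 2.
pose f t := 2 * psi (vcons t y) * partial ord0 psi (vcons t y).
have lE t : vcons t y = vcons 0 y + t *: delta_mx 0 ord0.
  by rewrite -vcons_shift_head add0r.
have dF t : is_derive (t : R) 1 F (f t).
  have -> : F = (fun t => psi (vcons 0 y + t *: delta_mx 0 ord0)) ^+ 2.
    by apply/funext => r; rewrite /F lE.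
  have dl := @is_derive_line _ _ psi (vcons 0 y) (delta_mx 0 ord0) t (dp _ _).
  by apply: is_derive_eq; rewrite /f /partial (lE t) expr1.
have cf : continuous f.
  move=> t; apply: (@continuousM _ _ (fun t => 2 * psi (vcons t y)) (fun t => partial ord0 psi (vcons t y))).
    apply: (@continuousM _ _ (cst 2) (fun t => psi (vcons t y))); first by apply: cst_continuous.
    by apply: (@continuous_comp _ _ _ (fun t : R => vcons t y) psi); [exact: continuous_vcons_head|exact: cp].
  by apply: (@continuous_comp _ _ _ (fun t : R => vcons t y) (partial ord0 psi)); [exact: continuous_vcons_head|exact: cdp].
pose a := - (`|M| + `|s| + 1).
have as_ : a <= s.
  rewrite /a lerNl; have := ler_norm (- s); rewrite normrN; have := normr_ge0 M; lra.
have Fa : F a = 0.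
  rewrite /F HM ?expr0n//; apply: lt_le_trans (vcons_norm_le _ _).
  rewrite /a normrN ger0_norm ?addr_ge0//; have := ler_norm M; have := normr_ge0 s; lra.
have mf : measurable_fun [set: measurableTypeR R] f by exact: continuous_measurable_fun.
have := FTC_line as_ dF cf; rewrite Fa sube0 => <-.
apply: le_trans (le_trans (lee_abs _) (le_abse_integral _ _ _)) _ => //.
  by apply/measurable_EFinP; exact: measurable_funTS.
apply: ge0_subset_integral => //.
by apply: measurableT_comp => //; exact/measurable_EFinP.
Qed.

End Cc.

(** * The Ladyzhenskaya inequality *)

Section ladyzhenskaya_inequality.
Context {R : realType}.
Local Notation leb := (@lebesgue_measure R).
Local Notation mu d := (lebesgue_rV R d).
Local Notation G i psi := (\int[mu _]_x (gradprod i psi x)%:E)%E.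

Lemma EFin_Rintegral d (f : 'rV[R]_d -> R) : L1 (mu d) setT f ->
  (\int[mu d]_x (f x)%:E = (\int[mu d]_x f x)%:E)%E.
Proof. by move=> If; rewrite fineK//; exact: integrable_fin_num. Qed.

Lemma sqr_le_gradprod1 (psi : 'rV[R]_1 -> R) y : Cc psi ->
  ((psi y ^+ 2)%:E <= G ord0 psi)%E.
Proof.
move=> Cp; have := sqr_le_line_integral (y 0 ord0) (\row_i y 0 (lift ord0 i)) Cp.
rewrite -vcons_surj integral_cons; last 2 first.
- exact: measurable_gradprod.
- exact: gradprod_ge0.
move=> /le_trans; apply; rewrite le_eqVlt; apply/orP; left; apply/eqP.
apply: eq_integral => t _.
have E (x y' : 'rV[R]_0) : x = y' by apply/rowP => -[].
rewrite [RHS]integral_dirac//.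
  by rewrite diracT mul1e; congr (gradprod _ _ (vcons _ _))%:E.
rewrite (_ : (fun x => _) = cst (gradprod ord0 psi (vcons t 0))%:E)//.
by apply/funext => x; rewrite (E x 0).
Qed.

(** psi^2 is bounded by a function a(y) of the second variable, the integral of its first
derivative along the line, and likewise by a function b(s) of the first variable;
the integral of a(y) b(s) is a product. *)
Lemma ladyzhenskaya2 (psi : 'rV[R]_2 -> R) : Cc psi ->
  (\int[mu 2]_x (psi x ^+ 4)%:E <= G ord0 psi * G (lift ord0 ord0) psi)%E.
Proof.
move=> Cp.
have mpsi : measurable_fun setT psi := Cc_measurable Cp.
have m4 : measurable_fun setT (fun x => (psi x ^+ 4)%:E).
  by apply/measurable_EFinP; exact: measurable_funX.
have p0 x : (0 <= (psi x ^+ 4)%:E)%E by rewrite lee_fin -[4%N]/(2 * 2)%N exprM sqr_ge0.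
pose g0 := EFin \o gradprod ord0 psi.
pose g1 := EFin \o gradprod (lift ord0 ord0) psi.
have mg0 : measurable_fun setT g0 := measurable_gradprod _ Cp.
have mg1 : measurable_fun setT g1 := measurable_gradprod _ Cp.
have g00 x : (0 <= g0 x)%E := gradprod_ge0 _ _ _.
have g10 x : (0 <= g1 x)%E := gradprod_ge0 _ _ _.
pose a y := (\int[leb]_t g0 (vcons t y))%E.
pose b s := (\int[mu 1]_z g1 (vcons s z))%E.
have ma : measurable_fun setT a := measurable_integral_head mg0 g00.
have mb : measurable_fun [set: measurableTypeR R] b := measurable_integral_tail mg1 g10.
have a0 y : (0 <= a y)%E by apply: integral_ge0 => t _; exact: g00.
have b0 s : (0 <= b s)%E by apply: integral_ge0 => t _; exact: g10.
have pw s y : ((psi (vcons s y) ^+ 4)%:E <= a y * b s)%E.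
  rewrite -[4%N]/(2 + 2)%N exprD EFinM; apply: lee_pmul.
  - by rewrite lee_fin sqr_ge0.
  - by rewrite lee_fin sqr_ge0.
  - exact: sqr_le_line_integral.
  apply: le_trans (sqr_le_gradprod1 y (Cc_slice s Cp)) _.
  rewrite le_eqVlt; apply/orP; left; apply/eqP.
  by apply: eq_integral => z _; rewrite /g1 /= /gradprod partial_slice.
rewrite integral_cons//.
have msl s : measurable_fun setT (fun y : 'rV[R]_1 => (psi (vcons s y) ^+ 4)%:E).
  by apply/measurable_EFinP; apply: measurable_funX; exact: Cc_measurable (Cc_slice s Cp).
apply: (@le_trans _ _ (\int[leb]_s \int[mu 1]_y (a y * b s))%E).
  apply: ge0_le_integral => //.
  - by move=> s _; exact: integral_ge0.
  - exact: (measurable_integral_tail m4 p0).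
  - have -> : (fun s => \int[mu 1]_y (a y * b s))%E = fun s => ((\int[mu 1]_y a y) * b s)%E.
      by apply/funext => s; rewrite ge0_integralZr.
    exact: (measurable_funeM _ mb).
  - move=> s _; apply: ge0_le_integral => //.
    + exact: (emeasurable_funM ma (measurable_cst (b s))).
under eq_integral do rewrite ge0_integralZr//.
rewrite ge0_integralZl//; last exact: integral_ge0.
by rewrite /a /b -(integral_cons_swap mg0 g00) -(integral_cons mg1 g10).
Qed.

Lemma gradprod_sqr_le d (psi : 'rV[R]_d -> R) i : Cc psi ->
  (\int[mu d]_x gradprod i psi x) ^+ 2 <=
  4 * (\int[mu d]_x psi x ^+ 2 * \int[mu d]_x partial i psi x ^+ 2).
Proof.
move=> Cp; have L := Cc_L2 Cp; have Li := Cc_L2_partial i Cp.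
have nL (f : 'rV[R]_d -> R) : L2 (mu d) setT f -> L2 (mu d) setT (fun x => `|f x|).
  move=> Lf; apply: (L2_le _ _ Lf) => //.
    by apply: measurableT_comp => //; exact: L2_measurable Lf.
  by move=> x _; rewrite normr_id.
have := cauchy_schwarz measurableT (nL _ L) (nL _ Li).
under [in X in _ <= X * _]eq_Rintegral do rewrite real_normK ?num_real//.
under [in X in _ <= _ * X]eq_Rintegral do rewrite real_normK ?num_real//.
under [in X in _ -> X ^+ 2 <= _]eq_Rintegral.
  move=> x _; rewrite (_ : gradprod i psi x = 2 * (`|psi x| * `|partial i psi x|)); last first.
    by rewrite /gradprod !normrM ger0_norm ?mulrA.
  over.
rewrite RintegralZl//; last by apply: L2M_L1 => //; exact: nL.
by move=> H; rewrite exprMn -natrX ler_wpM2l.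
Qed.

Lemma gradprod_L1 d (psi : 'rV[R]_d -> R) i : Cc psi -> L1 (mu d) setT (gradprod i psi).
Proof.
move=> Cp; have := L2M_L1 measurableT (Cc_L2 Cp) (Cc_L2_partial i Cp).
move=> /(L1Z measurableT 2) /(L1_norm measurableT); apply: L1_eq => // x _.
by rewrite /gradprod mulrA.
Qed.

Lemma gradprod_le d (psi : 'rV[R]_d -> R) i : Cc psi ->
  \int[mu d]_x gradprod i psi x <=
  \int[mu d]_x psi x ^+ 2 + \int[mu d]_x partial i psi x ^+ 2.
Proof.
move=> Cp; have L := L2_L1 (Cc_L2 Cp); have Li := L2_L1 (Cc_L2_partial i Cp).
rewrite -RintegralD//; apply: le_Rintegral => //.
- exact: gradprod_L1.
- exact: L1D.
move=> x _; rewrite /gradprod ler_norml -mulrA -subr_ge0 opprK -[X in _ && X]subr_ge0.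
rewrite (_ : _ + _ = (psi x + partial i psi x) ^+ 2); last by ring.
by rewrite (_ : _ - _ = (psi x - partial i psi x) ^+ 2) ?sqr_ge0//; ring.
Qed.

(** The planar inequality holds on each slice, and there the integral of psi^2 is at most
the integral over the whole space of the derivative of psi^2 in the first variable.
This makes the bound linear in quantities that can be integrated over the slices. *)
Lemma ladyzhenskaya3 (psi : 'rV[R]_3 -> R) : Cc psi ->
  (\int[mu 3]_x (psi x ^+ 4)%:E <=
   (2 * \int[mu 3]_x gradprod ord0 psi x *
     (\int[mu 3]_x partial (lift ord0 ord0) psi x ^+ 2 +
      \int[mu 3]_x partial (lift ord0 (lift ord0 ord0)) psi x ^+ 2))%:E)%E.
Proof.
move=> Cp.
have mpsi : measurable_fun setT psi := Cc_measurable Cp.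
have m4 : measurable_fun setT (fun x => (psi x ^+ 4)%:E).
  by apply/measurable_EFinP; exact: measurable_funX.
have p0 x : (0 <= (psi x ^+ 4)%:E)%E by rewrite lee_fin -[4%N]/(2 * 2)%N exprM sqr_ge0.
set S0 := \int[mu 3]_x gradprod ord0 psi x.
have S0_ge0 : 0 <= S0 by apply: Rintegral_ge0 => x _; exact: normr_ge0.
have Ibound s : \int[mu 2]_y psi (vcons s y) ^+ 2 <= S0.
  rewrite -lee_fin -(EFin_Rintegral (L2_L1 (Cc_L2 (Cc_slice s Cp)))).
  rewrite -(EFin_Rintegral (gradprod_L1 ord0 Cp)).
  rewrite (integral_cons_swap (measurable_gradprod ord0 Cp) (gradprod_ge0 ord0 psi)).
  apply: ge0_le_integral => //.
  - by move=> y _; rewrite lee_fin sqr_ge0.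
  - by apply/measurable_EFinP/measurable_funX; exact: Cc_measurable (Cc_slice s Cp).
  - exact: (measurable_integral_head (measurable_gradprod ord0 Cp) (gradprod_ge0 ord0 psi)).
  - by move=> y _; exact: sqr_le_line_integral.
pose J (i : 'I_2) (x : 'rV[R]_3) := (partial (lift ord0 i) psi x ^+ 2)%:E.
have mJ i : measurable_fun setT (J i).
  by apply/measurable_EFinP/measurable_funX; exact: Cc_measurable_partial.
have J0 i x : (0 <= J i x)%E by rewrite lee_fin sqr_ge0.
have JE i s : (\int[mu 2]_y J i (vcons s y) =
    (\int[mu 2]_y partial i (fun z => psi (vcons s z)) y ^+ 2)%:E)%E.
  rewrite -(EFin_Rintegral (L2_L1 (Cc_L2_partial i (Cc_slice s Cp)))).
  by apply: eq_integral => y _; rewrite /J partial_slice.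
have JE3 i : (\int[mu 3]_x J i x = (\int[mu 3]_x partial (lift ord0 i) psi x ^+ 2)%:E)%E.
  by rewrite -(EFin_Rintegral (L2_L1 (Cc_L2_partial (lift ord0 i) Cp))).
have aux (p1 p2 I J1 J2 S : R) : p1 ^+ 2 <= 4 * (I * J1) -> p2 ^+ 2 <= 4 * (I * J2) ->
    I <= S -> 0 <= J1 -> 0 <= J2 -> p1 * p2 <= 2 * S * (J1 + J2).
  move=> H1 H2 IS J10 J20; have := sqr_ge0 (p1 - p2).
  have : I * J1 <= S * J1 by exact: ler_wpM2r.
  have : I * J2 <= S * J2 by exact: ler_wpM2r.
  move: H1 H2; rewrite sqrrB; lra.
have slice s : (\int[mu 2]_y (psi (vcons s y) ^+ 4)%:E <=
  (2 * S0)%:E * (\int[mu 2]_y J ord0 (vcons s y) + \int[mu 2]_y J (lift ord0 ord0) (vcons s y)))%E.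
  have Cs := Cc_slice s Cp.
  apply: le_trans (ladyzhenskaya2 Cs) _.
  rewrite (EFin_Rintegral (gradprod_L1 ord0 Cs)).
  rewrite (EFin_Rintegral (gradprod_L1 (lift ord0 ord0) Cs)).
  rewrite !JE -EFinD -!EFinM lee_fin; apply: aux.
  - exact: gradprod_sqr_le.
  - exact: gradprod_sqr_le.
  - exact: Ibound.
  - exact: Rintegral_sqr_ge0.
  - exact: Rintegral_sqr_ge0.
suff H : (\int[mu 3]_x (psi x ^+ 4)%:E <=
    (2 * S0)%:E * (\int[mu 3]_x J ord0 x + \int[mu 3]_x J (lift ord0 ord0) x))%E.
  apply: le_trans H _; rewrite (JE3 ord0) (JE3 (lift ord0 ord0)).
  exact: lexx.
rewrite (integral_cons m4 p0) (integral_cons (mJ ord0) (J0 ord0)).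
rewrite (integral_cons (mJ (lift ord0 ord0)) (J0 (lift ord0 ord0))).
have mJs i : measurable_fun [set: measurableTypeR R] (fun s => \int[mu 2]_y J i (vcons s y))%E.
  exact: (measurable_integral_tail (mJ i) (J0 i)).
have Js0 i s : (0 <= \int[mu 2]_y J i (vcons s y))%E by apply: integral_ge0 => y _; exact: J0.
apply: (@le_trans _ _ (\int[leb]_s ((2 * S0)%:E * (\int[mu 2]_y J ord0 (vcons s y) + \int[mu 2]_y J (lift ord0 ord0) (vcons s y))))%E).
  apply: ge0_le_integral => //.
  - by move=> s _; exact: integral_ge0.
  - exact: (measurable_integral_tail m4 p0).
  - by apply: emeasurable_funM => //; exact: emeasurable_funD.
pose A i s := (\int[mu 2]_y J i (vcons s y))%E.
have E : (\int[leb]_s ((2 * S0)%:E * (A ord0 s + A (lift ord0 ord0) s)) =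
    (2 * S0)%:E * (\int[leb]_s A ord0 s + \int[leb]_s A (lift ord0 ord0) s))%E.
  rewrite ge0_integralZl//; last 3 first.
  - by apply: emeasurable_funD; exact: mJs.
  - by move=> s _; apply: adde_ge0; exact: Js0.
  - by rewrite lee_fin mulr_ge0.
  congr (_ * _)%E; rewrite ge0_integralD//; by [move=> s _; exact: Js0|exact: mJs].
by rewrite le_eqVlt; apply/orP; left; apply/eqP; exact: E.
Qed.

(** The squared H^1 norm over the whole space, with classical derivatives. *)
Definition H1sqr d (psi : 'rV[R]_d -> R) : R :=
  \int[mu d]_x psi x ^+ 2 + \sum_i \int[mu d]_x partial i psi x ^+ 2.

Lemma integral_pow4_le d (psi : 'rV[R]_d -> R) : d = 2%N \/ d = 3%N -> Cc psi ->
  (\int[mu d]_x (psi x ^+ 4)%:E <= (2 * H1sqr psi ^+ 2)%:E)%E.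
Proof.
have aux2 (g0 g1 I J0 J1 : R) : g0 <= I + J0 -> g1 <= I + J1 -> 0 <= g0 -> 0 <= g1 ->
  0 <= I -> 0 <= J0 -> 0 <= J1 -> g0 * g1 <= 2 * (I + (J0 + J1)) ^+ 2 by nra.
have aux3 (g0 I J0 J1 J2 : R) : g0 <= I + J0 -> 0 <= g0 ->
  0 <= I -> 0 <= J0 -> 0 <= J1 -> 0 <= J2 -> 2 * g0 * (J1 + J2) <= 2 * (I + (J0 + (J1 + J2))) ^+ 2 by nra.
have EFinM_le (a b c : R) : a * b <= c -> (a%:E * b%:E <= c%:E)%E.
  by rewrite -EFinM lee_fin.
have sum2 (F : 'I_2 -> R) : \sum_i F i = F ord0 + F (lift ord0 ord0).
  by rewrite !big_ord_recl big_ord0 addr0.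
have sum3 (F : 'I_3 -> R) : \sum_i F i =
    F ord0 + (F (lift ord0 ord0) + F (lift ord0 (lift ord0 ord0))).
  by rewrite !big_ord_recl big_ord0 addr0.
have gp0 k (i : 'I_k) (f : 'rV[R]_k -> R) : 0 <= \int[mu k]_x gradprod i f x.
  by apply: Rintegral_ge0 => x _; exact: normr_ge0.
case=> dE; move: psi; rewrite dE => psi Cp.
  apply: le_trans (ladyzhenskaya2 Cp) _.
  rewrite (EFin_Rintegral (gradprod_L1 ord0 Cp)).
  rewrite (EFin_Rintegral (gradprod_L1 (lift ord0 ord0) Cp)).
  apply: EFinM_le; rewrite /H1sqr sum2; apply: aux2; by [exact: gradprod_le|exact: Rintegral_sqr_ge0|exact: gp0].
apply: le_trans (ladyzhenskaya3 Cp) _.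
rewrite lee_fin /H1sqr sum3; apply: aux3; by [exact: gradprod_le|exact: Rintegral_sqr_ge0|exact: gp0].
Qed.

End ladyzhenskaya_inequality.

(** * Fourth powers of functions in H^1_0 *)

Section fast_convergence.
Context {R : realType} {dT : measure_display} {T : measurableType dT}.
Variables (mu : {measure set T -> \bar R}) (D : set T) (mD : measurable D).

Lemma sum_half_pow_le (n : nat) : \sum_(0 <= k < n) (2^-1 : R) ^+ k <= 2.
Proof.
suff -> : \sum_(0 <= k < n) (2^-1 : R) ^+ k = 2 - 2 * 2^-1 ^+ n.
  by rewrite lerBlDr lerDl mulr_ge0// exprn_ge0.
elim: n => [|n IH]; first by rewrite big_geq// expr0 mulr1 subrr.
by rewrite big_nat_recr//= IH exprS; field.
Qed.

(** The series of the g n has a finite integral, so it converges almost everywhere and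
its terms tend to zero. Choosing sequences with geometric rate replaces the
extraction of subsequences. *)
Lemma ae_cvg0_of_fast_L1 (g : nat -> T -> R) (C : R) :
  (forall n, L1 mu D (g n)) -> (forall n x, D x -> 0 <= g n x) ->
  (forall n, \int[mu]_(x in D) g n x <= C * 2^-1 ^+ n) ->
  {ae mu, forall x, D x -> g n x @[n --> \oo] --> (0 : R)}.
Proof.
move=> Ig g0 gC.
pose E x := (\sum_(n <oo) (g n x)%:E)%E.
have mg n : measurable_fun D (EFin \o g n) by have /integrableP[] := Ig n.
have g0E n x : D x -> (0 <= (EFin \o g n) x)%E by move=> Dx; rewrite lee_fin g0.
have IE : mu.-integrable D E.
  apply/integrableP; split.
    apply: (@ge0_emeasurable_sum _ _ _ D (fun n x => (g n x)%:E) xpredT) => //.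
      by move=> k x Dx _; exact: g0E.
    by move=> k _; exact: mg.
  rewrite [X in (X < _)%E](_ : _ = (\int[mu]_(x in D) E x)%E); last first.
    apply: eq_integral => x; rewrite inE => Dx; rewrite gee0_abs//; apply: nneseries_ge0 => n _ _.
    exact: g0E.
  rewrite (integral_nneseries mu mD mg g0E).
  apply: (@le_lt_trans _ _ (C * 2)%:E); last exact: ltry.
  apply: lime_le; first by apply: is_cvg_nneseries => n _ _; apply: integral_ge0 => x; exact: g0E.
  apply: nearW => n.
  rewrite (eq_bigr (fun k => (\int[mu]_(x in D) g k x)%:E)); last first.
    by move=> k _; apply/esym/fineK; apply: integrable_fin_num => //; exact: Ig.
  rewrite sumEFin lee_fin.
  apply: (@le_trans _ _ (\sum_(0 <= k < n) (C * 2^-1 ^+ k))).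
    by apply: ler_sum => k _; exact: gC.
  have C0 : 0 <= C.
    have := gC 0%N; rewrite expr0 mulr1; apply: le_trans.
    by apply: Rintegral_ge0 => x; exact: g0.
  by rewrite -mulr_sumr ler_wpM2l// sum_half_pow_le.
apply: filterS (integrable_ae mD IE) => x /[swap] Dx /(_ Dx) Ex.
apply: cvg_series_cvg_0; apply: nondecreasing_is_cvgn.
  by apply: nondecreasing_series => n _ _; exact: g0.
exists (fine (E x)) => _ [n _ <-].
rewrite -lee_fin fineK// /series /= -sumEFin.
by apply: nneseries_lim_ge => k _ _; rewrite lee_fin g0.
Qed.

End fast_convergence.

Section H10_L4.
Context {R : realType} {d : nat} (d23 : d = 2%N \/ d = 3%N).
Local Notation mu := (lebesgue_rV R d).
Variables (O : set 'rV[R]_d) (oO : open O).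
Implicit Types (f g h p v psi : 'rV[R]_d -> R) (i : 'I_d).

Let mO : measurable O := open_measurable_rV oO.

Lemma Rintegral_support (F : 'rV[R]_d -> R) : (forall x, ~ O x -> F x = 0) ->
  \int[mu]_x F x = \int[mu]_(x in O) F x.
Proof.
move=> FO; rewrite [RHS]Rintegral_mkcond; apply: eq_Rintegral => x _.
rewrite patchE; case: ifPn => //; rewrite notin_setE => /FO ->//.
Qed.

Lemma H1sqr_test psi : test_fun O psi -> H1sqr psi = sqnormH1 O psi.
Proof.
move=> tp; rewrite /H1sqr sqnormH1E; congr (_ + _).
  by apply: Rintegral_support => x /(test_out tp) ->; rewrite expr0n.
apply: eq_bigr => i _.
rewrite Rintegral_support; last by move=> x /(test_partial_out i tp) ->; rewrite expr0n.
apply: (Rintegral_sqr_ae oO).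
- exact: test_partial_L2 tp.
- by apply: inH1_L2_wderiv => //; exact: test_inH1.
- by apply: ae_inS (wderiv_test oO i tp) => x _ ->.
Qed.

Lemma test_pow4_le psi : test_fun O psi ->
  (\int[mu]_(x in O) (psi x ^+ 4)%:E <= (2 * sqnormH1 O psi ^+ 2)%:E)%E.
Proof.
move=> tp; have Cp := test_Cc tp; rewrite -H1sqr_test//.
apply: le_trans (integral_pow4_le d23 Cp); apply: ge0_subset_integral => //.
  by apply/measurable_EFinP/measurable_funX; exact: Cc_measurable.
by move=> x _; rewrite lee_fin -[4%N]/(2 * 2)%N exprM sqr_ge0.
Qed.

(** Fatou's lemma along test functions that approximate f so fast that they converge
almost everywhere. The margin e is what the approximation error adds to the norm. *)
Lemma H10_pow4_le_eps f e : inH10 O f -> 0 < e ->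
  (\int[mu]_(x in O) (f x ^+ 4)%:E <= (2 * (2 * sqnormH1 O f + 2 * e) ^+ 2)%:E)%E.
Proof.
move=> Hf e0; have [Hf1 Df] := Hf; have Lf := inH1_L2 Hf1.
have /choice[psi tpsi] : forall n : nat, exists psi, test_fun O psi /\
    sqnormH1 O (f \- psi) < e * 2^-1 ^+ n.
  move=> n; have en0 : 0 < e * 2^-1 ^+ n by rewrite mulr_gt0// exprn_gt0.
  by have [psi tp lp] := Df _ en0; exists psi.
have Hpsi n : inH1 O (psi n) by exact: test_inH1 (tpsi n).1.
have ae_cv : {ae mu, forall x, O x -> (f x - psi n x) ^+ 2 @[n --> \oo] --> (0 : R)}.
  apply: (ae_cvg0_of_fast_L1 mO (g := fun n x => (f x - psi n x) ^+ 2) (C := e)).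
  - by move=> n; apply: L2_L1; apply: L2B => //; exact: inH1_L2.
  - by move=> n x _; exact: sqr_ge0.
  - move=> n; apply: le_trans (ltW (tpsi n).2).
    exact: (sqnormH1_fun O (f \- psi n)).
have mf := L2_measurable Lf.
pose F n x := (psi n x ^+ 4)%:E.
have mF n : measurable_fun O (F n).
  by apply/measurable_EFinP/measurable_funX; exact: test_measurable (tpsi n).1.
have F0 n x : O x -> (0 <= F n x)%E.
  by move=> _; rewrite lee_fin -[4%N]/(2 * 2)%N exprM sqr_ge0.
rewrite (@ae_eq_integral _ _ _ mu O (fun x => limn_einf (F^~ x)) (fun x => (f x ^+ 4)%:E)) //; last 3 first.
- by apply/measurable_EFinP; exact: measurable_funX.
- rewrite /limn_einf; apply: measurableT_comp => //.
  by apply: measurable_fun_limn_esup => n; apply: measurableT_comp.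
- apply: filterS ae_cv => x cv Ox.
  have cx : psi n x @[n --> \oo] --> f x.
    apply/cvgrPdist_lt => r r0.
    have /cvgrPdist_lt/(_ _ (exprn_gt0 2 r0)) := cv Ox.
    apply: filterS => n; rewrite sub0r normrN normrX ltr_pXn2r// ?nnegrE//.
    exact: ltW.
  have c4 : F n x @[n --> \oo] --> (f x ^+ 4)%:E.
    apply: cvg_EFin; first exact: nearW.
    exact: (cvg_comp _ _ cx (@exprn_continuous R 4 (f x))).
  by have [-> _] := cvg_limn_einf_sup c4.
apply: le_trans (fatou mu mO mF F0) _.
rewrite limn_einf_lim; apply: lime_le; first exact: is_cvg_einfs.
apply: nearW => n; apply: (@le_trans _ _ (\int[mu]_(x in O) F n x)%E).
  by apply: ereal_inf_lbound; exists n => /=.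
apply: le_trans (test_pow4_le (tpsi n).1) _; rewrite lee_fin ler_pM2l//.
rewrite ler_sqr ?nnegrE ?sqnormH1_ge0//; last first.
  by rewrite addr_ge0// mulr_ge0// ?sqnormH1_ge0// ltW.
have -> : psi n = fun x => f x + -1 * (f \- psi n) x.
  by apply/funext => x /=; ring.
have Hfp : inH1 O (f \- psi n) by exact: inH1B.
apply: le_trans (sqnormH1D oO Hf1 (inH1Z oO (-1) Hfp)) _.
rewrite (sqnormH1Z oO _ Hfp) sqrrN expr1n mul1r lerD2l ler_pM2l//.
apply: le_trans (ltW (tpsi n).2) _.
apply: ler_piMr; first exact: ltW.
by rewrite exprn_ile1// invf_le1// ler1n.
Qed.

(** The margin of [H10_pow4_le_eps] is taken equal to the squared norm, or tends to zero
if the norm vanishes. *)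
Lemma H10_L4 f : inH10 O f -> L1 mu O (fun x => f x ^+ 4) /\
  \int[mu]_(x in O) f x ^+ 4 <= 32 * sqnormH1 O f ^+ 2.
Proof.
move=> Hf; have p0 x : (0 <= (f x ^+ 4)%:E)%E.
  by rewrite lee_fin -[4%N]/(2 * 2)%N exprM sqr_ge0.
have I4 : L1 mu O (fun x => f x ^+ 4).
  apply/integrableP; split.
    by apply/measurable_EFinP/measurable_funX; exact: L2_measurable (inH1_L2 Hf.1).
  rewrite [X in (X < _)%E](_ : _ = (\int[mu]_(x in O) (f x ^+ 4)%:E)%E).
    by apply: le_lt_trans (H10_pow4_le_eps Hf ltr01) _; exact: ltry.
  by apply: eq_integral => x _; apply: gee0_abs; exact: p0.
split=> //.
(* The choice e = sqnormH1 O f gives the constant 2 * 4 ^+ 2 = 32. *)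
have H e : 0 < e -> \int[mu]_(x in O) f x ^+ 4 <= 2 * (2 * sqnormH1 O f + 2 * e) ^+ 2.
  move=> e0; rewrite -lee_fin fineK; last exact: integrable_fin_num.
  exact: H10_pow4_le_eps.
have := sqnormH1_ge0 O f; rewrite le_eqVlt => /predU1P[S0|S0]; last first.
  have aux (S : R) : 2 * (2 * S + 2 * S) ^+ 2 = 32 * S ^+ 2 by ring.
  by have := H _ S0; rewrite aux.
rewrite -S0 expr0n mulr0; apply/ler_addgt0Pr => e e0; rewrite add0r.
have [r r0 re] : exists2 r : R, 0 < r & 8 * r ^+ 2 = e.
  exists (Num.sqrt (e / 8)); first by rewrite sqrtr_gt0 divr_gt0.
  by rewrite sqr_sqrtr ?divr_ge0 ?ltW// mulrC divfK.
apply: le_trans (H _ r0) _; rewrite -S0 -re mulr0 add0r.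
by rewrite exprMn mulrA -natrX -natrM.
Qed.

End H10_L4.

(** * Translations and Fubini's theorem *)

Section fubini_real.
Context {R : realType} {d1 d2 : measure_display}
  {T1 : measurableType d1} {T2 : measurableType d2}.
Variables (m1 : {sigma_finite_measure set T1 -> \bar R})
  (m2 : {sigma_finite_measure set T2 -> \bar R}).
Variable q : T1 * T2 -> R.
Hypothesis Iq : (m1 \x m2)%E.-integrable setT (EFin \o q).

Lemma L1_fine dT (T : measurableType dT) (m : {measure set T -> \bar R}) (F : T -> \bar R) :
  m.-integrable setT F -> L1 m setT (fine \o F).
Proof.
move=> IF; apply: (le_integrable _ _ _ IF) => //.
  apply/measurable_EFinP; apply: measurableT_comp; first exact: fine_measurable.
  exact: measurable_int IF.
by move=> x _; rewrite /=; case: (F x) => [r| |] /=; rewrite ?normr0 ?leey ?lexx.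
Qed.

Lemma integral_fine dT (T : measurableType dT) (m : {measure set T -> \bar R}) (F : T -> \bar R) :
  m.-integrable setT F -> \int[m]_x fine (F x) = fine (\int[m]_x F x)%E.
Proof.
move=> IF; congr fine; apply: ae_eq_integral => //.
- exact: measurable_int (L1_fine IF).
- exact: measurable_int IF.
- apply: filterS (integrable_ae measurableT IF) => x Fx Dx.
  by rewrite /= fineK//; exact: Fx.
Qed.

Lemma Fubini_L1 : L1 m1 setT (fun x => \int[m2]_y q (x, y)).
Proof. exact: (L1_fine (integrable_fubini_F Iq)). Qed.

Lemma integrable_G : m2.-integrable setT (fubini_G m1 (EFin \o q)).
Proof.
have mq := measurable_int _ Iq.
have mqa : measurable_fun setT (abse \o (EFin \o q)) by exact: measurableT_comp.
apply/integrableP; split; first exact: (measurable_fubini_G Iq).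
have := (integrable21ltyP m1 m2 mq).1 Iq; apply: le_lt_trans.
apply: ge0_le_integral => //.
- by apply: measurableT_comp => //; exact: (measurable_fubini_G Iq).
- exact: (measurable_fun_fubini_tonelli_G (m1 := m1) (abse \o (EFin \o q)) mqa (fun x => abse_ge0 _)).
- move=> y _; apply: le_abse_integral => //.
  exact: (measurable_fun_pair1 y mq).
Qed.

Lemma Fubini_real :
  \int[m1]_x (\int[m2]_y q (x, y)) = \int[m2]_y (\int[m1]_x q (x, y)).
Proof.
rewrite (integral_fine (integrable_fubini_F Iq)).
rewrite (integral_fine integrable_G).
by congr fine; exact: Fubini.
Qed.

Lemma Fubini_ae : {ae m1, forall x, L1 m2 setT (fun y => q (x, y))}.
Proof. exact: (ae_integrable1 Iq). Qed.

End fubini_real.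

Section translation.
Context {R : realType} {d : nat}.
Local Notation mu := (lebesgue_rV R d).
Local Notation leb := (@lebesgue_measure R).
Variable i : 'I_d.
Implicit Types (f g h psi rho F : 'rV[R]_d -> R).

(** Translation along the i-th axis. *)
Definition tr (s : R) (x : 'rV[R]_d) : 'rV[R]_d := x + s *: delta_mx 0 i.

Lemma tr0 x : tr 0 x = x. Proof. by rewrite /tr scale0r addr0. Qed.

Lemma trK s x : tr (- s) (tr s x) = x.
Proof. by rewrite /tr scaleNr addrK. Qed.

Lemma trNK s x : tr s (tr (- s) x) = x.
Proof. by rewrite /tr scaleNr subrK. Qed.

Lemma measurable_tr : measurable_fun [set: 'rV[R]_d * measurableTypeR R]
  (fun p => tr p.2 p.1).
Proof.
apply: measurable_rVP => j.
rewrite (_ : _ \o _ = fun p : 'rV[R]_d * measurableTypeR R =>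
   rV_coord j p.1 + p.2 * (delta_mx 0 i : 'rV[R]_d) 0 j); last first.
  by apply/funext => p; rewrite /= /rV_coord /tr mxE [X in _ + X]mxE.
apply: measurable_funD.
  by apply: measurableT_comp; [exact: measurable_rV_coord|exact: measurable_fst].
by apply: measurable_funM => //; exact: measurable_snd.
Qed.

Lemma measurable_tr1 s : measurable_fun [set: 'rV[R]_d] (tr s).
Proof. exact: measurable_shift. Qed.

Lemma Rintegral_tr s F : measurable_fun setT F ->
  \int[mu]_x F (tr s x) = \int[mu]_x F x.
Proof. by move=> mF; rewrite -[RHS](Rintegral_shift (s *: delta_mx 0 i)). Qed.

Lemma L1_tr s F : L1 mu setT F -> L1 mu setT (fun x => F (tr s x)).
Proof. exact: (integrable_shift (s *: delta_mx 0 i)). Qed.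

Section window.
Variables (h : R) (h0 : 0 <= h).

(** The indicator of [0, h], as a factor: integrals over [0, h] become integrals over the
line, to which Fubini's theorem applies. *)
Definition win (s : R) : R := \1_(`[0, h]%classic) s.

Lemma winE (r : R -> R) : \int[leb]_s (win s * r s) = \int[leb]_(s in `[0, h]) r s.
Proof.
rewrite [RHS]Rintegral_mkcond; apply: eq_Rintegral => s _.
by rewrite patchE /win indicE; case: (s \in _); rewrite ?mul1r ?mul0r.
Qed.

Lemma measurable_win : measurable_fun [set: measurableTypeR R] win.
Proof. by apply: measurable_indic; exact: measurable_itv. Qed.

Lemma win_ge0 s : 0 <= win s. Proof. by rewrite /win indicE. Qed.

Lemma integral_win : (\int[leb]_s (win s)%:E = h%:E)%E.
Proof.
rewrite integral_indic//.
rewrite setIT; transitivity (@lebesgue_measure R `[0, h]%classic) => //.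
rewrite lebesgue_measure_itv /= lte_fin.
by case: ltgtP h0 => // [_ _|<- _]; rewrite ?EFinN ?sube0.
Qed.

Lemma integrable_window (q : 'rV[R]_d * measurableTypeR R -> R) (N : R) :
  measurable_fun setT q ->
  (forall s, \int[mu]_x (`|q (x, s)|)%:E <= N%:E)%E ->
  (mu \x leb)%E.-integrable setT (EFin \o (fun p => win p.2 * q p)).
Proof.
move=> mq qN; have mw : measurable_fun [set: 'rV[R]_d * measurableTypeR R] (fun p => win p.2).
  by apply: measurableT_comp; [exact: measurable_win|exact: measurable_snd].
apply/integrable21ltyP; first by apply/measurable_EFinP; exact: measurable_funM.
have N0 : 0 <= N.
  by have := qN 0; rewrite -lee_fin; apply: le_trans; apply: integral_ge0 => x _; rewrite lee_fin.
have mqs s : measurable_fun [set: 'rV[R]_d] (fun x => (`|q (x, s)|)%:E).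
  apply/measurable_EFinP; apply: measurableT_comp => //.
  exact: (measurable_fun_pair1 s mq).
pose W (p : 'rV[R]_d * measurableTypeR R) := `|(EFin \o (fun p => (win p.2 * q p)%R)) p|%E.
have mW : measurable_fun setT W.
  by apply: measurableT_comp => //; apply/measurable_EFinP; exact: measurable_funM.
have W0 p : (0 <= W p)%E by exact: abse_ge0.
apply: (@le_lt_trans _ _ (\int[leb]_s (N%:E * (win s)%:E))%E).
  apply: ge0_le_integral => //.
  - by move=> s _; exact: integral_ge0.
  - exact: (measurable_fun_fubini_tonelli_G (m1 := mu) W mW W0).
  - apply/measurable_EFinP; apply: measurable_funM => //; exact: measurable_win.
  move=> s _ /=.
  rewrite [X in (X <= _)%E](_ : _ = (win s)%:E * \int[mu]_x (`|q (x, s)|)%:E)%E; last first.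
    rewrite -ge0_integralZl//; last by rewrite lee_fin win_ge0.
    by apply: eq_integral => x _; rewrite normrM (ger0_norm (win_ge0 s)).
  by rewrite muleC lee_wpmul2r// lee_fin win_ge0.
rewrite ge0_integralZl//; last 2 first.
- by apply/measurable_EFinP; exact: measurable_win.
- by move=> s _; rewrite lee_fin win_ge0.
by rewrite integral_win ltry.
Qed.

End window.

End translation.

(** * Steklov's formula *)

Section test_translation.
Context {R : realType} {d : nat}.
Local Notation mu := (lebesgue_rV R d).
Variable i : 'I_d.
Implicit Types (f g psi rho F : 'rV[R]_d -> R) (O : set 'rV[R]_d).

Lemma continuous_tr s : continuous (tr i s : 'rV[R]_d -> 'rV[R]_d).
Proof.
move=> x; apply: (@continuousD _ _ _ id (cst (s *: delta_mx 0 i)) x).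
  exact: cvg_id.
exact: cst_continuous.
Qed.

Lemma tr_growth rho s x (v : 'rV[R]_d) :
  (fun k : R => k^-1 *: (((fun y => rho (tr i s y)) \o shift x) (k *: v) - rho (tr i s x))) =
  (fun k : R => k^-1 *: ((rho \o shift (tr i s x)) (k *: v) - rho (tr i s x))).
Proof. by apply/funext => k /=; rewrite /tr addrA. Qed.

Lemma partial_tr rho s j : partial j (fun x => rho (tr i s x)) =
  fun x => partial j rho (tr i s x).
Proof. by apply/funext => x; rewrite /partial /derive tr_growth. Qed.

Lemma C1_tr rho s : C1 rho -> C1 (fun x => rho (tr i s x)).
Proof.
move=> Cr; split => [x|j].
  apply: (differentiable_comp (f := tr i s) (g := rho)); last exact: Cr.1.
  by apply: (@differentiableD _ _ _ id (cst (s *: delta_mx 0 i)) x).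
rewrite partial_tr => x.
apply: (@continuous_comp _ _ _ (tr i s) (partial j rho)); first exact: continuous_tr.
exact: (Cr.2 j).
Qed.

Lemma test_tr O O' rho s : (forall x, O' x -> O (tr i s x)) -> test_fun O' rho ->
  test_fun O (fun x => rho (tr i (- s) x)).
Proof.
move=> HO tr_; have Cr := test_C1 tr_; have [_ _ cK KO] := tr_.
set K := closure [set x | rho x != 0] in cK KO.
have cK' : compact (tr i s @` K).
  by apply: continuous_compact => //; apply: continuous_subspaceT; exact: continuous_tr.
apply: (test_sub_support (C1_tr (- s) Cr) cK').
- by apply: compact_closed => //.
- by move=> _ [x Kx <-]; apply: HO; exact: KO.
- move=> x Kx; apply: support_out => Kt; apply: Kx; exists (tr i (- s) x) => //.
  exact: trNK.
Qed.

Lemma derive_opp_dir rho (y v : 'rV[R]_d) : C1 rho -> 'D_(- v) rho y = - 'D_v rho y.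
Proof.
move=> Cr; have dr := Cr.1 y.
rewrite (@deriveE _ _ _ rho y (- v) dr) (@deriveE _ _ _ rho y v dr).
exact: linearN.
Qed.

(** The form in which the fundamental theorem of calculus is used: the translations act
backwards on the test function once they have been moved from f by a change of
variable. *)
Lemma FTC_back rho x h : 0 <= h -> C1 rho ->
  \int[@lebesgue_measure R]_s (win h s * - partial i rho (tr i (- s) x)) =
  rho (tr i (- h) x) - rho x.
Proof.
move=> h0 Cr; rewrite winE.
pose G t := rho (x + t *: - delta_mx 0 i).
have GE t : G t = rho (tr i (- t) x) by rewrite /G /tr scaleNr scalerN.
have dG t : is_derive (t : R) 1 G (- partial i rho (tr i (- t) x)).
  have -> : - partial i rho (tr i (- t) x) = 'D_(- delta_mx 0 i) rho (x + t *: - delta_mx 0 i).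
    by rewrite derive_opp_dir// /partial /tr scaleNr scalerN.
  by apply: is_derive_line; exact: C1_derivable.
have cG : continuous (fun t => - partial i rho (tr i (- t) x)).
  move=> t; apply: (@continuousN _ _ _ (fun t => partial i rho (tr i (- t) x))).
  apply: (@continuous_comp _ _ _ (fun t => tr i (- t) x) (partial i rho)); last exact: (Cr.2 i).
  apply: (@continuousD _ _ _ (cst x) (fun t : R => - t *: (delta_mx 0 i : 'rV[R]_d)) t).
    exact: cst_continuous.
  apply: continuousZr_tmp.
  by apply: continuousN; exact: cvg_id.
rewrite /Rintegral (FTC_line h0 dG cG) /= !GE oppr0 tr0 //.
Qed.

End test_translation.

Section steklov.
Context {R : realType} {d : nat}.
Local Notation mu := (lebesgue_rV R d).
Local Notation leb := (@lebesgue_measure R).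
Variables (i : 'I_d) (O : set 'rV[R]_d) (oO : open O).
Implicit Types (f g psi rho F : 'rV[R]_d -> R).

Let mO : measurable O := open_measurable_rV oO.

Definition ext0 f (x : 'rV[R]_d) : R := \1_O x * f x.

Lemma L1_ext0 f : L1 mu O f -> L1 mu setT (ext0 f).
Proof.
move=> If; apply: eq_integrable ((integrable_mkcond (EFin \o f) mO).1 If) => // x _.
by rewrite /= /ext0 patchE indicE; case: (x \in O); rewrite ?mul1r ?mul0r.
Qed.

Lemma Rintegral_ext0 f rho :
  \int[mu]_x (ext0 f x * rho x) = \int[mu]_(x in O) (f x * rho x).
Proof.
rewrite [RHS]Rintegral_mkcond; apply: eq_Rintegral => x _.
by rewrite /ext0 patchE indicE; case: (x \in O); rewrite ?mul1r ?mul0r.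
Qed.

Lemma ext0E f x : O x -> ext0 f x = f x.
Proof. by move=> Ox; rewrite /ext0 indicE mem_set// mul1r. Qed.

Lemma measurable_ext0_tr f : L1 mu O f ->
  measurable_fun [set: 'rV[R]_d * measurableTypeR R] (fun p => ext0 f (tr i p.2 p.1)).
Proof.
move=> If; apply: (measurableT_comp (f := ext0 f)); last exact: measurable_tr.
exact: L1_measurable (L1_ext0 If).
Qed.

Lemma measurable_comp_fst F : measurable_fun setT F ->
  measurable_fun [set: 'rV[R]_d * measurableTypeR R] (fun p => F p.1).
Proof. by move=> mF; exact: (measurableT_comp mF measurable_fst). Qed.

Lemma measurable_comp_trN F : measurable_fun setT F ->
  measurable_fun [set: 'rV[R]_d * measurableTypeR R] (fun p => F (tr i (- p.2) p.1)).
Proof.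
move=> mF.
have m1 : measurable_fun [set: 'rV[R]_d * measurableTypeR R]
    (fun p : 'rV[R]_d * measurableTypeR R => (p.1, - p.2 : measurableTypeR R)).
  apply: measurable_fun_pair; first exact: measurable_fst.
  have mN : measurable_fun [set: measurableTypeR R] (-%R : R -> R) by [].
  exact: (measurableT_comp mN measurable_snd).
exact: (measurableT_comp mF (measurableT_comp (@measurable_tr R d i) m1)).
Qed.

Variables (O' : set 'rV[R]_d) (oO' : open O') (h : R) (h0 : 0 <= h).
Hypothesis HO : forall x s, O' x -> 0 <= s <= h -> O (tr i s x).

Let mO' : measurable O' := open_measurable_rV oO'.

Lemma window_Fubini (q : 'rV[R]_d * measurableTypeR R -> R) N :
  measurable_fun setT q -> (forall s, L1 mu setT (fun x => q (x, s))) ->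
  (forall s, \int[mu]_x `|q (x, s)| <= N) ->
  [/\ L1 mu setT (fun x => \int[leb]_s (win h s * q (x, s))),
    \int[mu]_x (\int[leb]_s (win h s * q (x, s))) =
      \int[leb]_s (win h s * \int[mu]_x q (x, s)),
    {ae mu, forall x, L1 leb setT (fun s => win h s * q (x, s))} &
    L1 leb setT (fun s => win h s * \int[mu]_x q (x, s))].
Proof.
move=> mq Iq qN.
have I : (mu \x leb)%E.-integrable setT (EFin \o (fun p => win h p.2 * q p)).
  apply: (integrable_window h0 mq (N := N)) => s.
  by rewrite (EFin_Rintegral (L1_norm measurableT (Iq s))) lee_fin.
split.
- exact: (Fubini_L1 I).
- rewrite (Fubini_real I); apply: eq_Rintegral => s _ /=.
  by apply: RintegralZl => //; exact: Iq.
- exact: (Fubini_ae I).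
- have := L1_fine (integrable_G I); apply: L1_eq => // s _.
  by rewrite -RintegralZl//; exact: Iq.
Qed.

Lemma L1_win_bounded (c : R -> R) C : measurable_fun [set: measurableTypeR R] c ->
  (forall s, `|c s| <= C) -> L1 leb setT (fun s => win h s * c s).
Proof.
move=> mc cC.
have Iw : L1 leb setT (win h).
  apply: L1_indic; first exact: measurable_itv.
  by have := integral_win h0; rewrite integral_indic// setIT => ->; exact: ltry.
by have := L1_bounded measurableT mc (fun s _ => cC s) Iw; apply: L1_eq => // s _; rewrite mulrC.
Qed.

(** Tested with a function rho supported in O', the left-hand side moves the difference
onto rho, where it is the integral of a classical derivative; exchanging the
integrals and using the definition of g gives the right-hand side. The condition on
O' makes the translates of rho test functions on O. *)
Lemma steklov f g : L1 mu O f -> L1 mu O g -> is_wderiv O i f g ->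
  ae_in O' (fun x => ext0 f (tr i h x) - ext0 f x =
    \int[leb]_s (win h s * ext0 g (tr i s x))).
Proof.
move=> If Ig [lf _ W].
have If0 := L1_ext0 If; have Ig0 := L1_ext0 Ig.
have mf0 := L1_measurable If0; have mg0 := L1_measurable Ig0.
have mgt := measurable_ext0_tr Ig.
have gN s : \int[mu]_x `|ext0 g (tr i s x)| <= \int[mu]_x `|ext0 g x|.
  by rewrite (Rintegral_tr i s (F := fun x => `|ext0 g x|))//; exact: measurableT_comp.
have [IPsi _ aePsi _] := @window_Fubini (fun p => ext0 g (tr i p.2 p.1)) _ mgt
  (fun s => L1_tr i s Ig0) gN.
have IPhi : L1 mu setT (fun x => ext0 f (tr i h x) - ext0 f x).
  by apply: L1B => //; exact: L1_tr.
apply: weak_unique => //.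
- by apply: L1_L1loc => //; apply: (integrableS measurableT).
- by apply: L1_L1loc => //; apply: (integrableS measurableT).
move=> rho trho; have [C C0 bC] := test_bounded trho.
have [D D0 bD] := test_partial_bounded i trho.
have mrho : measurable_fun setT rho := test_measurable trho.
have mprho : measurable_fun setT (partial i rho) := test_partial_measurable i trho.
have rho_out (F : 'rV[R]_d -> R) x : ~ O' x -> F x * rho x = 0.
  by move=> O'x; rewrite (test_out trho O'x) mulr0.
rewrite -(Rintegral_support (rho_out _)) -(Rintegral_support (rho_out _)).
have mback s : measurable_fun [set: 'rV[R]_d] (tr i (- s)) by exact: measurable_tr1.
have mq1 : measurable_fun setT (fun p : 'rV[R]_d * measurableTypeR R =>
    ext0 g (tr i p.2 p.1) * rho p.1).
  by apply: measurable_funM => //; exact: measurable_comp_fst.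
have Iq1 s : L1 mu setT (fun x => ext0 g (tr i s x) * rho x).
  have := L1_bounded measurableT mrho (fun x _ => bC x) (L1_tr i s Ig0).
  by apply: L1_eq => // x _; rewrite mulrC.
have q1N s : \int[mu]_x `|ext0 g (tr i s x) * rho x| <= C * \int[mu]_x `|ext0 g x|.
  apply: (@le_trans _ _ (C * \int[mu]_x `|ext0 g (tr i s x)|)); last exact: ler_wpM2l.
  have In := L1_norm measurableT (L1_tr i s Ig0).
  rewrite -RintegralZl//; apply: le_Rintegral => //.
  - exact: (L1_norm measurableT (Iq1 s)).
  - exact: (L1Z measurableT C In).
  - by move=> x _; rewrite normrM mulrC ler_wpM2r.
have [I1 E1 _ _] := @window_Fubini (fun p => ext0 g (tr i p.2 p.1) * rho p.1) _ mq1 Iq1 q1N.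
have -> : \int[mu]_x ((\int[leb]_s (win h s * ext0 g (tr i s x))) * rho x) =
    \int[leb]_s (win h s * \int[mu]_x (ext0 g x * rho (tr i (- s) x))).
  rewrite (@Rintegral_ae _ _ _ mu setT measurableT _
    (fun x => \int[leb]_s (win h s * (ext0 g (tr i s x) * rho x)))).
  - rewrite E1; apply: eq_Rintegral => s _; congr (_ * _).
    rewrite -(Rintegral_tr i s (F := fun x => ext0 g x * rho (tr i (- s) x))).
      by apply: eq_Rintegral => x _; rewrite trK.
    by apply: measurable_funM => //; exact: measurableT_comp.
  - apply: filterS aePsi => x Ix _; rewrite -RintegralZr//.
    by apply: eq_Rintegral => s _; rewrite mulrA.
  - by apply: measurable_funM => //; exact: L1_measurable IPsi.
  - exact: L1_measurable I1.
have Cr := test_C1 trho.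
have Ifr s : L1 mu setT (fun x => ext0 f x * rho (tr i (- s) x)).
  have mr : measurable_fun setT (fun x => rho (tr i (- s) x)) by exact: measurableT_comp.
  have := L1_bounded measurableT mr (fun x _ => bC (tr i (- s) x)) If0.
  by apply: L1_eq => // x _; rewrite mulrC.
have -> : \int[mu]_x ((ext0 f (tr i h x) - ext0 f x) * rho x) =
   \int[mu]_x (ext0 f x * (rho (tr i (- h) x) - rho x)).
  under eq_Rintegral do rewrite mulrBl.
  under [RHS]eq_Rintegral do rewrite mulrBr.
  have I0 : L1 mu setT (fun x => ext0 f x * rho x).
    by have := Ifr 0; apply: L1_eq => // x _; rewrite oppr0 tr0.
  have Ih : L1 mu setT (fun x => ext0 f (tr i h x) * rho x).
    have := L1_bounded measurableT mrho (fun x _ => bC x) (L1_tr i h If0).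
    by apply: L1_eq => // x _; rewrite mulrC.
  rewrite RintegralB// RintegralB//; last exact: Ifr.
  congr (_ - _).
  rewrite -[RHS](Rintegral_tr i h).
    by apply: eq_Rintegral => x _; rewrite trK.
  exact: L1_measurable (Ifr h).
have mq2 : measurable_fun setT (fun p : 'rV[R]_d * measurableTypeR R =>
    ext0 f p.1 * - partial i rho (tr i (- p.2) p.1)).
  apply: measurable_funM.
    exact: measurable_comp_fst.
  by apply: measurableT_comp => //; exact: measurable_comp_trN.
have Iq2 s : L1 mu setT (fun x => ext0 f x * - partial i rho (tr i (- s) x)).
  have mr : measurable_fun setT (fun x => - partial i rho (tr i (- s) x)).
    by apply: measurableT_comp => //; exact: (measurableT_comp (f := partial i rho)).
  have br x : setT x -> `|- partial i rho (tr i (- s) x)| <= D by rewrite normrN.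
  by have := L1_bounded measurableT mr br If0; apply: L1_eq => // x _; rewrite mulrC.
have q2N s : \int[mu]_x `|ext0 f x * - partial i rho (tr i (- s) x)| <= D * \int[mu]_x `|ext0 f x|.
  have In := L1_norm measurableT If0.
  rewrite -RintegralZl//; apply: le_Rintegral => //.
  - exact: (L1_norm measurableT (Iq2 s)).
  - exact: (L1Z measurableT D In).
  - by move=> x _; rewrite normrM normrN mulrC ler_wpM2r.
have [_ E2 _ _] := @window_Fubini (fun p => ext0 f p.1 * - partial i rho (tr i (- p.2) p.1)) _ mq2 Iq2 q2N.
transitivity (\int[mu]_x (\int[leb]_s (win h s * (ext0 f x * - partial i rho (tr i (- s) x))))).
  apply: eq_Rintegral => x _; rewrite -(FTC_back i x h0 Cr).
  rewrite -RintegralZl//.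
    by apply: eq_Rintegral => s _; rewrite mulrCA.
  apply: (L1_win_bounded (C := D)); last by move=> s; rewrite normrN.
  apply: measurableT_comp => //.
  exact: (measurable_fun_pair2 x (measurable_comp_trN mprho)).
rewrite E2; apply: eq_Rintegral => s _.
rewrite /win indicE; case: (boolP (s \in _)); last by rewrite !mul0r.
rewrite inE /= in_itv /= => sh; congr (_ * _).
have ts : test_fun O (fun x => rho (tr i (- s) x)).
  by apply: test_tr trho => x O'x; exact: HO.
rewrite !Rintegral_ext0.
have If' := L1loc_partial_L1 oO i lf ts; rewrite partial_tr in If'.
have E := W _ ts; rewrite partial_tr in E.
apply: oppr_inj; rewrite -E -mulN1r -RintegralZl//.
  by apply: eq_Rintegral => x _; ring.
by have := L1N mO If'; apply: L1_eq => // x _; rewrite mulrN.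
Qed.

Lemma Rintegral_win (c : R) : \int[leb]_s (win h s * c) = h * c.
Proof.
rewrite RintegralZr//; first by rewrite /Rintegral (integral_win h0).
have := @L1_win_bounded (cst 1) 1 (measurable_cst _) (fun s => _).
by under eq_fun do rewrite mulr1; apply => s; rewrite normr1.
Qed.

(** Integrate Steklov's formula: the L^1 norm of g is the same for all translates. *)
Lemma translation_rate1 f g : L1 mu O f -> L1 mu O g -> is_wderiv O i f g ->
  \int[mu]_(x in O') `|ext0 f (tr i h x) - ext0 f x| <= h * \int[mu]_x `|ext0 g x|.
Proof.
move=> If Ig W; have S := steklov If Ig W.
have If0 := L1_ext0 If; have Ig0 := L1_ext0 Ig.
have mga : measurable_fun setT (fun p : 'rV[R]_d * measurableTypeR R => `|ext0 g (tr i p.2 p.1)|).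
  by apply: measurableT_comp => //; exact: measurable_ext0_tr.
have gN s : \int[mu]_x `| `|ext0 g (tr i s x)| | <= \int[mu]_x `|ext0 g x|.
  under eq_Rintegral do rewrite normr_id.
  by rewrite (Rintegral_tr i s (F := fun x => `|ext0 g x|))//; apply: measurableT_comp => //;
    exact: L1_measurable Ig0.
have [I1 E1 ae1 _] := @window_Fubini (fun p => `|ext0 g (tr i p.2 p.1)|) _ mga
  (fun s => L1_norm measurableT (L1_tr i s Ig0)) gN.
have IPhi : L1 mu setT (fun x => ext0 f (tr i h x) - ext0 f x).
  by apply: L1B => //; exact: L1_tr.
have E2 : \int[mu]_x (\int[leb]_s (win h s * `|ext0 g (tr i s x)|)) = h * \int[mu]_x `|ext0 g x|.
  rewrite E1 -Rintegral_win; apply: eq_Rintegral => s _; congr (_ * _).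
  rewrite (Rintegral_tr i s (F := fun x => `|ext0 g x|))//; apply: measurableT_comp => //.
  exact: L1_measurable Ig0.
rewrite -E2; apply: (@le_trans _ _ (\int[mu]_(x in O') (\int[leb]_s (win h s * `|ext0 g (tr i s x)|)))).
  apply: le_Rintegral_ae => //.
  - by apply: (integrableS measurableT) => //; exact: L1_norm.
  - exact: (integrableS measurableT).
  - suff : ae_in O' (fun x => `|ext0 f (tr i h x) - ext0 f x| <=
      \int[leb]_s (win h s * `|ext0 g (tr i s x)|)) by [].
    have ae2 : ae_in O' (fun x => L1 leb setT (fun s => win h s * `|ext0 g (tr i s x)|)).
      by apply: filterS ae1.
    apply: ae_inS (ae_inI S ae2) => x _ [-> Ix].
    have Iy : L1 leb setT (fun s => win h s * ext0 g (tr i s x)).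
      apply: (L1_le _ _ Ix) => //.
      + apply: measurable_funM; first exact: measurable_win.
        exact: (measurable_fun_pair2 x (measurable_ext0_tr Ig)).
      + by move=> s _; rewrite normrM (ger0_norm (win_ge0 _ _)).
    apply: le_trans (le_normr_Rintegral _ _) _ => //.
    apply: le_Rintegral => //; first exact: L1_norm.
    by move=> s _; rewrite normrM (ger0_norm (win_ge0 _ _)).
apply: Rintegral_subset_le => // x _; apply: Rintegral_ge0 => s _.
by rewrite mulr_ge0// win_ge0.
Qed.

End steklov.

Section translation_rate2.
Context {R : realType} {d : nat}.
Local Notation mu := (lebesgue_rV R d).
Local Notation leb := (@lebesgue_measure R).
Variables (i : 'I_d) (O : set 'rV[R]_d) (oO : open O).
Variables (O' : set 'rV[R]_d) (oO' : open O') (h : R) (h0 : 0 <= h).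
Hypothesis HO : forall x s, O' x -> 0 <= s <= h -> O (tr i s x).

Let mO : measurable O := open_measurable_rV oO.
Let mO' : measurable O' := open_measurable_rV oO'.

(** By Steklov's formula the remainder is the mean over [0, h] of the differences of g,
each of which is bounded by [translation_rate1]. *)
Lemma translation_rate2 (f g g' : 'rV[R]_d -> R) :
  L1 mu O f -> L1 mu O g -> L1 mu O g' ->
  is_wderiv O i f g -> is_wderiv O i g g' ->
  \int[mu]_(x in O') `|ext0 O f (tr i h x) - ext0 O f x - h * ext0 O g x|
    <= h * (h * \int[mu]_x `|ext0 O g' x|).
Proof.
move=> If Ig Ig' W W'; have S := steklov oO oO' h0 HO If Ig W.
have If0 := L1_ext0 oO If; have Ig0 := L1_ext0 oO Ig.
have mg0 := L1_measurable Ig0.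
(* The indicator of O' is part of the integrand: Fubini's theorem is used on the whole
   space. *)
pose q (p : 'rV[R]_d * measurableTypeR R) :=
  \1_O' p.1 * `|ext0 O g (tr i p.2 p.1) - ext0 O g p.1|.
have m1 : measurable_fun [set: 'rV[R]_d] (\1_O' : 'rV[R]_d -> R) by exact: measurable_indic.
have mdiff : measurable_fun setT (fun p : 'rV[R]_d * measurableTypeR R =>
    ext0 O g (tr i p.2 p.1) - ext0 O g p.1).
  apply: measurable_funB; first exact: measurable_ext0_tr.
  exact: measurable_comp_fst.
have mq : measurable_fun setT q.
  apply: measurable_funM; first exact: measurable_comp_fst.
  exact: measurableT_comp.
have Id s : L1 mu setT (fun x => ext0 O g (tr i s x) - ext0 O g x).
  by apply: L1B => //; exact: L1_tr.
have b1 (x : 'rV[R]_d) : setT x -> `|\1_O' x : R| <= 1.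
  by move=> _; rewrite indicE; case: (_ \in _); rewrite ?normr1 ?normr0.
have Iq s : L1 mu setT (fun x => q (x, s)).
  exact: (L1_bounded measurableT m1 b1 (L1_norm measurableT (Id s))).
have q0 p : 0 <= q p by rewrite mulr_ge0// indicE.
have qN s : \int[mu]_x `|q (x, s)| <= 2 * \int[mu]_x `|ext0 O g x|.
  have In := L1_norm measurableT Ig0; have Int := L1_norm measurableT (L1_tr i s Ig0).
  apply: (@le_trans _ _ (\int[mu]_x (`|ext0 O g (tr i s x)| + `|ext0 O g x|))).
    apply: le_Rintegral => //; [exact: (L1_norm measurableT (Iq s))|exact: L1D|].
    move=> x _; rewrite ger0_norm// /q /= (le_trans _ (ler_normB _ _))//.
    by rewrite ler_piMl// (le_trans (ler_norm _) (b1 x I)).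
  rewrite RintegralD// (Rintegral_tr i s (F := fun x => `|ext0 O g x|)).
    by rewrite mulr_natl mulr2n.
  exact: measurableT_comp.
have [I1 E1 ae1 I2] := window_Fubini h0 mq Iq qN.
have qE s : \int[mu]_x q (x, s) = \int[mu]_(x in O') `|ext0 O g (tr i s x) - ext0 O g x|.
  rewrite [RHS]Rintegral_mkcond; apply: eq_Rintegral => x _.
  by rewrite /q /= patchE indicE; case: (x \in O'); rewrite ?mul1r ?mul0r.
have N0 : 0 <= \int[mu]_x `|ext0 O g' x| by apply: Rintegral_ge0.
apply: (@le_trans _ _ (\int[leb]_s (win h s * \int[mu]_x q (x, s)))); last first.
  rewrite -(Rintegral_win h0); apply: le_Rintegral => //.
    by apply: (@L1_win_bounded _ _ h0 (cst (h * \int[mu]_x `|ext0 O g' x|))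
      `|h * \int[mu]_x `|ext0 O g' x| |).
  move=> s _; rewrite /win indicE; case: (boolP (s \in _)); last by rewrite !mul0r.
  rewrite inE /= in_itv /= => /andP[s0 sh]; rewrite !mul1r qE.
  have HOs x t : O' x -> 0 <= t <= s -> O (tr i t x).
    by move=> O'x /andP[t0 ts]; apply: HO => //; rewrite t0 (le_trans ts).
  apply: le_trans (translation_rate1 oO oO' s0 HOs Ig Ig' W') _.
  by rewrite ler_wpM2r.
rewrite -E1; apply: (@le_trans _ _ (\int[mu]_(x in O') (\int[leb]_s (win h s * q (x, s))))).
  apply: le_Rintegral_ae => //.
  - apply: (integrableS measurableT) => //; apply: L1_norm => //; apply: L1B => //.
      by apply: L1B => //; exact: L1_tr.
    exact: L1Z.
  - exact: (integrableS measurableT).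
  - suff : ae_in O' (fun x => `|ext0 O f (tr i h x) - ext0 O f x - h * ext0 O g x| <=
      \int[leb]_s (win h s * q (x, s))) by [].
    have ae2 : ae_in O' (fun x => L1 leb setT (fun s => win h s * q (x, s))).
      by apply: filterS ae1.
    apply: ae_inS (ae_inI S ae2) => x O'x [-> Ix].
    have qx s : q (x, s) = `|ext0 O g (tr i s x) - ext0 O g x|.
      by rewrite /q /= indicE mem_set// mul1r.
    have Iy : L1 leb setT (fun s => win h s * (ext0 O g (tr i s x) - ext0 O g x)).
      apply: (L1_le _ _ Ix) => //.
      + apply: measurable_funM; first exact: measurable_win.
        exact: (measurable_fun_pair2 x mdiff).
      + by move=> s _; rewrite normrM (ger0_norm (win_ge0 _ _)) qx.
    have Ic : L1 leb setT (fun s => win h s * ext0 O g x).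
      by apply: (@L1_win_bounded _ _ h0 (cst (ext0 O g x)) `|ext0 O g x|).
    have Iz : L1 leb setT (fun s => win h s * ext0 O g (tr i s x)).
      have := L1D measurableT Iy Ic; apply: L1_eq => // s _.
      by rewrite -mulrDr subrK.
    rewrite -(Rintegral_win h0) -RintegralB//.
    under eq_Rintegral do rewrite -mulrBr.
    apply: le_trans (le_normr_Rintegral _ _) _ => //.
    apply: le_Rintegral => //; first exact: L1_norm.
    by move=> s _; rewrite normrM (ger0_norm (win_ge0 _ _)) qx.
apply: Rintegral_subset_le => // x _; apply: Rintegral_ge0 => s _.
by rewrite mulr_ge0// win_ge0.
Qed.

End translation_rate2.

(** * Chain rule for truncated products *)

Section truncation.
Context {R : realType}.
Variables (c : R) (c0 : 0 < c).
Implicit Types a b : R.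

Definition resolvent a : R := (1 + c * a ^+ 2)^-1.
(** A bounded truncation of the identity: it tends to a as c tends to 0 and is dominated
by |a|. Being a rational function, it has an explicit divided difference [tquot],
whose diagonal values are the derivative. *)
Definition trunc a : R := a * resolvent a.
Definition tquot a b : R := (1 - c * a * b) * resolvent a * resolvent b.

Lemma resolvent_den a : 0 < 1 + c * a ^+ 2.
Proof. by rewrite ltr_pwDl// mulr_ge0 ?sqr_ge0// ltW. Qed.

Lemma resolvent_ge0 a : 0 <= resolvent a.
Proof. by rewrite invr_ge0 ltW// resolvent_den. Qed.

Lemma resolvent_le1 a : resolvent a <= 1.
Proof.
by rewrite invf_le1 ?resolvent_den// lerDl mulr_ge0 ?sqr_ge0// ltW.
Qed.

Lemma trunc_le a : `|trunc a| <= `|a|.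
Proof.
by rewrite normrM ler_piMr// ger0_norm ?resolvent_ge0// resolvent_le1.
Qed.

Lemma trunc_bounded a : `|trunc a| <= 1 + c^-1.
Proof.
rewrite normrM (ger0_norm (resolvent_ge0 a)) ler_pdivrMr ?resolvent_den//.
have ci : 0 < c^-1 by rewrite invr_gt0.
have -> : (1 + c^-1) * (1 + c * a ^+ 2) = 1 + a ^+ 2 + (c * a ^+ 2 + c^-1).
  by field; rewrite gt_eqF.
have h : `|a| <= 1 + a ^+ 2 by rewrite ler_norml; apply/andP; split; nra.
apply: le_trans h _; rewrite lerDl; apply: addr_ge0; last exact: ltW.
by rewrite mulr_ge0 ?sqr_ge0// ltW.
Qed.

Lemma tquotP a b : trunc a - trunc b = tquot a b * (a - b).
Proof.
rewrite /tquot /trunc /resolvent; field.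
by rewrite !gt_eqF ?resolvent_den.
Qed.

Lemma tquot_le1 a b : `|tquot a b| <= 1.
Proof.
rewrite /tquot !normrM !(ger0_norm (resolvent_ge0 _)) -mulrA -invfM.
rewrite ler_pdivrMr ?mulr_gt0 ?resolvent_den// mul1r.
have h1 : 0 <= c * (a - b) ^+ 2 by rewrite mulr_ge0 ?sqr_ge0// ltW.
have h2 : 0 <= c * (a + b) ^+ 2 by rewrite mulr_ge0 ?sqr_ge0// ltW.
have h3 : 0 <= c * a ^+ 2 * (c * b ^+ 2).
  by apply: mulr_ge0; (apply: mulr_ge0; [exact: ltW|exact: sqr_ge0]).
rewrite ler_norml; apply/andP; split; nra.
Qed.

Lemma continuous_resolvent : continuous resolvent.
Proof.
move=> a; apply: (@cvgV _ _ _ _ (fun a => 1 + c * a ^+ 2)).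
  by rewrite gt_eqF// resolvent_den.
apply: cvgD; first exact: cvg_cst.
by apply: cvgM; [exact: cvg_cst|exact: exprn_continuous].
Qed.

Lemma continuous_trunc : continuous trunc.
Proof. by move=> a; apply: cvgM; [exact: cvg_id|exact: continuous_resolvent]. Qed.

Lemma continuous_tquot b : continuous (tquot ^~ b).
Proof.
move=> a; apply: cvgM; last exact: cvg_cst.
apply: cvgM; last exact: continuous_resolvent.
apply: cvgB; first exact: cvg_cst.
apply: cvgM; last exact: cvg_cst.
by apply: cvgM; [exact: cvg_cst|exact: cvg_id].
Qed.

Lemma measurable_resolvent dT (T : measurableType dT) (D : set T) (f : T -> R) :
  measurable_fun D f -> measurable_fun D (resolvent \o f).
Proof. by apply: measurableT_comp; exact: continuous_measurable_fun continuous_resolvent. Qed.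

Lemma measurable_trunc dT (T : measurableType dT) (D : set T) (f : T -> R) :
  measurable_fun D f -> measurable_fun D (trunc \o f).
Proof. by apply: measurableT_comp; exact: continuous_measurable_fun continuous_trunc. Qed.

Lemma measurable_tquot dT (T : measurableType dT) (D : set T) (f g : T -> R) :
  measurable_fun D f -> measurable_fun D g -> measurable_fun D (fun x => tquot (f x) (g x)).
Proof.
move=> mf mg; apply: measurable_funM; last exact: measurable_resolvent.
apply: measurable_funM; last exact: measurable_resolvent.
by apply: measurable_funB => //; apply: measurable_funM => //; exact: measurable_funM.
Qed.

End truncation.

Lemma seq_limit_unique {R : realType} (u_ : nat -> R) (a b : R) :
  u_ n @[n --> \oo] --> a -> u_ n @[n --> \oo] --> b -> a = b.
Proof.
move=> /cvg_lim -/(_ (@Rhausdorff R)) <-.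
by move=> /cvg_lim -/(_ (@Rhausdorff R)) <-.
Qed.

(** Bounded weights converging almost everywhere against functions converging in L^1:
only the second factor needs a convergence in norm. *)
Lemma Rintegral_weight_cvg {R : realType} dT (T : measurableType dT)
    (mu : {measure set T -> \bar R}) (D : set T) (mD : measurable D)
    (w_ f_ : nat -> T -> R) (w f : T -> R) (C : R) (e_ : nat -> R) :
  0 <= C -> (forall n, measurable_fun D (w_ n)) -> measurable_fun D w ->
  (forall n x, D x -> `|w_ n x| <= C) ->
  {ae mu, forall x, D x -> w_ n x @[n --> \oo] --> w x} ->
  (forall n, L1 mu D (f_ n)) -> L1 mu D f ->
  (forall n, \int[mu]_(x in D) `|f_ n x - f x| <= e_ n) ->
  e_ n @[n --> \oo] --> (0 : R) ->
  \int[mu]_(x in D) (w_ n x * f_ n x) @[n --> \oo] --> \int[mu]_(x in D) (w x * f x).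
Proof.
move=> C0 mw_ mw wC ww If_ If fe e0.
have Iwf n : L1 mu D (fun x => w_ n x * f x) by exact: L1_bounded (mw_ n) (wC n) If.
have Id n : L1 mu D (fun x => f_ n x - f x) by exact: L1B.
have Iwd n : L1 mu D (fun x => w_ n x * (f_ n x - f x)) by exact: L1_bounded (mw_ n) (wC n) (Id n).
have [_ H1] : L1 mu D (fun x => w x * f x) /\
    \int[mu]_(x in D) (w_ n x * f x) @[n --> \oo] --> \int[mu]_(x in D) (w x * f x).
  apply: (Rintegral_dominated mD (g := fun x => C * `|f x|)).
  - by move=> n; exact: L1_measurable (Iwf n).
  - by apply: measurable_funM => //; exact: L1_measurable If.
  - by apply: filterS ww => x wx Dx; apply: cvgM (cvg_cst _); exact: wx.
  - by apply: L1Z => //; exact: L1_norm.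
  - by move=> x n Dx; rewrite normrM ler_wpM2r// wC.
have H2 : \int[mu]_(x in D) (w_ n x * (f_ n x - f x)) @[n --> \oo] --> (0 : R).
  have Ce : (C * e_ n) @[n --> \oo] --> (0 : R).
    by rewrite -(mulr0 C); apply: cvgM e0; exact: cvg_cst.
  apply/norm_cvg0P; apply: (squeeze_cvgr _ (cvg_cst 0) Ce); apply: nearW => n.
  rewrite normr_ge0 /=; apply: le_trans (le_normr_Rintegral mD (Iwd n)) _.
  apply: (@le_trans _ _ (\int[mu]_(x in D) (C * `|f_ n x - f x|))).
    apply: le_Rintegral => //; first exact: L1_norm.
      by apply: L1Z => //; exact: L1_norm.
    by move=> x Dx; rewrite normrM ler_wpM2r// wC.
  rewrite RintegralZl//; last exact: L1_norm.
  exact: ler_wpM2l.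
rewrite -[X in _ --> X]add0r.
have E n : \int[mu]_(x in D) (w_ n x * f_ n x) =
    \int[mu]_(x in D) (w_ n x * (f_ n x - f x)) + \int[mu]_(x in D) (w_ n x * f x).
  rewrite -(RintegralD mD (Iwd n) (Iwf n)); apply: eq_Rintegral => x _.
  by rewrite -mulrDr subrK.
by rewrite (eq_cvg _ _ E); exact: cvgD.
Qed.

Section room.
Context {R : realType} {d : nat}.
Variable (i : 'I_d).

(** A compact subset of an open set has a neighbourhood that remains in the open set
under all small enough translations. *)
Lemma compact_room (O K : set 'rV[R]_d) : open O -> compact K -> K `<=` O ->
  exists (O' : set 'rV[R]_d) (e : R), [/\ open O', 0 < e, K `<=` O' &
    forall x s, O' x -> 0 <= s <= e -> O (tr i s x)].
Proof.
move=> oO cK KO.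
have cov : \forall e \near (0 : R)^'+, K `<=` [set x | ball x e `<=` O].
  move/compact_near_coveringP : cK; apply => x Kx.
  have /nbhs_ballP[r /= r0 rO] : nbhs x O by exact: open_nbhs_nbhs (conj oO (KO _ Kx)).
  have r2 : 0 < r / 2 by rewrite divr_gt0.
  exists (ball x (r / 2), [set e : R | e < r / 2]) => /=.
    split; first exact: nbhsx_ballx.
    exact: nbhs_right_lt.
  move=> [y e] /= [xy er] z yz; apply: rO.
  rewrite [r]splitr; apply: ball_triangle xy _.
  by apply: le_ball yz; exact: ltW.
have [e [e0 eO]] : exists e : R, 0 < e /\ K `<=` [set x | ball x (e + e) `<=` O].
  have [r [r0 rO]] : exists r : R, 0 < r /\ K `<=` [set x | ball x r `<=` O].
    near (0 : R)^'+ => r; exists r; split => //.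
    by near: r.
  by exists (r / 2); rewrite divr_gt0// -splitr.
exists (\bigcup_(z in K) ball z e), e; split => //.
- apply: bigcup_open => z _; exact: ball_open.
- by move=> z Kz; exists z => //; exact: ballxx.
move=> x s [z Kz zx] /andP[s0 se]; apply: (eO _ Kz).
move: zx; rewrite -!ball_normE /= => zx.
rewrite /tr opprD addrA; apply: le_lt_trans (ler_normB _ _) _.
rewrite ltr_leD//; rewrite normrZ (ger0_norm s0).
by rewrite -[leRHS]mulr1 ler_pM// norm_delta_le1.
Unshelve. all: by end_near. Qed.

End room.

Section chain_rule.
Context {R : realType} {d : nat}.
Local Notation mu := (lebesgue_rV R d).
Variables (i : 'I_d) (O : set 'rV[R]_d) (oO : open O).
Variables (c : R) (c0 : 0 < c).
Variables (f f1 f2 g g1 g2 : 'rV[R]_d -> R).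
Hypotheses (If : L1 mu O f) (If1 : L1 mu O f1) (If2 : L1 mu O f2).
Hypotheses (Ig : L1 mu O g) (Ig1 : L1 mu O g1) (Ig2 : L1 mu O g2).
Hypotheses (Wf : is_wderiv O i f f1) (Wf1 : is_wderiv O i f1 f2).
Hypotheses (Wg : is_wderiv O i g g1) (Wg1 : is_wderiv O i g1 g2).

Let mO : measurable O := open_measurable_rV oO.
Let T := trunc c.
Let Q := tquot c.
Let F x := T (ext0 O f x) * T (ext0 O g x).
Let G x := Q (f x) (f x) * T (g x) * f1 x + T (f x) * Q (g x) (g x) * g1 x.

Let If0 := L1_ext0 oO If.
Let Ig0 := L1_ext0 oO Ig.
Let If10 := L1_ext0 oO If1.
Let Ig10 := L1_ext0 oO Ig1.
Let mf0 := L1_measurable If0.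
Let mg0 := L1_measurable Ig0.

Let mTf : measurable_fun setT (fun x => T (ext0 O f x)).
Proof. exact: measurable_trunc mf0. Qed.

Let mTg : measurable_fun setT (fun x => T (ext0 O g x)).
Proof. exact: measurable_trunc mg0. Qed.

Let Tle a : `|T a| <= 1 + c^-1. Proof. exact: trunc_bounded. Qed.

Let B0 : 0 <= 1 + c^-1.
Proof. by rewrite addr_ge0// invr_ge0 ltW. Qed.

Let I_F : L1 mu setT F.
Proof.
apply: (L1_le measurableT _ (L1Z measurableT (1 + c^-1) (L1_norm measurableT Ig0))).
  exact: measurable_funM.
by move=> x _; rewrite normrM; apply: ler_pM => //; exact: trunc_le.
Qed.

Let FE x : O x -> F x = T (f x) * T (g x).
Proof. by move=> Ox; rewrite /F !ext0E. Qed.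

Let IG : L1 mu O G.
Proof.
have mf := L1_measurable If; have mg := L1_measurable Ig.
have b1 a b : `|Q a a * T b| <= 1 + c^-1.
  rewrite normrM -[leRHS]mul1r; apply: ler_pM => //; exact: tquot_le1.
apply: (L1D mO).
  apply: (L1_bounded mO (C := 1 + c^-1) _ _ If1) => //.
  by apply: measurable_funM; [exact: measurable_tquot|exact: measurable_trunc].
apply: (L1_bounded mO (C := 1 + c^-1) _ _ Ig1); last by move=> x _; rewrite mulrC.
by apply: measurable_funM; [exact: measurable_trunc|exact: measurable_tquot].
Qed.

Section one_test_function.
Variables (psi : 'rV[R]_d -> R) (tpsi : test_fun O psi).
Variables (O' : set 'rV[R]_d) (e : R) (oO' : open O') (e0 : 0 < e).
Hypothesis KO' : closure [set x | psi x != 0] `<=` O'.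
Hypothesis HO : forall x s, O' x -> 0 <= s <= e -> O (tr i s x).

Let mO' : measurable O' := open_measurable_rV oO'.
(* Geometric steps, as asked by [ae_cvg0_of_fast_L1]. *)
Let h (n : nat) : R := e * 2^-1 ^+ n.

Let h0 n : 0 < h n. Proof. by rewrite mulr_gt0// exprn_gt0. Qed.

Let he n : h n <= e.
Proof.
apply: ler_piMr; first exact: ltW.
by apply: exprn_ile1 => //; rewrite invf_le1// ler1n.
Qed.

Let hc : h n @[n --> \oo] --> (0 : R).
Proof. by apply: cvg_geometric; rewrite ger0_norm// invf_lt1// ltr1n. Qed.

Let HOn n x s : O' x -> 0 <= s <= h n -> O (tr i s x).
Proof. by move=> O'x /andP[s0 sh]; apply: HO => //; rewrite s0 (le_trans sh). Qed.

Let psi_out x : ~ O' x -> psi x = 0.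
Proof. by move=> O'x; apply: support_out => /KO'. Qed.

Let mpsi : measurable_fun setT psi := test_measurable tpsi.

Let mw1 n : measurable_fun setT (fun x => Q (ext0 O f (tr i (h n) x)) (ext0 O f x) *
  T (ext0 O g (tr i (h n) x)) * psi x).
Proof.
have mt := @measurable_tr1 R d i (h n).
apply: measurable_funM => //; apply: measurable_funM.
  exact: (measurable_tquot c0 (measurableT_comp mf0 mt) mf0).
exact: (measurable_trunc c0 (measurableT_comp mg0 mt)).
Qed.

Let mw2 n : measurable_fun setT (fun x => T (ext0 O f x) *
  Q (ext0 O g (tr i (h n) x)) (ext0 O g x) * psi x).
Proof.
have mt := @measurable_tr1 R d i (h n).
apply: measurable_funM => //; apply: measurable_funM => //.
exact: (measurable_tquot c0 (measurableT_comp mg0 mt) mg0).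
Qed.

Let mw1' : measurable_fun setT (fun x =>
  Q (ext0 O f x) (ext0 O f x) * T (ext0 O g x) * psi x).
Proof.
apply: measurable_funM => //; apply: measurable_funM => //.
exact: (measurable_tquot c0 mf0 mf0).
Qed.

Let mw2' : measurable_fun setT (fun x =>
  T (ext0 O f x) * Q (ext0 O g x) (ext0 O g x) * psi x).
Proof.
apply: measurable_funM => //; apply: measurable_funM => //.
exact: (measurable_tquot c0 mg0 mg0).
Qed.

Let translate_ae (a b : 'rV[R]_d -> R) : L1 mu O a -> L1 mu O b -> is_wderiv O i a b ->
  ae_in O' (fun x => ext0 O a (tr i (h n) x) @[n --> \oo] --> ext0 O a x).
Proof.
move=> Ia Ib W; have Ia0 := L1_ext0 oO Ia.
have Id n : L1 mu O' (fun x => ext0 O a (tr i (h n) x) - ext0 O a x).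
  by apply: (integrableS measurableT) => //; apply: L1B => //; exact: L1_tr.
have := @ae_cvg0_of_fast_L1 _ _ _ mu O' mO'
  (fun n x => `|ext0 O a (tr i (h n) x) - ext0 O a x|) (e * \int[mu]_x `|ext0 O b x|)
  (fun n => L1_norm mO' (Id n)) (fun _ _ _ => normr_ge0 _).
have H n : \int[mu]_(x in O') `|ext0 O a (tr i (h n) x) - ext0 O a x| <=
    e * (\int[mu]_x `|ext0 O b x|) * 2^-1 ^+ n.
  rewrite mulrAC.
  exact: (translation_rate1 oO oO' (ltW (h0 n)) (@HOn n) Ia Ib W).
move=> /(_ H); apply: ae_inS => x O'x /norm_cvg0P Hx.
rewrite -[X in _ --> X]add0r.
have E n : ext0 O a (tr i (h n) x) = (ext0 O a (tr i (h n) x) - ext0 O a x) + ext0 O a x.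
  by rewrite subrK.
by rewrite (eq_cvg _ _ E); apply: cvgD => //; exact: cvg_cst.
Qed.

Let quotient_cvg (a b b' : 'rV[R]_d -> R) (w_ : nat -> 'rV[R]_d -> R) (w : 'rV[R]_d -> R) C :
  L1 mu O a -> L1 mu O b -> L1 mu O b' ->
  is_wderiv O i a b -> is_wderiv O i b b' ->
  0 <= C -> (forall n, measurable_fun setT (w_ n)) -> measurable_fun setT w ->
  (forall n x, `|w_ n x| <= C) -> ae_in O' (fun x => w_ n x @[n --> \oo] --> w x) ->
  \int[mu]_(x in O') (w_ n x * ((h n)^-1 * (ext0 O a (tr i (h n) x) - ext0 O a x)))
    @[n --> \oo] --> \int[mu]_(x in O') (w x * ext0 O b x).
Proof.
move=> Ia Ib Ib' W W' C0 mw_ mw wC ww.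
have Ia0 := L1_ext0 oO Ia; have Ib0 := L1_ext0 oO Ib.
have Id n : L1 mu setT (fun x => (h n)^-1 * (ext0 O a (tr i (h n) x) - ext0 O a x)).
  by apply: L1Z => //; apply: L1B => //; exact: L1_tr.
have Id' n : L1 mu O' (fun x => (h n)^-1 * (ext0 O a (tr i (h n) x) - ext0 O a x)).
  exact: (integrableS measurableT mO' (@subsetT _ O') (Id n)).
have Ib0' : L1 mu O' (ext0 O b) by exact: (integrableS measurableT).
have hc' : (h n * \int[mu]_x `|ext0 O b' x|) @[n --> \oo] --> (0 : R).
  by rewrite -(mul0r (\int[mu]_x `|ext0 O b' x|)); apply: cvgM hc (cvg_cst _).
apply: (Rintegral_weight_cvg mO' C0 _ _ _ ww Id' Ib0' _ hc').
- by move=> n; exact: measurable_funTS.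
- exact: measurable_funTS.
- by move=> n x _.
move=> n.
have I2 : L1 mu O' (fun x => `|ext0 O a (tr i (h n) x) - ext0 O a x - h n * ext0 O b x|).
  apply: (integrableS measurableT) => //; apply: L1_norm => //; apply: L1B => //.
    by apply: L1B => //; exact: L1_tr.
  exact: L1Z.
have -> : \int[mu]_(x in O') `|(h n)^-1 * (ext0 O a (tr i (h n) x) - ext0 O a x) - ext0 O b x| =
  (h n)^-1 * \int[mu]_(x in O') `|ext0 O a (tr i (h n) x) - ext0 O a x - h n * ext0 O b x|.
  rewrite -(RintegralZl _ mO' I2); apply: eq_Rintegral => x _.
  have aux (k A b1 : R) : 0 < k -> `|k^-1 * A - b1| = k^-1 * `|A - k * b1|.
    move=> k0; rewrite -[X in _ = X * _](gtr0_norm (x := k^-1)) ?invr_gt0// -normrM.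
    by rewrite [in RHS]mulrBr mulKf// gt_eqF.
  exact: aux.
rewrite ler_pdivrMl//.
exact: (translation_rate2 oO oO' (ltW (h0 n)) (@HOn n) Ia Ib Ib' W W').
Qed.

(** The quotients are taken backwards because the change of variable of [transfer] turns
them into forward quotients of f and g. *)
Let backward_cvg : \int[mu]_x (F x * ((h n)^-1 * (psi x - psi (tr i (- h n) x))))
  @[n --> \oo] --> \int[mu]_x (F x * partial i psi x).
Proof.
have [D D0 bD] := test_partial_bounded i tpsi.
have Cp := test_C1 tpsi.
have mb n : measurable_fun setT (fun x => psi (tr i (- h n) x)).
  by apply: measurableT_comp => //; exact: measurable_tr1.
suff [] : L1 mu setT (fun x => F x * partial i psi x) /\
    \int[mu]_x (F x * ((h n)^-1 * (psi x - psi (tr i (- h n) x)))) @[n --> \oo] -->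
    \int[mu]_x (F x * partial i psi x) by [].
apply: (Rintegral_dominated measurableT
  (f_ := fun n x => F x * ((h n)^-1 * (psi x - psi (tr i (- h n) x))))
  (f := fun x => F x * partial i psi x) (g := fun x => D * `|F x|)).
- move=> n; apply: measurable_funM; first exact: L1_measurable I_F.
  by apply: measurable_funM => //; exact: measurable_funB.
- by apply: measurable_funM; [exact: L1_measurable I_F|exact: test_partial_measurable tpsi].
- apply: aeW => x _; apply: cvgM; first exact: cvg_cst.
  have hn0 n : - h n != 0 by rewrite oppr_eq0 gt_eqF.
  have hnc : - h n @[n --> \oo] --> (0 : R) by rewrite -oppr0; exact: cvgN.
  have := @difference_quotient_cvg _ _ psi i x (fun n => - h n) Cp hn0 hnc.
  have E n : (- h n)^-1 * (psi (tr i (- h n) x) - psi x) =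
      (h n)^-1 * (psi x - psi (tr i (- h n) x)) by rewrite invrN mulNr -mulrN opprB.
  by rewrite (eq_cvg _ _ E).
- by apply: L1Z => //; exact: L1_norm.
- move=> x n _; rewrite normrM mulrC ler_wpM2r// normrM normfV ler_pdivrMl ?normr_gt0 ?gt_eqF//.
  have := @C1_line_lipschitz _ _ psi i x (- h n) D Cp bD.
  by rewrite distrC normrN mulrC.
Qed.

(** The same integral with the quotients moved, by a change of variable, to the product
T(f) T(g), where the divided differences of T make the quotients of f and g appear. *)
Let transfer n : \int[mu]_x (F x * ((h n)^-1 * (psi x - psi (tr i (- h n) x)))) =
  - (\int[mu]_(x in O') (Q (ext0 O f (tr i (h n) x)) (ext0 O f x) *
        T (ext0 O g (tr i (h n) x)) * psi x *
        ((h n)^-1 * (ext0 O f (tr i (h n) x) - ext0 O f x))) +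
     \int[mu]_(x in O') (T (ext0 O f x) *
        Q (ext0 O g (tr i (h n) x)) (ext0 O g x) * psi x *
        ((h n)^-1 * (ext0 O g (tr i (h n) x) - ext0 O g x)))).
Proof.
have [C C0 bC] := test_bounded tpsi.
have mt s : measurable_fun setT (tr i s : 'rV[R]_d -> 'rV[R]_d) by exact: measurable_tr1.
have IFp : L1 mu setT (fun x => F x * psi x).
  by have := L1_bounded measurableT mpsi (fun x _ => bC x) I_F; apply: L1_eq => // x _; rewrite mulrC.
have mb : measurable_fun setT (fun x => psi (tr i (- h n) x)) by exact: measurableT_comp.
have IFb : L1 mu setT (fun x => F x * psi (tr i (- h n) x)).
  have := L1_bounded measurableT mb (fun x _ => bC (tr i (- h n) x)) I_F.
  by apply: L1_eq => // x _; rewrite mulrC.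
have IFt : L1 mu setT (fun x => F (tr i (h n) x) * psi x).
  have := L1_bounded measurableT mpsi (fun x _ => bC x) (L1_tr i (h n) I_F).
  by apply: L1_eq => // x _; rewrite mulrC.
have Eb : \int[mu]_x (F x * psi (tr i (- h n) x)) = \int[mu]_x (F (tr i (h n) x) * psi x).
  rewrite -(Rintegral_tr i (h n) (F := fun x => F x * psi (tr i (- h n) x))).
    by apply: eq_Rintegral => x _; rewrite trK.
  exact: L1_measurable IFb.
have Id (a : 'rV[R]_d -> R) : L1 mu O a ->
    L1 mu setT (fun x => (h n)^-1 * (ext0 O a (tr i (h n) x) - ext0 O a x)).
  move=> Ia; have Ia0 := L1_ext0 oO Ia.
  by apply: L1Z => //; apply: L1B => //; exact: L1_tr.
have bw a b (t x : R) : `|t| <= C -> `|Q a b * T x * t| <= (1 + c^-1) * C.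
  move=> tC; rewrite normrM; apply: ler_pM => //.
  by rewrite normrM -[leRHS]mul1r; apply: ler_pM => //; exact: tquot_le1.
have J1 : L1 mu setT (fun x => Q (ext0 O f (tr i (h n) x)) (ext0 O f x) *
        T (ext0 O g (tr i (h n) x)) * psi x *
        ((h n)^-1 * (ext0 O f (tr i (h n) x) - ext0 O f x))).
  apply: (L1_bounded measurableT (C := (1 + c^-1) * C) _ _ (Id _ If)).
    exact: mw1.
  by move=> x _; exact: bw.
have J2 : L1 mu setT (fun x => T (ext0 O f x) *
        Q (ext0 O g (tr i (h n) x)) (ext0 O g x) * psi x *
        ((h n)^-1 * (ext0 O g (tr i (h n) x) - ext0 O g x))).
  apply: (L1_bounded measurableT (C := (1 + c^-1) * C) _ _ (Id _ Ig)).
    exact: mw2.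
  by move=> x _; rewrite [X in X * psi x]mulrC; exact: bw.
have KE : \int[mu]_(x in O') (Q (ext0 O f (tr i (h n) x)) (ext0 O f x) *
        T (ext0 O g (tr i (h n) x)) * psi x *
        ((h n)^-1 * (ext0 O f (tr i (h n) x) - ext0 O f x))) +
     \int[mu]_(x in O') (T (ext0 O f x) *
        Q (ext0 O g (tr i (h n) x)) (ext0 O g x) * psi x *
        ((h n)^-1 * (ext0 O g (tr i (h n) x) - ext0 O g x))) =
     \int[mu]_x ((h n)^-1 * (F (tr i (h n) x) * psi x - F x * psi x)).
  rewrite -(Rintegral_support (O := O')); last by move=> x /psi_out ->; rewrite mulr0 mul0r.
  rewrite -(Rintegral_support (O := O')); last by move=> x /psi_out ->; rewrite mulr0 mul0r.
  rewrite -(RintegralD measurableT J1 J2); apply: eq_Rintegral => x _.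
  have aux (q1 t1 t2 q2 T1 T2 p k A B : R) : t1 - t2 = q1 * A -> T1 - T2 = q2 * B ->
      q1 * T1 * p * (k * A) + t2 * q2 * p * (k * B) = k * (t1 * T1 * p - t2 * T2 * p).
    move=> E1 E2; transitivity (k * p * ((q1 * A) * T1 + t2 * (q2 * B))); first by ring.
    by rewrite -E1 -E2; ring.
  by apply: aux; exact: tquotP.
rewrite KE; under eq_Rintegral do rewrite mulrCA mulrBr.
rewrite (RintegralZl _ measurableT (L1B measurableT IFp IFb)).
rewrite (RintegralZl _ measurableT (L1B measurableT IFt IFp)).
rewrite (RintegralB measurableT IFp IFb) (RintegralB measurableT IFt IFp) Eb.
by rewrite -mulrN opprB.
Qed.

Let limit_identity : \int[mu]_x (F x * partial i psi x) = - \int[mu]_(x in O) (G x * psi x).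
Proof.
have [C C0 bC] := test_bounded tpsi.
have mt s : measurable_fun setT (tr i s : 'rV[R]_d -> 'rV[R]_d) by exact: measurable_tr1.
have bw a b (t x : R) : `|t| <= C -> `|Q a b * T x * t| <= (1 + c^-1) * C.
  move=> tC; rewrite normrM; apply: ler_pM => //.
  by rewrite normrM -[leRHS]mul1r; apply: ler_pM => //; exact: tquot_le1.
have BC : 0 <= (1 + c^-1) * C by exact: mulr_ge0.
have Q1 : \int[mu]_(x in O') (Q (ext0 O f (tr i (h n) x)) (ext0 O f x) *
        T (ext0 O g (tr i (h n) x)) * psi x *
        ((h n)^-1 * (ext0 O f (tr i (h n) x) - ext0 O f x))) @[n --> \oo] -->
   \int[mu]_(x in O') (Q (ext0 O f x) (ext0 O f x) * T (ext0 O g x) * psi x * ext0 O f1 x).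
  apply: (quotient_cvg If If1 If2 Wf Wf1 BC).
  - exact: mw1.
  - exact: mw1'.
  - by move=> n x; exact: bw.
  - apply: ae_inS (ae_inI (translate_ae If If1 Wf) (translate_ae Ig Ig1 Wg)) => x _ [cf cg].
    apply: cvgM (cvg_cst _); apply: cvgM.
      exact: (cvg_comp _ (tquot c ^~ (ext0 O f x)) cf (@continuous_tquot _ _ c0 (ext0 O f x) (ext0 O f x))).
    exact: (cvg_comp _ T cg (@continuous_trunc _ _ c0 (ext0 O g x))).
have Q2 : \int[mu]_(x in O') (T (ext0 O f x) *
        Q (ext0 O g (tr i (h n) x)) (ext0 O g x) * psi x *
        ((h n)^-1 * (ext0 O g (tr i (h n) x) - ext0 O g x))) @[n --> \oo] -->
   \int[mu]_(x in O') (T (ext0 O f x) * Q (ext0 O g x) (ext0 O g x) * psi x * ext0 O g1 x).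
  apply: (quotient_cvg Ig Ig1 Ig2 Wg Wg1 BC).
  - exact: mw2.
  - exact: mw2'.
  - by move=> n x; rewrite [X in X * psi x]mulrC; exact: bw.
  - apply: ae_inS (translate_ae Ig Ig1 Wg) => x _ cg.
    apply: cvgM (cvg_cst _); apply: cvgM; first exact: cvg_cst.
    exact: (cvg_comp _ (tquot c ^~ (ext0 O g x)) cg (@continuous_tquot _ _ c0 (ext0 O g x) (ext0 O g x))).
move: backward_cvg; rewrite (eq_cvg _ _ transfer) => H1.
transitivity (- (\int[mu]_(x in O') (Q (ext0 O f x) (ext0 O f x) * T (ext0 O g x) * psi x * ext0 O f1 x) +
  \int[mu]_(x in O') (T (ext0 O f x) * Q (ext0 O g x) (ext0 O g x) * psi x * ext0 O g1 x))).
  by apply: (seq_limit_unique H1); apply: cvgN; exact: cvgD.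
congr (- _).
have IGp : L1 mu O (fun x => G x * psi x).
  by have := L1_bounded mO (measurable_funTS mpsi) (fun x _ => bC x) IG; apply: L1_eq => // x _; rewrite mulrC.
have J1 : L1 mu O' (fun x => Q (ext0 O f x) (ext0 O f x) * T (ext0 O g x) * psi x * ext0 O f1 x).
  apply: (integrableS measurableT) => //.
  apply: (L1_bounded measurableT (C := (1 + c^-1) * C) _ _ If10); last by move=> x _; exact: bw.
  exact: mw1'.
have J2 : L1 mu O' (fun x => T (ext0 O f x) * Q (ext0 O g x) (ext0 O g x) * psi x * ext0 O g1 x).
  apply: (integrableS measurableT) => //.
  apply: (L1_bounded measurableT (C := (1 + c^-1) * C) _ _ Ig10); last first.
    by move=> x _; rewrite [X in X * psi x]mulrC; exact: bw.
  exact: mw2'.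
rewrite -(RintegralD mO' J1 J2).
rewrite -(Rintegral_support (O := O')); last first.
  by move=> x /psi_out ->; rewrite !mulr0 !mul0r addr0.
rewrite (Rintegral_support (O := O)); last first.
  by move=> x Ox; rewrite (test_out tpsi Ox) !mulr0 !mul0r addr0.
apply: eq_Rintegral => x; rewrite inE => Ox; rewrite !ext0E// /G.
by ring.
Qed.

Lemma chain_rule_test : \int[mu]_(x in O) (T (f x) * T (g x) * partial i psi x) =
  - \int[mu]_(x in O) (G x * psi x).
Proof.
rewrite -limit_identity (Rintegral_support (O := O)); last first.
  by move=> x Ox; rewrite (test_partial_out i tpsi Ox) mulr0.
by apply: eq_Rintegral => x; rewrite inE => Ox; rewrite FE.
Qed.

End one_test_function.

(** The second derivatives make the difference quotients of f and g converge in L^1 at a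
linear rate, whereas the bounded factors T and Q only converge almost everywhere;
[Rintegral_weight_cvg] needs exactly this. *)
Lemma truncated_product_wderiv :
  is_wderiv O i (fun x => T (f x) * T (g x)) G.
Proof.
have I_FO : L1 mu O (fun x => T (f x) * T (g x)).
  have := integrableS measurableT mO (@subsetT _ O) I_F; apply: L1_eq => //.
  by move=> x; rewrite inE => Ox; rewrite FE.
split; [exact: L1_L1loc|exact: L1_L1loc|] => psi tpsi.
have [_ _ cK KO] := tpsi.
have [U [e [oU e0 KU HU]]] := compact_room i oO cK KO.
exact: (chain_rule_test tpsi oU e0 KU HU).
Qed.

End chain_rule.

(** * Convection by a solenoidal field *)

Section convection.
Context {R : realType} {d : nat}.
Local Notation mu := (lebesgue_rV R d).
Variables (hd : d = 2%N \/ d = 3%N).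
Variables (O : set 'rV[R]_d) (oO : open O).
Implicit Types (f g h p v psi : 'rV[R]_d -> R) (i : 'I_d).

Let mO : measurable O := open_measurable_rV oO.

(** Cauchy-Schwarz between the squares, which are square integrable by [H10_L4]. *)
Lemma H10_mul_L2 f h : inH10 O f -> inH10 O h ->
  L2 mu O (fun x => f x * h x) /\
  \int[mu]_(x in O) (f x * h x) ^+ 2 <=
    (1 + 32 * \int[mu]_(x in O) f x ^+ 4) * sqnormH1 O h.
Proof.
move=> Hf Hh; have [If4 _] := H10_L4 hd oO Hf; have [Ih4 h4] := H10_L4 hd oO Hh.
have mf := L2_measurable (inH1_L2 Hf.1); have mh := L2_measurable (inH1_L2 Hh.1).
have Lf : L2 mu O (fun x => f x ^+ 2).
  by split; [exact: measurable_funX|apply: (L1_eq mO _ If4) => x _; rewrite -exprM].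
have Lh : L2 mu O (fun x => h x ^+ 2).
  by split; [exact: measurable_funX|apply: (L1_eq mO _ Ih4) => x _; rewrite -exprM].
split.
  split; first exact: measurable_funM.
  by have := L2M_L1 mO Lf Lh; apply: L1_eq => // x _; rewrite exprMn.
have := cauchy_schwarz mO Lf Lh.
have E g : \int[mu]_(x in O) (g x ^+ 2) ^+ 2 = \int[mu]_(x in O) g x ^+ 4.
  by apply: eq_Rintegral => x _; rewrite -exprM.
rewrite !E.
have -> : \int[mu]_(x in O) (f x ^+ 2 * h x ^+ 2) = \int[mu]_(x in O) (f x * h x) ^+ 2.
  by apply: eq_Rintegral => x _; rewrite exprMn.
have N0 := sqnormH1_ge0 O h.
have F0 : 0 <= \int[mu]_(x in O) f x ^+ 4.
  by apply: Rintegral_ge0 => x _; rewrite -[4%N]/(2 * 2)%N exprM sqr_ge0.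
have I0 := Rintegral_sqr_ge0 mu O (fun x => f x * h x).
have aux (a F H N : R) : 0 <= a -> 0 <= F -> 0 <= N -> H <= 32 * N ^+ 2 ->
    a ^+ 2 <= F * H -> a <= (1 + 32 * F) * N.
  move=> a0 F0' N0' HN aFH.
  have le2 : a ^+ 2 <= ((1 + 32 * F) * N) ^+ 2.
    apply: le_trans aFH _; apply: le_trans (ler_wpM2l F0' HN) _.
    rewrite exprMn mulrA ler_wpM2r ?sqr_ge0//.
    have : 0 <= F ^+ 2 by exact: sqr_ge0.
    by nra.
  by rewrite -ler_sqr ?nnegrE// mulr_ge0// addr_ge0// mulr_ge0.
move=> H; exact: (aux _ _ _ _ I0 F0 N0 h4 H).
Qed.

Variables (U : 'I_d -> 'rV[R]_d -> R).
Hypothesis HU : forall i, inH10 O (U i).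
Hypothesis divU : ae_in O (fun x => \sum_i wderiv O i (U i) x = 0).

(** The fields in H^1_0 are not bounded, so that the integrability of a product of three
of them with one derivative already needs the L^4 bound. *)
Lemma transport_L1 v h : inH10 O v -> inH10 O h ->
  L1 mu O (fun x => (\sum_i U i x * wderiv O i v x) * h x).
Proof.
move=> Hv Hh.
have : L1 mu O (fun x => \sum_i (U i x * h x) * wderiv O i v x).
  apply: L1_sum => // i _; apply: (L2M_L1 mO).
    by have [] := H10_mul_L2 (HU i) Hh.
  exact (inH1_L2_wderiv oO i Hv.1).
by apply: L1_eq => // x _; rewrite mulr_suml; apply: eq_bigr => i _; rewrite mulrAC.
Qed.

(** Integrate by parts with p = U_i psi and sum over i: the derivatives of U_i add up to
the divergence. *)
Lemma transport_antisym_test v psi : inH10 O v -> test_fun O psi ->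
  \int[mu]_(x in O) ((\sum_i U i x * wderiv O i v x) * psi x) =
  - \int[mu]_(x in O) ((\sum_i U i x * wderiv O i psi x) * v x).
Proof.
move=> Hv tp; have Hpsi := inH10_test oO tp.
have Lv := inH1_L2 Hv.1.
have HUp i : inH1 O (fun x => U i x * psi x) by have [] := inH1_mul_test oO (HU i).1 tp.
have E i : \int[mu]_(x in O) ((U i x * psi x) * wderiv O i v x) =
    - \int[mu]_(x in O) ((wderiv O i (U i) x * psi x + U i x * wderiv O i psi x) * v x).
  rewrite (integration_by_parts_H10 oO i (HUp i) Hv); congr (- _).
  have Lw := inH1_L2_wderiv oO i (HUp i).
  have LU := inH1_L2_wderiv oO i (HU i).1.
  have mv := L2_measurable Lv.
  have mp := @test_measurable _ _ _ _ O tp.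
  apply: Rintegral_ae => //.
  - have [_ W] := inH1_mul_test oO (HU i).1 tp.
    have [_ A] := wderivP oO (W i).
    apply: ae_inS (ae_inI A (wderiv_test oO i tp)) => x _ [-> ->]; exact: erefl.
  - by apply: measurable_funM => //; exact: L2_measurable Lw.
  - apply: measurable_funM => //; apply: measurable_funD.
      by apply: measurable_funM => //; exact: L2_measurable LU.
    apply: measurable_funM; first exact: L2_measurable (inH1_L2 (HU i).1).
    exact: L2_measurable (inH1_L2_wderiv oO i (inH10_inH1 Hpsi)).
have [C C0 bC] := test_bounded tp.
have I1 i : L1 mu O (fun x => (U i x * psi x) * wderiv O i v x).
  exact (L2M_L1 mO (inH1_L2 (HUp i)) (inH1_L2_wderiv oO i Hv.1)).
have Ia i : L1 mu O (fun x => (wderiv O i (U i) x * psi x) * v x).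
  have := L2_bounded mO (@test_measurable _ _ _ _ O tp) (fun x _ => bC x) (inH1_L2_wderiv oO i (HU i).1).
  move=> L; have := L2M_L1 mO L Lv; apply: L1_eq => // x _; by rewrite (mulrC (psi x)).
have Ib i : L1 mu O (fun x => (U i x * wderiv O i psi x) * v x).
  have [LUv _] := H10_mul_L2 (HU i) Hv.
  have := L2M_L1 mO LUv (inH1_L2_wderiv oO i (inH10_inH1 Hpsi)).
  by apply: L1_eq => // x _; rewrite mulrAC.
have Iab i : L1 mu O (fun x => (wderiv O i (U i) x * psi x + U i x * wderiv O i psi x) * v x).
  by have := L1D mO (Ia i) (Ib i); apply: L1_eq => // x _; rewrite mulrDl.
transitivity (\sum_i \int[mu]_(x in O) ((U i x * psi x) * wderiv O i v x)).
  rewrite -Rintegral_sum//; apply: eq_Rintegral => x _.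
  by rewrite mulr_suml; apply: eq_bigr => i _; rewrite mulrAC.
rewrite (eq_bigr _ (fun i _ => E i)) sumrN -Rintegral_sum//; congr (- _).
have IS : L1 mu O (fun x => \sum_i (wderiv O i (U i) x * psi x + U i x * wderiv O i psi x) * v x).
  by apply: L1_sum => // i _.
have IT : L1 mu O (fun x => (\sum_i U i x * wderiv O i psi x) * v x) by exact: transport_L1.
apply: Rintegral_ae => //; [|exact: L1_measurable IS|exact: L1_measurable IT].
apply: ae_inS divU => x _ D.
rewrite -mulr_suml big_split /= -mulr_suml D mul0r add0r; exact: erefl.
Qed.

Lemma transport_bound v h : inH10 O v -> inH10 O h ->
  (\int[mu]_(x in O) ((\sum_i U i x * wderiv O i v x) * h x)) ^+ 2 <=
  d%:R * (\sum_i (1 + 32 * \int[mu]_(x in O) U i x ^+ 4)) * (sqnormH1 O v * sqnormH1 O h).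
Proof.
move=> Hv Hh.
have sum_sq (a : 'I_d -> R) : (\sum_i a i) ^+ 2 <= d%:R * \sum_i a i ^+ 2.
  rewrite expr2 mulr_suml.
  have : \sum_i \sum_j a i * a j <= \sum_i \sum_(j < d) (a i ^+ 2 / 2 + a j ^+ 2 / 2).
    apply: ler_sum => i _; apply: ler_sum => j _.
    have := sqr_ge0 (a i - a j); have aux (s t : R) : 0 <= (s - t) ^+ 2 -> s * t <= s ^+ 2 / 2 + t ^+ 2 / 2 by nra.
    exact: aux.
  under eq_bigr do rewrite -mulr_sumr.
  move=> /le_trans; apply.
  set S := \sum_i a i ^+ 2.
  have E i : \sum_(j < d) (a i ^+ 2 / 2 + a j ^+ 2 / 2) = d%:R / 2 * a i ^+ 2 + S / 2.
    by rewrite big_split /= sumr_const card_ord -mulr_natl -mulr_suml -/S; field.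
  rewrite (eq_bigr _ (fun i _ => E i)) big_split /= sumr_const card_ord -mulr_sumr -/S.
  by rewrite -mulr_natl le_eqVlt; apply/orP; left; apply/eqP; field.
have I i : L1 mu O (fun x => (U i x * h x) * wderiv O i v x).
  apply: (L2M_L1 mO); first by have [] := H10_mul_L2 (HU i) Hh.
  exact (inH1_L2_wderiv oO i Hv.1).
have -> : \int[mu]_(x in O) ((\sum_i U i x * wderiv O i v x) * h x) =
    \sum_i \int[mu]_(x in O) ((U i x * h x) * wderiv O i v x).
  rewrite -Rintegral_sum//; apply: eq_Rintegral => x _.
  by rewrite mulr_suml; apply: eq_bigr => i _; rewrite mulrAC.
apply: le_trans (sum_sq _) _; rewrite -mulrA; apply: ler_wpM2l => //.
rewrite mulr_suml; apply: ler_sum => i _.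
have [LUh B] := H10_mul_L2 (HU i) Hh.
apply: le_trans (cauchy_schwarz mO LUh (inH1_L2_wderiv oO i Hv.1)) _.
rewrite [sqnormH1 O v * _]mulrC mulrA; apply: ler_pM B (sqnormH1_wderiv _ _ _).
  exact: Rintegral_sqr_ge0.
exact: Rintegral_sqr_ge0.
Qed.

(** The form (v, h) |-> ((U . nabla) v, h) is antisymmetric when h is a test function;
by [transport_bound] the antisymmetry defect is continuous in h, so it also vanishes
at h = v. *)
Lemma transport_self v : inH10 O v ->
  \int[mu]_(x in O) ((\sum_i U i x * wderiv O i v x) * v x) = 0.
Proof.
move=> Hv.
pose S a b := \int[mu]_(x in O) ((\sum_i U i x * wderiv O i a x) * b x).
pose K := d%:R * (\sum_i (1 + 32 * \int[mu]_(x in O) U i x ^+ 4)) * sqnormH1 O v.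
have SBr a b c : inH10 O a -> inH10 O b -> inH10 O c -> S a (b \- c) = S a b - S a c.
  move=> Ha Hb Hc; rewrite /S -RintegralB//; [|exact: transport_L1..].
  by apply: eq_Rintegral => x _; rewrite /= mulrBr.
have SBl a b c : inH10 O a -> inH10 O b -> inH10 O c -> S (b \- c) a = S b a - S c a.
  move=> Ha Hb Hc; rewrite /S -RintegralB//; [|exact: transport_L1..].
  have Hbc := inH10B oO Hb Hc.
  apply: Rintegral_ae => //.
  - have W : ae_in O (fun x => forall i, wderiv O i (b \- c) x = wderiv O i b x - wderiv O i c x).
      by apply: ae_in_forall => i; exact (wderivB oO i Hb.1 Hc.1).
    apply: ae_inS W => x _ W; rewrite -mulrBl; congr (_ * _).
    by rewrite -sumrB; apply: eq_bigr => i _; rewrite W mulrBr.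
  - exact: L1_measurable (transport_L1 Hbc Ha).
  - by apply: measurable_funB; [exact: L1_measurable (transport_L1 Hb Ha)|
      exact: L1_measurable (transport_L1 Hc Ha)].
have : S v v + S v v = 0.
  apply: (@inH10_density _ _ O oO (fun h => S v h + S h v) (4 * K) v Hv).
  - by move=> psi tp; rewrite /S (transport_antisym_test Hv tp) addNr.
  - move=> psi tp; have Hp := inH10_test oO tp.
    by rewrite SBr// SBl// opprD addrACA.
  (* [transport_bound] is symmetric in its two arguments, so it serves both terms. *)
  - move=> h Hh.
    have aux (a b c : R) : a ^+ 2 <= c -> b ^+ 2 <= c -> (a + b) ^+ 2 <= 4 * c.
      by move=> A B; have := sqr_ge0 (a - b); nra.
    rewrite -mulrA; apply: aux; rewrite /K -(mulrA (d%:R * _)).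
      exact: (transport_bound Hv Hh).
    rewrite [sqnormH1 O v * _]mulrC; exact: (transport_bound Hh Hv).
by move=> /eqP; rewrite -mulr2n mulrn_eq0 /= => /eqP.
Qed.

End convection.

(** * Second derivatives and solenoidal fields *)

Section second_order.
Context {R : realType} {d : nat}.
Local Notation mu := (lebesgue_rV R d).
Variables (O : set 'rV[R]_d) (oO : open O).
Implicit Types (f g h p v psi : 'rV[R]_d -> R) (w : 'rV[R]_d -> 'rV[R]_d) (i : 'I_d).

Let mO : measurable O := open_measurable_rV oO.

Lemma wdiv_H1 w : (forall i, inH1 O (fun x => w x 0 i)) ->
  ae_in O (fun x => wdiv O w x = \sum_i wderiv O i (fun y => w y 0 i) x).
Proof.
by move=> Hw; have [] := wdivP oO (is_wdiv_sum oO (fun i => inH1_wderiv oO i (Hw i))).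
Qed.

Lemma wlap_H2 f : inH2 O f ->
  ae_in O (fun x => wlap O f x = \sum_i wderiv O i (wderiv O i f) x).
Proof.
move=> [_ Hf]; have E i : (fun x => wgrad O f x 0 i) = wderiv O i f.
  by apply/funext => x; rewrite mxE.
have := @wdiv_H1 (wgrad O f); rewrite /wlap => H.
have : forall i, inH1 O (fun x => wgrad O f x 0 i) by move=> i; rewrite E.
by move=> /H; apply: ae_inS => x _ ->; apply: eq_bigr => i _; rewrite E.
Qed.

Lemma wdiv_measurable w : (forall i, inH1 O (fun x => w x 0 i)) -> measurable_fun O (wdiv O w).
Proof.
by move=> Hw; have [[_ []]] := wdivP oO (is_wdiv_sum oO (fun i => inH1_wderiv oO i (Hw i))).
Qed.

Lemma wlap_measurable f : inH2 O f -> measurable_fun O (wlap O f).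
Proof.
move=> [_ Hf]; apply: wdiv_measurable => i.
by rewrite (_ : (fun x => _) = wderiv O i f)//; apply/funext => x; rewrite mxE.
Qed.

Lemma wlap_L2 f : inH2 O f -> L2 mu O (wlap O f).
Proof.
move=> Hf; apply: (L2_ae mO (f := fun x => \sum_i wderiv O i (wderiv O i f) x)).
- by apply: ae_inS (wlap_H2 Hf) => x _ ->.
- exact: wlap_measurable.
- by apply: L2_sum => // i _; apply: inH1_L2_wderiv => //; case: Hf.
Qed.

(** Representatives that agree almost everywhere have the same weak derivatives. This is
needed because the second derivatives of a sum are derivatives of a representative. *)
Lemma inH1_ae f g : inH1 O f -> measurable_fun O g -> ae_in O (fun x => f x = g x) ->
  inH1 O g /\ forall i, is_wderiv O i g (wderiv O i f).
Proof.
move=> Hf mg fg.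
have Lg : L2 mu O g by apply: (L2_ae mO fg mg); exact: inH1_L2.
have W i : is_wderiv O i g (wderiv O i f).
  have [lf lw E] := inH1_wderiv oO i Hf; split => //; first exact: L2_L1loc.
  move=> psi tp; rewrite -E//.
  have mpp := @test_partial_measurable _ _ _ _ O i tp.
  apply: Rintegral_ae => //.
  - by apply: ae_inS fg => x _ ->.
  - exact: measurable_funM.
  - by apply: measurable_funM => //; exact: L2_measurable (inH1_L2 Hf).
split=> //; apply: (@inH1I _ _ O g (fun i => wderiv O i f)) => // i.
exact: inH1_L2_wderiv.
Qed.

Lemma inH2D f g : inH2 O f -> inH2 O g -> inH2 O (fun x => f x + g x).
Proof.
move=> [Hf f2] [Hg g2]; split=> [|i]; first exact: inH1D.
have E := wderivD oO i Hf Hg.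
have [] // := @inH1_ae (fun x => wderiv O i f x + wderiv O i g x)
  (wderiv O i (fun x => f x + g x)).
- exact: inH1D.
- by apply: L2_measurable; apply: inH1_L2_wderiv => //; exact: inH1D.
- by apply: ae_inS E => x _ ->.
Qed.

Lemma inH2Z c f : inH2 O f -> inH2 O (fun x => c * f x).
Proof.
move=> [Hf f2]; split=> [|i]; first exact: inH1Z.
have E := wderivZ oO i c Hf.
have [] // := @inH1_ae (fun x => c * wderiv O i f x) (wderiv O i (fun x => c * f x)).
- exact: inH1Z.
- by apply: L2_measurable; apply: inH1_L2_wderiv => //; exact: inH1Z.
- by apply: ae_inS E => x _ ->.
Qed.

Lemma green_dirichlet v : inH2 O v -> inH10 O v ->
  \int[mu]_(x in O) (wlap O v x * v x) = - \sum_i \int[mu]_(x in O) wderiv O i v x ^+ 2.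
Proof.
move=> H2v Hv; have Lv := inH1_L2 Hv.1.
have L2d i : L2 mu O (wderiv O i (wderiv O i v)) by apply: inH1_L2_wderiv => //; case: H2v.
have I i : L1 mu O (fun x => wderiv O i (wderiv O i v) x * v x) by exact: L2M_L1.
have IS : L1 mu O (fun x => \sum_i wderiv O i (wderiv O i v) x * v x).
  by apply: L1_sum => // i _.
transitivity (\int[mu]_(x in O) (\sum_i wderiv O i (wderiv O i v) x * v x)).
  apply: Rintegral_ae => //.
  - by apply: ae_inS (wlap_H2 H2v) => x _ ->; rewrite mulr_suml.
  - exact: L1_measurable (L2M_L1 mO (wlap_L2 H2v) Lv).
  - exact: (L1_measurable IS).
rewrite Rintegral_sum// -sumrN; apply: eq_bigr => i _.
have := integration_by_parts_H10 oO i (H2v.2 i) Hv.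
move=> /(congr1 -%R); rewrite opprK => <-.
by under [in RHS]eq_Rintegral do rewrite expr2.
Qed.

Lemma pressure_orthogonal p (w : 'I_d -> 'rV[R]_d -> R) : inH1 O p ->
  (forall i, inH10 O (w i)) -> ae_in O (fun x => \sum_i wderiv O i (w i) x = 0) ->
  \sum_i \int[mu]_(x in O) (wderiv O i p x * w i x) = 0.
Proof.
move=> Hp Hw dw.
have I i : L1 mu O (fun x => p x * wderiv O i (w i) x).
  exact (L2M_L1 mO (inH1_L2 Hp) (inH1_L2_wderiv oO i (Hw i).1)).
have IS : L1 mu O (fun x => \sum_i p x * wderiv O i (w i) x).
  by apply: L1_sum => // i _.
have E i : \int[mu]_(x in O) (wderiv O i p x * w i x) =
    - \int[mu]_(x in O) (p x * wderiv O i (w i) x).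
  by rewrite (integration_by_parts_H10 oO i Hp (Hw i)) opprK.
rewrite (eq_bigr _ (fun i _ => E i)) sumrN -Rintegral_sum//.
have -> : \int[mu]_(x in O) (\sum_i p x * wderiv O i (w i) x) = \int[mu]_(x in O) 0.
  apply: Rintegral_ae => //; last exact: (L1_measurable IS).
  by apply: ae_inS dw => x _ D; rewrite -mulr_sumr D mulr0.
by rewrite /Rintegral integral0 oppr0.
Qed.

(** In div (f w) = grad f . w + f div w, the last term disappears. *)
Lemma wdiv_product f w : inH1 O f -> (forall i, inH10 O (fun x => w x 0 i)) ->
  ae_in O (fun x => wdiv O w x = 0) ->
  ae_in O (fun x => wdiv O (fun y => f y *: w y) x = \sum_i wderiv O i f x * w x 0 i).
Proof.
move=> Hf Hw dw.
have W : forall i, is_wderiv O i (fun x => (f x *: w x) 0 i)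
    (fun x => wderiv O i f x * w x 0 i + f x * wderiv O i (fun y => w y 0 i) x).
  move=> i; have := product_rule_H10 oO i Hf (Hw i).
  by congr is_wderiv; apply/funext => x; rewrite mxE.
have [_ E] := wdivP oO (is_wdiv_sum oO W).
have D := wdiv_H1 (fun i => (Hw i).1).
apply: ae_inS (ae_inI (ae_inI E D) dw) => x _ [[-> D0] d0].
by rewrite big_split /= -mulr_sumr -D0 d0 mulr0 addr0.
Qed.

Hypothesis muO : (mu O < +oo)%E.

Lemma L2_L1_fin f : L2 mu O f -> L1 mu O f.
Proof.
move=> Lf; apply: (L1_le mO (g := fun x => 1 + f x ^+ 2)); first exact: L2_measurable Lf.
  apply: (L1D mO); last exact: L2_L1.
  apply: (L1_eq mO (f := \1_O)); first by move=> x xO; rewrite indicE xO.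
  by apply: (integrableS measurableT) => //; exact: L1_indic.
by move=> x _; rewrite ler_norml; apply/andP; split; nra.
Qed.

Lemma truncated_product_H1 (c : R) f g : 0 < c -> inH2 O f -> inH2 O g ->
  inH1 O (fun x => trunc c (f x) * trunc c (g x)) /\
  forall i, is_wderiv O i (fun x => trunc c (f x) * trunc c (g x))
    (fun x => tquot c (f x) (f x) * trunc c (g x) * wderiv O i f x
            + trunc c (f x) * tquot c (g x) (g x) * wderiv O i g x).
Proof.
move=> c0 [Hf f2] [Hg g2].
have mf := L2_measurable (inH1_L2 Hf); have mg := L2_measurable (inH1_L2 Hg).
have W i := truncated_product_wderiv oO c0
  (L2_L1_fin (inH1_L2 Hf)) (L2_L1_fin (inH1_L2_wderiv oO i Hf))
  (L2_L1_fin (inH1_L2_wderiv oO i (f2 i)))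
  (L2_L1_fin (inH1_L2 Hg)) (L2_L1_fin (inH1_L2_wderiv oO i Hg))
  (L2_L1_fin (inH1_L2_wderiv oO i (g2 i)))
  (inH1_wderiv oO i Hf) (inH1_wderiv oO i (f2 i))
  (inH1_wderiv oO i Hg) (inH1_wderiv oO i (g2 i)).
split=> //.
have B0 : 0 <= 1 + c^-1 by rewrite addr_ge0// invr_ge0 ltW.
apply: (inH1I _ _ W).
  apply: (L2_bounded mO (C := 1 + c^-1)).
  - exact: measurable_trunc.
  - by move=> x _; exact: trunc_bounded.
  - apply: (L2_le mO _ (inH1_L2 Hg)); first exact: measurable_trunc.
    by move=> x _; exact: trunc_le.
move=> i; apply: (L2D mO).
  apply: (L2_bounded mO (C := 1 + c^-1)).
  - by apply: measurable_funM; [exact: measurable_tquot|exact: measurable_trunc].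
  - move=> x _; rewrite normrM -[leRHS]mul1r; apply: ler_pM => //; first exact: tquot_le1.
    exact: trunc_bounded.
  - exact: inH1_L2_wderiv.
apply: (L2_bounded mO (C := 1 + c^-1)).
- by apply: measurable_funM; [exact: measurable_trunc|exact: measurable_tquot].
- move=> x _; rewrite normrM -[leRHS]mulr1; apply: ler_pM => //; last exact: tquot_le1.
  exact: trunc_bounded.
- exact: inH1_L2_wderiv.
Qed.

Lemma resolvent_cvg1 (a : R) : resolvent n.+1%:R^-1 a @[n --> \oo] --> (1 : R).
Proof.
rewrite -[X in _ --> X]invr1; apply: cvgV; first exact: oner_neq0.
rewrite -[X in _ --> X]addr0; apply: cvgD; first exact: cvg_cst.
rewrite -(mul0r (a ^+ 2)); apply: cvgM (cvg_cst _); exact: cvg_harmonic.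
Qed.

Lemma trunc_cvg (a : R) : trunc n.+1%:R^-1 a @[n --> \oo] --> a.
Proof.
by rewrite -[X in _ --> X]mulr1; apply: cvgM; [exact: cvg_cst|exact: resolvent_cvg1].
Qed.

Lemma tquot_cvg1 (a : R) : tquot n.+1%:R^-1 a a @[n --> \oo] --> (1 : R).
Proof.
rewrite -[X in _ --> X]mulr1; apply: cvgM; last exact: resolvent_cvg1.
rewrite -[X in _ --> X]mulr1; apply: cvgM; last exact: resolvent_cvg1.
rewrite -[X in _ --> X]subr0; apply: cvgB; first exact: cvg_cst.
rewrite -(mul0r a); apply: cvgM (cvg_cst _).
by rewrite -(mul0r a); apply: cvgM (cvg_cst _); exact: cvg_harmonic.
Qed.

(** Formally this is the orthogonality of grad (f g) and w, but f g is not known to lie in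
H^1. For the truncated product [pressure_orthogonal] applies; its gradient tested
with w is dominated by the two integrable functions at hand, and tends to their sum
as the truncation is removed. *)
Lemma solenoidal_orthogonal_product f g (w : 'I_d -> 'rV[R]_d -> R) :
  inH2 O f -> inH2 O g -> (forall i, inH10 O (w i)) ->
  ae_in O (fun x => \sum_i wderiv O i (w i) x = 0) ->
  L1 mu O (fun x => (\sum_i wderiv O i f x * w i x) * g x) ->
  L1 mu O (fun x => f x * (\sum_i wderiv O i g x * w i x)) ->
  \int[mu]_(x in O) ((\sum_i wderiv O i f x * w i x) * g x) +
  \int[mu]_(x in O) (f x * (\sum_i wderiv O i g x * w i x)) = 0.
Proof.
move=> H2f H2g Hw dw IA IB.
have mf := L2_measurable (inH1_L2 H2f.1); have mg := L2_measurable (inH1_L2 H2g.1).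
pose A x := \sum_i wderiv O i f x * w i x.
pose B x := \sum_i wderiv O i g x * w i x.
have mw i : measurable_fun O (w i) by exact: L2_measurable (inH1_L2 (Hw i).1).
have mA : measurable_fun O A.
  apply: measurable_sum => i; apply: measurable_funM => //.
  exact: L2_measurable (inH1_L2_wderiv oO i H2f.1).
have mB : measurable_fun O B.
  apply: measurable_sum => i; apply: measurable_funM => //.
  exact: L2_measurable (inH1_L2_wderiv oO i H2g.1).
(* The truncation disappears as c tends to zero. *)
pose c (n : nat) : R := n.+1%:R^-1.
have c0 n : 0 < c n by rewrite invr_gt0.
pose D n x := tquot (c n) (f x) (f x) * trunc (c n) (g x) * A x
            + trunc (c n) (f x) * tquot (c n) (g x) (g x) * B x.
have mD n : measurable_fun O (D n).
  apply: measurable_funD; apply: measurable_funM => //; apply: measurable_funM;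
    by [exact: (measurable_tquot (c0 n))|exact: (measurable_trunc (c0 n))].
have D0 n : \int[mu]_(x in O) D n x = 0.
  have [HP WP] := truncated_product_H1 (c0 n) H2f H2g.
  have I i : L1 mu O (fun x => wderiv O i (fun y => trunc (c n) (f y) * trunc (c n) (g y)) x * w i x).
    exact (L2M_L1 mO (inH1_L2_wderiv oO i HP) (inH1_L2 (Hw i).1)).
  have IS : L1 mu O (fun x => \sum_i wderiv O i (fun y => trunc (c n) (f y) * trunc (c n) (g y)) x * w i x).
    by apply: L1_sum => // i _.
  rewrite -(pressure_orthogonal HP Hw dw) -Rintegral_sum//.
  apply: Rintegral_ae => //; last exact: (L1_measurable IS).
  have W : ae_in O (fun x => forall i,
      wderiv O i (fun y => trunc (c n) (f y) * trunc (c n) (g y)) x =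
      tquot (c n) (f x) (f x) * trunc (c n) (g x) * wderiv O i f x
            + trunc (c n) (f x) * tquot (c n) (g x) (g x) * wderiv O i g x).
    by apply: ae_in_forall => i; have [_] := wderivP oO (WP i).
  apply: ae_inS W => x _ W; rewrite /D /A /B !mulr_sumr -big_split /=.
  by apply: eq_bigr => i _; rewrite W; ring.
have [I2 C] : L1 mu O (fun x => A x * g x + f x * B x) /\
   \int[mu]_(x in O) D n x @[n --> \oo] --> \int[mu]_(x in O) (A x * g x + f x * B x).
  apply: (Rintegral_dominated mO (g := fun x => `|A x * g x| + `|f x * B x|)) => //.
  - by apply: measurable_funD; exact: measurable_funM.
  - apply: aeW => x Ox; apply: cvgD.
      have -> : A x * g x = 1 * g x * A x by rewrite mul1r mulrC.
      apply: cvgM (cvg_cst _).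
      by apply: cvgM; [exact: tquot_cvg1|exact: trunc_cvg].
    have -> : f x * B x = f x * 1 * B x by rewrite mulr1.
    apply: cvgM (cvg_cst _).
    by apply: cvgM; [exact: trunc_cvg|exact: tquot_cvg1].
  - by apply: (L1D mO); exact: L1_norm.
  - move=> x n Ox; apply: le_trans (ler_normD _ _) _.
    have aux (k t a b : R) : `|k| <= 1 -> `|t| <= `|b| -> `|k * t * a| <= `|a * b|.
      move=> k1 tb; rewrite !normrM [leRHS]mulrC; apply: ler_wpM2r => //.
      by rewrite -(mul1r `|b|); exact: ler_pM.
    apply: lerD; first exact: aux (tquot_le1 (c0 n) _ _) (trunc_le (c0 n) _).
    rewrite (mulrC (trunc _ _) (tquot _ _ _)) (mulrC (f x) (B x)).
    exact: aux (tquot_le1 (c0 n) _ _) (trunc_le (c0 n) _).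
rewrite -(RintegralD mO IA IB).
apply: esym; apply: (seq_limit_unique _ C).
by under eq_fun do rewrite D0; exact: cvg_cst.
Qed.

End second_order.

(** * Algebra of the time discretization *)

Section energy_algebra.
Context {R : realType}.

Definition lin_closed (V : lmodType R) (S : V -> Prop) : Prop :=
  (forall a b, S a -> S b -> S (a + b)) /\ (forall c a, S a -> S (c *: a)).

(** The energy involves three inner products: on L^2 functions, on L^2 vector fields, and
that of gradients, which is degenerate and is only bilinear on H^1. The predicate
[S] is the space on which the laws hold. *)
Record semi_inner (V : lmodType R) (S : V -> Prop) (ip : V -> V -> R) : Prop := {
  semi_inner_closed : lin_closed S;
  semi_inner_sym : forall a b, ip a b = ip b a;
  semi_inner_linear : forall c a b e, S a -> S b -> S e ->
    ip (c *: a + b) e = c * ip a e + ip b e;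
  semi_inner_ge0 : forall a, S a -> 0 <= ip a a }.

Variables (nu eps theta dt : R).
Hypotheses (nu0 : 0 < nu) (eps0 : 0 <= eps) (th : 2^-1 < theta <= 1) (dt0 : 0 < dt).

(** All the time operators of the scheme are linear combinations of three consecutive
values. *)
Definition comb3 (V : lmodType R) (x y z : R) (a b c : V) : V := x *: a + (y *: b + z *: c).

Section time_differences.
Variables (V : lmodType R) (S : V -> Prop) (S_closed : lin_closed S).

Lemma comb3_in x y z a b c : S a -> S b -> S c -> S (comb3 x y z a b c).
Proof.
have [SD SZ] := S_closed.
by move=> Sa Sb Sc; exact: (SD _ _ (SZ _ _ Sa) (SD _ _ (SZ _ _ Sb) (SZ _ _ Sc))).
Qed.

Lemma JopE (a : nat -> V) n : Jop nu eps theta a n =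
  comb3 (theta * ((nu + eps) / nu)) (1 - theta * ((nu + 2 * eps) / nu)) (theta * (eps / nu))
    (a n.+1) (a n) (a n.-1).
Proof. by rewrite /Jop /comb3 addrA. Qed.

Lemma DopE (a : nat -> V) n : Dop theta dt a n =
  comb3 (dt^-1 * (theta + 2^-1)) (- (dt^-1 * (2 * theta))) (dt^-1 * (theta - 2^-1))
    (a n.+1) (a n) (a n.-1).
Proof. by rewrite /Dop /comb3 !scalerDr !scalerA addrA scalerN scaleNr scalerA. Qed.

Lemma diff2E (a : nat -> V) n : diff2 a n = comb3 1 (- 2) 1 (a n.+1) (a n) (a n.-1).
Proof. by rewrite /diff2 /comb3 !scale1r scaleNr addrA. Qed.

Lemma HopE (a : nat -> V) n : Hop theta a n =
  comb3 0 (theta + 1) (- theta) (a n.+1) (a n) (a n.-1).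
Proof. by rewrite /Hop /comb3 scale0r add0r scaleNr. Qed.

Variables (a : nat -> V) (Sa : forall n, S (a n)).

Lemma Jop_in n : S (Jop nu eps theta a n).
Proof. by rewrite JopE; exact: comb3_in. Qed.

Lemma Dop_in n : S (Dop theta dt a n).
Proof. by rewrite DopE; exact: comb3_in. Qed.

Lemma diff2_in n : S (diff2 a n).
Proof. by rewrite diff2E; exact: comb3_in. Qed.

Lemma Hop_in n : S (Hop theta a n).
Proof. by rewrite HopE; exact: comb3_in. Qed.

End time_differences.

Section one_product.
Variables (V : lmodType R) (S : V -> Prop) (ip : V -> V -> R).
Hypothesis H : semi_inner S ip.

Let SD := (semi_inner_closed H).1.
Let SZ := (semi_inner_closed H).2.
Let S3 := comb3_in (semi_inner_closed H).

Lemma comb3_linear x y z a b c e : S a -> S b -> S c -> S e ->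
  ip (comb3 x y z a b c) e = x * ip a e + y * ip b e + z * ip c e.
Proof.
move=> Sa Sb Sc Se; have Zc := SZ z Sc.
rewrite /comb3 (semi_inner_linear H)//; last exact: (SD (SZ _ Sb) (SZ _ Sc)).
rewrite (semi_inner_linear H)// -addrA; congr (_ + (_ + _)).
have := semi_inner_linear H (-1) Zc Zc Se; rewrite scaleN1r addNr mulN1r addNr => Z0.
have := semi_inner_linear H z Sc (SD (SZ (-1) Zc) Zc) Se.
by rewrite scaleN1r addNr addr0 Z0 addr0.
Qed.

Lemma comb3_bilinear x y z x' y' z' a b c : S a -> S b -> S c ->
  ip (comb3 x y z a b c) (comb3 x' y' z' a b c) =
  x * x' * ip a a + y * y' * ip b b + z * z' * ip c c
  + (x * y' + y * x') * ip a b + (x * z' + z * x') * ip a c + (y * z' + z * y') * ip b c.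
Proof.
move=> Sa Sb Sc; have T := S3 x' y' z' Sa Sb Sc.
rewrite comb3_linear// !(semi_inner_sym H _ (comb3 _ _ _ _ _ _)) !comb3_linear//.
rewrite (semi_inner_sym H b a) (semi_inner_sym H c a) (semi_inner_sym H c b).
have aux (p q s t u v : R) : x * (x' * p + y' * t + z' * u) + y * (x' * t + y' * q + z' * v)
  + z * (x' * u + y' * v + z' * s) = x * x' * p + y * y' * q + z * z' * s
  + (x * y' + y * x') * t + (x * z' + z * x') * u + (y * z' + z * y') * v by ring.
exact: aux.
Qed.

(** G-stability: multiplied out, both sides are the same quadratic form in three
consecutive values. *)
Lemma G_identity (a : nat -> V) n : (forall k, S (a k)) ->
  dt * ip (Dop theta dt a n) (Jop nu eps theta a n) =
  sqG nu eps theta ip (a n.+1) (a n) - sqG nu eps theta ip (a n) (a n.-1)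
  + sqF nu eps theta ip (diff2 a n) / 4.
Proof.
move=> Sa; rewrite JopE DopE /sqF diff2E !comb3_bilinear// /sqG /g11 /g12 /g22.
move: (ip (a n.+1) (a n.+1)) (ip (a n) (a n)) (ip (a n.-1) (a n.-1)).
move: (ip (a n.+1) (a n)) (ip (a n.+1) (a n.-1)) (ip (a n) (a n.-1)) => x y z p q s.
by field; rewrite !gt_eqF.
Qed.

Lemma sqF_ge0 a : S a -> 0 <= sqF nu eps theta ip a.
Proof.
move=> Sa; apply: mulr_ge0 (semi_inner_ge0 H Sa); move: th => /andP[th1 th2].
have t0 : 0 <= theta by apply: le_trans (ltW th1); rewrite invr_ge0.
apply: addr_ge0; first by apply: mulr_ge0 => //; rewrite subr_ge0; lra.
by rewrite divr_ge0 ?(ltW nu0)// mulr_ge0// mulr_ge0// sqr_ge0.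
Qed.

(** The difference of the two sides is - g12 times the square of v - w, and g12 is not
positive. *)
Lemma sqG_lower v w : S v -> S w ->
  (2 * theta + 1) / 4 * ip v v - (2 * theta - 1) / 4 * ip w w <= sqG nu eps theta ip v w.
Proof.
move=> Sv Sw; move: th => /andP[th1 th2].
have P := semi_inner_ge0 H (S3 1 (- 1) 0 Sv Sw Sw).
rewrite comb3_bilinear// in P.
have G0 : 0 <= - g12 nu eps theta.
  rewrite /g12 opprK addr_ge0// mulr_ge0 ?divr_ge0 ?addr_ge0 ?(ltW nu0)//; nra.
have E : sqG nu eps theta ip v w - ((2 * theta + 1) / 4 * ip v v - (2 * theta - 1) / 4 * ip w w) =
   - g12 nu eps theta * (ip v v - 2 * ip v w + ip w w).
  rewrite /sqG /g11 /g12 /g22; move: (ip v v) (ip v w) (ip w w) => x y z.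
  by field; rewrite gt_eqF.
rewrite -subr_ge0 E mulr_ge0//; move: P; congr (_ <= _).
by move: (ip v v) (ip v w) (ip w w) => x y z; ring.
Qed.

End one_product.

(** With r = (2 theta - 1) / (2 theta + 1), the lower bound on E and the telescoped law
E n + (sum of s) = E 1 give Y n <= r Y (n - 1) + 2 (1 - r) E 1, where Y is the
left-hand side of the conclusion; a geometric series remains. *)
Lemma energy_recursion (X E s : nat -> R) N :
  (forall n, 0 <= X n) -> (forall n, (1 <= n)%N -> 0 <= s n) ->
  (forall n, (1 <= n)%N -> E n.+1 + s n = E n) ->
  (forall n, (1 <= n)%N -> (2 * theta + 1) / 4 * X n - (2 * theta - 1) / 4 * X n.-1 <= E n) ->
  (1 <= N)%N ->
  X N + 4 / (2 * theta + 1) * \sum_(1 <= n < N) s n <=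
  ((2 * theta - 1) / (2 * theta + 1)) ^+ N * X 0%N +
  2 * (1 - ((2 * theta - 1) / (2 * theta + 1)) ^+ N) * E 1%N.
Proof.
move=> X0 s0 Es XE; move: th => /andP[th1 th2].
have t1 : 0 < 2 * theta + 1 by lra.
have t2 : 0 <= 2 * theta - 1 by lra.
set r := (2 * theta - 1) / _; have r0 : 0 <= r by rewrite divr_ge0// ltW.
have EN n : (1 <= n)%N -> E n + \sum_(1 <= k < n) s k = E 1%N.
  elim: n => // -[|n] IH _; first by rewrite big_geq ?addr0.
  by rewrite big_nat_recr//= addrCA Es// addrC IH.
have key n : (1 <= n)%N ->
    X n + 4 / (2 * theta + 1) * \sum_(1 <= k < n) s k <= r * X n.-1 + 2 * (1 - r) * E 1%N.
  move=> n1; have := XE n n1; rewrite -(EN n n1).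
  move: (X n) (X n.-1) (E n) (\sum_(1 <= k < n) s k) => x y e S h.
  have -> : r * y + 2 * (1 - r) * (e + S) =
     4 / (2 * theta + 1) * ((2 * theta - 1) / 4 * y + e) + 4 / (2 * theta + 1) * S.
    by rewrite /r; field; rewrite gt_eqF.
  rewrite lerD2r; have -> : x = 4 / (2 * theta + 1) * ((2 * theta + 1) / 4 * x).
    by field; rewrite gt_eqF.
  by rewrite ler_wpM2l ?divr_ge0 ?(ltW t1)// -lerBlDl.
elim: N => // -[|n] IH _; first by have := key 1%N isT; rewrite expr1.
have S0 : 0 <= 4 / (2 * theta + 1) * \sum_(1 <= k < n.+1) s k.
  rewrite mulr_ge0 ?divr_ge0 ?(ltW t1)// big_nat_cond sumr_ge0// => k /andP[/andP[k1 _] _].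
  exact: s0.
have := key n.+2 isT; move: (IH isT) => /= A B.
apply: le_trans B _.
have aux (x S e rn x0 : R) : 0 <= S -> x + S <= rn * x0 + 2 * (1 - rn) * e ->
    r * x + 2 * (1 - r) * e <= r * rn * x0 + 2 * (1 - r * rn) * e.
  move=> S0' h; have : r * x <= r * (rn * x0 + 2 * (1 - rn) * e).
    by rewrite ler_wpM2l//; apply: le_trans h; rewrite lerDl.
  by lra.
by rewrite [in leRHS]exprS; exact: (aux _ _ _ _ _ S0 A).
Qed.

End energy_algebra.

(** * The energy balance of one time step *)

Section energy_balance.
Context {R : realType} {d : nat}.
Local Notation mu := (lebesgue_rV R d).
Variables (hd : d = 2%N \/ d = 3%N).
Variables (O : set 'rV[R]_d) (oO : open O) (muO : (mu O < +oo)%E).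

Let mO : measurable O := open_measurable_rV oO.

Lemma ipL2E f g : ipL2 O f g = \int[mu]_(x in O) (f x * g x).
Proof. by []. Qed.

Lemma ipL2M_row (F G : 'rV[R]_d -> 'rV[R]_d) :
  ipL2M O F G = \sum_j ipL2 O (fun x => F x 0 j) (fun x => G x 0 j).
Proof. by rewrite /ipL2M big_ord1. Qed.

Definition ipgrad (f g : 'rV[R]_d -> R) : R := ipL2M O (wgrad O f) (wgrad O g).

Lemma ipgradE f g : ipgrad f g = \sum_j ipL2 O (wderiv O j f) (wderiv O j g).
Proof.
rewrite /ipgrad ipL2M_row; apply: eq_bigr => j _.
by rewrite !ipL2E; apply: eq_Rintegral => x _; rewrite !mxE.
Qed.

(** This is the vanishing of the normal trace, read as Green's formula. *)
Lemma neumann_green f psi : zero_neumann O f -> inH1 O psi ->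
  \int[mu]_(x in O) (wlap O f x * psi x) = - ipgrad f psi.
Proof.
by move=> Hf Hpsi; apply/eqP; rewrite -addr_eq0 addrC; apply/eqP; exact: Hf.
Qed.

Variables (nu lambda eta M : R).
Hypotheses (lambda0 : lambda != 0) (eta0 : eta != 0).
Variables (f g dphi jphi dq jq jp : 'rV[R]_d -> R) (du w U : 'rV[R]_d -> 'rV[R]_d).
Hypotheses (Hf : inH2 O f) (Hg : inH2 O g) (Hjphi : inH2 O jphi) (Hdphi : inH1 O dphi).
Hypotheses (Hdq : L2 mu O dq) (Hjq : L2 mu O jq) (Hjp : inH1 O jp).
Hypotheses (Hdu : forall j, L2 mu O (fun x => du x 0 j)).
Hypotheses (Hw2 : forall j, inH2 O (fun x => w x 0 j)).
Hypotheses (Hw : forall j, inH10 O (fun x => w x 0 j)).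
Hypotheses (HU : forall j, inH10 O (fun x => U x 0 j)).
Hypotheses (div_w : ae_in O (fun x => wdiv O w x = 0)).
Hypotheses (div_U : ae_in O (fun x => wdiv O U x = 0)).
Hypotheses (neumann_phi : zero_neumann O jphi) (neumann_mu : zero_neumann O g).
Hypothesis phase : ae_in O (fun x =>
  dphi x + wdiv O (fun y => f y *: w y) x - M * wlap O g x = 0).
Hypothesis potential : ae_in O (fun x =>
  g x = lambda * (- wlap O jphi x + f x * jq x)).
Hypothesis auxiliary : ae_in O (fun x => dq x = 2 / eta ^+ 2 * f x * dphi x).
Hypothesis momentum : ae_in O (fun x =>
  du x + U x *m wgradv O w x - nu *: wlapv O w x + wgrad O jp x + f x *: wgrad O g x = 0).

Let Lf := inH1_L2 Hf.1.
Let Lg := inH1_L2 Hg.1.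
Let Ldphi := inH1_L2 Hdphi.
Let mf := L2_measurable Lf.
Let mg := L2_measurable Lg.
Let mdphi := L2_measurable Ldphi.
Let mjq := L2_measurable Hjq.
Let Lw j : L2 mu O (fun x => w x 0 j) := inH1_L2 (Hw j).1.
Let mw j := L2_measurable (Lw j).

Let A x := \sum_j wderiv O j f x * w x 0 j.
Let B x := \sum_j wderiv O j g x * w x 0 j.

Let divw : ae_in O (fun x => \sum_i wderiv O i (fun y => w y 0 i) x = 0).
Proof. by apply: ae_inS (ae_inI (wdiv_H1 oO (fun i => (Hw i).1)) div_w) => x _ [<-]. Qed.

Let divU : ae_in O (fun x => \sum_i wderiv O i (fun y => U y 0 i) x = 0).
Proof. by apply: ae_inS (ae_inI (wdiv_H1 oO (fun i => (HU i).1)) div_U) => x _ [<-]. Qed.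

(** grad f . w is a product of two functions with no bound, but the phase equation equates
it with square integrable functions. *)
Let LA : L2 mu O A.
Proof.
apply: (L2_ae mO (f := fun x => M * wlap O g x - dphi x)).
- apply: ae_inS (ae_inI phase (wdiv_product oO Hf.1 Hw div_w)) => x _ [+ E].
  rewrite E -/(A x) => /eqP; rewrite subr_eq0 => /eqP <-.
  by rewrite addrAC subrr add0r.
- apply: measurable_sum => j; apply: measurable_funM => //.
  exact: L2_measurable (inH1_L2_wderiv oO j Hf.1).
- by apply: (L2B mO) => //; apply: (L2Z mO); exact: wlap_L2.
Qed.

Let phase_tested : \int[mu]_(x in O) (dphi x * g x) + \int[mu]_(x in O) (A x * g x)
  + M * ipgrad g g = 0.
Proof.
have I1 := L2M_L1 mO Ldphi Lg; have I2 := L2M_L1 mO LA Lg.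
have I3 := L2M_L1 mO (wlap_L2 oO Hg) Lg.
have N := neumann_green neumann_mu Hg.1.
rewrite -[ipgrad g g]opprK -N mulrN -(RintegralZl _ mO I3) -(RintegralD mO I1 I2).
rewrite -(RintegralB mO (L1D mO I1 I2) (L1Z mO M I3)).
rewrite (_ : 0 = \int[mu]_(x in O) (0 : R)); last by rewrite /Rintegral integral0.
apply: Rintegral_ae => //; last exact: (L1_measurable (L1B mO (L1D mO I1 I2) (L1Z mO M I3))).
apply: ae_inS (ae_inI phase (wdiv_product oO Hf.1 Hw div_w)) => x _ [+ E].
by rewrite E -/(A x) mulrA -mulrDl -mulrBl => ->; rewrite mul0r.
Qed.

(** Likewise, f jq is square integrable because the potential equation says so. *)
Let Lfjq : L2 mu O (fun x => f x * jq x).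
Proof.
apply: (L2_ae mO (f := fun x => lambda^-1 * g x + wlap O jphi x)).
- by apply: ae_inS potential => x _ ->; rewrite mulKf// addrAC addNr add0r.
- exact: measurable_funM.
- by apply: (L2D mO); [exact: L2Z|exact: wlap_L2].
Qed.

Let potential_tested : \int[mu]_(x in O) (dphi x * g x) =
  lambda * (ipgrad dphi jphi + \int[mu]_(x in O) (f x * jq x * dphi x)).
Proof.
have I1 := L2M_L1 mO (wlap_L2 oO Hjphi) Ldphi; have I2 := L2M_L1 mO Lfjq Ldphi.
have E : ipgrad dphi jphi = - \int[mu]_(x in O) (wlap O jphi x * dphi x).
  rewrite (neumann_green neumann_phi Hdphi) opprK !ipgradE; apply: eq_bigr => j _.
  by rewrite !ipL2E; apply: eq_Rintegral => x _; rewrite mulrC.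
rewrite E addrC -(RintegralB mO I2 I1) -(RintegralZl _ mO (L1B mO I2 I1)).
have I3 := L1Z mO lambda (L1B mO I2 I1).
apply: Rintegral_ae => //; [|exact: measurable_funM|exact: (L1_measurable I3)].
by apply: ae_inS potential => x _ ->; ring.
Qed.

Let auxiliary_tested : \int[mu]_(x in O) (dq x * jq x) =
  2 / eta ^+ 2 * \int[mu]_(x in O) (f x * jq x * dphi x).
Proof.
have I2 := L2M_L1 mO Lfjq Ldphi.
rewrite -(RintegralZl _ mO I2).
apply: Rintegral_ae => //; [|exact: (L1_measurable (L2M_L1 mO Hdq Hjq))|exact: (L1_measurable (L1Z mO _ I2))].
by apply: ae_inS auxiliary => x _ ->; rewrite -!mulrA [jq x * _]mulrC.
Qed.

(** The momentum equation, tested with w, bounds the capillary force: all the other terms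
are integrable against w. *)
Let capillary j : L1 mu O (fun x => f x * wderiv O j g x * w x 0 j) /\
  \int[mu]_(x in O) (f x * wderiv O j g x * w x 0 j) =
  - (\int[mu]_(x in O) (du x 0 j * w x 0 j)
     + nu * \sum_i \int[mu]_(x in O) wderiv O i (fun y => w y 0 j) x ^+ 2
     + \int[mu]_(x in O) (wderiv O j jp x * w x 0 j)).
Proof.
have I1 := L2M_L1 mO (Hdu j) (Lw j).
have I2 := transport_L1 hd oO HU (Hw j) (Hw j).
have I3 := L2M_L1 mO (wlap_L2 oO (Hw2 j)) (Lw j).
have I4 := L2M_L1 mO (inH1_L2_wderiv oO j Hjp) (Lw j).
have T := transport_self hd oO HU divU (Hw j).
have G := green_dirichlet oO (Hw2 j) (Hw j).
have J12 := L1D mO I1 I2; have J3 := L1Z mO nu I3.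
have J := L1N mO (L1D mO (L1B mO J12 J3) I4).
have E : ae_in O (fun x => - (du x 0 j * w x 0 j
    + (\sum_i U x 0 i * wderiv O i (fun y => w y 0 j) x) * w x 0 j
    - nu * (wlap O (fun y => w y 0 j) x * w x 0 j)
    + wderiv O j jp x * w x 0 j) = f x * wderiv O j g x * w x 0 j).
  apply: ae_inS momentum => x _ /(congr1 (fun V : 'rV[R]_d => V 0 j)).
  rewrite !mxE; under eq_bigr do rewrite mxE.
  have aux (a b l p e k : R) : a + b - nu * l + p + e = 0 ->
      - (a * k + b * k - nu * (l * k) + p * k) = e * k.
    by move=> /eqP; rewrite addr_eq0 => /eqP /(congr1 -%R); rewrite opprK => <-; ring.
  exact: aux.
have mF : measurable_fun O (fun x => f x * wderiv O j g x * w x 0 j).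
  apply: measurable_funM => //; apply: measurable_funM => //.
  exact: L2_measurable (inH1_L2_wderiv oO j Hg.1).
split; first exact: (L1_ae mO E mF J).
rewrite -(Rintegral_ae mO E (L1_measurable J) mF).
have aux F : L1 mu O F -> \int[mu]_(x in O) (- F x) = - \int[mu]_(x in O) F x.
  move=> IF_; rewrite -mulN1r -(RintegralZl _ mO IF_).
  by apply: eq_Rintegral => x _; rewrite mulN1r.
rewrite (aux _ (L1D mO (L1B mO J12 J3) I4)) (RintegralD mO (L1B mO J12 J3) I4).
rewrite (RintegralB mO J12 J3) (RintegralD mO I1 I2) T (RintegralZl _ mO I3) G addr0 mulrN opprK.
by [].
Qed.

(** The four tested equations add up: the pressure and the convection are orthogonal to
w, the two coupling terms in f and g cancel by [solenoidal_orthogonal_product], and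
the auxiliary equation replaces f dphi jq by dq jq. *)
Lemma energy_balance :
  lambda * ipgrad dphi jphi + lambda * eta ^+ 2 / 2 * ipL2 O dq jq + ipL2M O du w
  + nu * ipL2M O (wgradv O w) (wgradv O w) + M * ipgrad g g = 0.
Proof.
have IA := L2M_L1 mO LA Lg.
have IB : L1 mu O (fun x => f x * B x).
  have : L1 mu O (fun x => \sum_j f x * wderiv O j g x * w x 0 j).
    by apply: L1_sum => // j _; have [] := capillary j.
  by apply: L1_eq => // x _; rewrite mulr_sumr; apply: eq_bigr => j _; rewrite mulrA.
have Z := solenoidal_orthogonal_product oO muO Hf Hg Hw divw IA IB.
have EB : \int[mu]_(x in O) (f x * B x) =
    - (ipL2M O du w + nu * ipL2M O (wgradv O w) (wgradv O w)).
  transitivity (\sum_j \int[mu]_(x in O) (f x * wderiv O j g x * w x 0 j)).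
    rewrite -Rintegral_sum//; last by move=> j _; have [] := capillary j.
    by apply: eq_Rintegral => x _; rewrite mulr_sumr; apply: eq_bigr => j _; rewrite mulrA.
  rewrite (eq_bigr _ (fun j _ => (capillary j).2)) sumrN !big_split /=; congr (- _).
  rewrite (pressure_orthogonal oO Hjp Hw divw) addr0 ipL2M_row; congr (_ + _).
  rewrite -mulr_sumr; congr (_ * _); rewrite /ipL2M exchange_big /=.
  apply: eq_bigr => j _; apply: eq_bigr => i _.
  by rewrite ipL2E; apply: eq_Rintegral => x _; rewrite !mxE expr2.
move: phase_tested potential_tested auxiliary_tested; rewrite !ipL2E.
rewrite -/A -/B EB in Z.
have aux (r a G P Q D K W : R) : r + a + M * G = 0 -> r = lambda * (P + Q) ->
    D = 2 / eta ^+ 2 * Q -> a - (K + nu * W) = 0 ->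
    lambda * P + lambda * eta ^+ 2 / 2 * D + K + nu * W + M * G = 0.
  move=> E1 E2 -> E3.
  have -> : lambda * eta ^+ 2 / 2 * (2 / eta ^+ 2 * Q) = lambda * Q by field.
  by rewrite -mulrDr -E2 -[RHS]E1 -[RHS]subr0 -E3; ring.
by move=> E1 E2 E3; exact: (aux _ _ _ _ _ _ _ _ E1 E2 E3 Z).
Qed.

End energy_balance.

(** * Linear structure of the function classes *)

Section function_classes.
Context {R : realType} {d : nat}.
Local Notation mu := (lebesgue_rV R d).
Variables (O : set 'rV[R]_d) (oO : open O).

Let mO : measurable O := open_measurable_rV oO.

Lemma bounded_lebesgue_fin : bounded_set O -> (mu O < +oo)%E.
Proof.
move=> [M [_ HM]]; set r := `|M| + 1.
have Mr : M < r by rewrite (le_lt_trans (ler_norm M))// ltrDl.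
apply: le_lt_trans (lebesgue_cbox_fin (const_mx (- r)) (const_mx r)).
apply: le_measure; rewrite ?inE; [exact: mO|exact: measurable_cbox|] => x Ox i.
by rewrite !mxE -ler_norml (le_trans (coord_le_norm x i))// (HM _ Mr).
Qed.

Lemma L2_closed : lin_closed (L2 mu O : ('rV[R]_d -> R) -> Prop).
Proof. by split=> [a b La Lb|c a La]; [exact: (L2D mO La Lb)|exact: (L2Z mO c La)]. Qed.

Lemma inH1_closed : lin_closed (inH1 O : ('rV[R]_d -> R) -> Prop).
Proof. by split=> [a b La Lb|c a La]; [exact: (inH1D oO La Lb)|exact: (inH1Z oO c La)]. Qed.

Lemma inH2_closed : lin_closed (inH2 O : ('rV[R]_d -> R) -> Prop).
Proof. by split=> [a b La Lb|c a La]; [exact: (inH2D oO La Lb)|exact: (inH2Z oO c La)]. Qed.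

Lemma inH10_closed : lin_closed (inH10 O : ('rV[R]_d -> R) -> Prop).
Proof. split=> [a b La Lb|c a La]; [exact (inH10D oO La Lb)|exact (inH10Z oO c La)]. Qed.

Lemma components_closed (P : ('rV[R]_d -> R) -> Prop) : lin_closed P ->
  lin_closed (fun u : 'rV[R]_d -> 'rV[R]_d => forall j, P (fun x => u x 0 j)).
Proof.
move=> [PD PZ]; split=> [a b Ha Hb j|c a Ha j].
  rewrite (_ : (fun x => _) = (fun x => a x 0 j) + (fun x => b x 0 j)); last first.
    by apply/funext => x; rewrite mxE.
  exact: (PD _ _ (Ha j) (Hb j)).
rewrite (_ : (fun x => _) = c *: (fun x => a x 0 j)); last by apply/funext => x; rewrite mxE.
exact: (PZ _ _ (Ha j)).
Qed.

Lemma semi_inner_L2 : semi_inner (L2 mu O : ('rV[R]_d -> R) -> Prop) (ipL2 O).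
Proof.
split; first exact: L2_closed.
- by move=> a b; apply: eq_Rintegral => x _; rewrite mulrC.
- move=> c a b e La Lb Le; rewrite !ipL2E.
  have I1 := L2M_L1 mO La Le; have I2 := L2M_L1 mO Lb Le.
  rewrite -(RintegralZl _ mO I1) -(RintegralD mO (L1Z mO c I1) I2).
  by apply: eq_Rintegral => x _; rewrite mulrA -mulrDl.
- by move=> a _; apply: Rintegral_ge0 => x _; rewrite -expr2 sqr_ge0.
Qed.

Lemma semi_inner_vec : semi_inner
  (fun u : 'rV[R]_d -> 'rV[R]_d => forall j, L2 mu O (fun x => u x 0 j)) (@ipL2M R d O 1 d).
Proof.
have H := semi_inner_L2; split; first exact: components_closed L2_closed.
- by move=> a b; rewrite !ipL2M_row; apply: eq_bigr => j _; exact: (semi_inner_sym H).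
- move=> c a b e La Lb Le; rewrite !ipL2M_row mulr_sumr -big_split; apply: eq_bigr => j _ /=.
  rewrite -(semi_inner_linear H c (La j) (Lb j) (Le j)); congr (ipL2 O _ _).
  by apply/funext => x; rewrite !mxE.
- by move=> a La; rewrite ipL2M_row sumr_ge0// => j _; exact: (semi_inner_ge0 H).
Qed.

Lemma semi_inner_grad : semi_inner (inH1 O : ('rV[R]_d -> R) -> Prop) (ipgrad O).
Proof.
have H := semi_inner_L2; split; first exact: inH1_closed.
- by move=> a b; rewrite !ipgradE; apply: eq_bigr => j _; exact: (semi_inner_sym H).
- move=> c a b e Ha Hb He; rewrite !ipgradE mulr_sumr -big_split; apply: eq_bigr => j _ /=.
  have La := inH1_L2_wderiv oO j Ha; have Lb := inH1_L2_wderiv oO j Hb.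
  have Le := inH1_L2_wderiv oO j He.
  rewrite -(semi_inner_linear H c La Lb Le) !ipL2E.
  have Hca := inH1Z oO c Ha; have Hab := inH1D oO Hca Hb.
  have Lab := inH1_L2_wderiv oO j Hab.
  apply: Rintegral_ae => //.
  + have := ae_inI (wderivD oO j Hca Hb) (wderivZ oO j c Ha).
    apply: ae_inS => x _ [E1 E2].
    by congr (_ * _); rewrite [LHS]E1 E2.
  + exact: (L1_measurable (L2M_L1 mO Lab Le)).
  + exact: (L1_measurable (L2M_L1 mO (L2D mO (L2Z mO c La) Lb) Le)).
- move=> a Ha; rewrite ipgradE sumr_ge0// => j _.
  exact (semi_inner_ge0 H (inH1_L2_wderiv oO j Ha)).
Qed.

Lemma wderiv_ae_eq i f g : inH1 O f -> inH1 O g -> ae_in O (fun x => f x = g x) ->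
  ae_in O (fun x => wderiv O i g x = wderiv O i f x).
Proof.
move=> Hf Hg fg; have [_ W] := inH1_ae oO Hf (L2_measurable (inH1_L2 Hg)) fg.
by have [] := wderivP oO (W i).
Qed.

(** The representatives chosen by [wderiv] are not linear in the function: linearity holds
almost everywhere, one derivative at a time. *)
Lemma wlap_linear c f g : inH2 O f -> inH2 O g ->
  ae_in O (fun x => wlap O (fun y => c * f y + g y) x = c * wlap O f x + wlap O g x).
Proof.
move=> Hf Hg; have Hcf := inH2Z oO c Hf; have Hfg := inH2D oO Hcf Hg.
have E i : ae_in O (fun x => wderiv O i (wderiv O i (fun y => c * f y + g y)) x =
    c * wderiv O i (wderiv O i f) x + wderiv O i (wderiv O i g) x).
  have H1 := inH1Z oO c (Hf.2 i); have H2 := inH1D oO H1 (Hg.2 i).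
  have E1 : ae_in O (fun x => c * wderiv O i f x + wderiv O i g x =
      wderiv O i (fun y => c * f y + g y) x).
    have := ae_inI (wderivD oO i Hcf.1 Hg.1) (wderivZ oO i c Hf.1).
    by apply: ae_inS => x _ [-> ->].
  have := ae_inI (wderiv_ae_eq i H2 (Hfg.2 i) E1)
    (ae_inI (wderivD oO i H1 (Hg.2 i)) (wderivZ oO i c (Hf.2 i))).
  by apply: ae_inS => x _ [-> [-> ->]].
have := ae_inI (ae_in_forall E) (ae_inI (wlap_H2 oO Hfg) (ae_inI (wlap_H2 oO Hf) (wlap_H2 oO Hg))).
apply: ae_inS => x _ [Ex [-> [-> ->]]].
by rewrite mulr_sumr -big_split; apply: eq_bigr => i _.
Qed.

Lemma neumann_linear c f g : inH2 O f -> inH2 O g -> zero_neumann O f -> zero_neumann O g ->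
  zero_neumann O (fun y => c * f y + g y).
Proof.
move=> Hf Hg Nf Ng psi Hpsi; have Lpsi := inH1_L2 Hpsi.
have Hfg := inH2D oO (inH2Z oO c Hf) Hg.
have E1 := semi_inner_linear semi_inner_grad c Hf.1 Hg.1 Hpsi.
have E2 := semi_inner_linear semi_inner_L2 c (wlap_L2 oO Hf) (wlap_L2 oO Hg) Lpsi.
have E3 : ipL2 O (wlap O (fun y => c * f y + g y)) psi =
    ipL2 O (c *: wlap O f + wlap O g : 'rV[R]_d -> R) psi.
  apply: Rintegral_ae => //.
  - by apply: ae_inS (wlap_linear c Hf Hg) => x _ ->.
  - exact: (L1_measurable (L2M_L1 mO (wlap_L2 oO Hfg) Lpsi)).
  - exact: (L1_measurable (L2M_L1 mO (L2D mO (L2Z mO c (wlap_L2 oO Hf)) (wlap_L2 oO Hg)) Lpsi)).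
have Pf := Nf _ Hpsi; have Pg := Ng _ Hpsi.
change (ipgrad O (c *: f + g : 'rV[R]_d -> R) psi +
  ipL2 O (wlap O (fun y => c * f y + g y)) psi = 0).
rewrite E1 E3 E2.
change (ipgrad O f psi + ipL2 O (wlap O f) psi = 0) in Pf.
change (ipgrad O g psi + ipL2 O (wlap O g) psi = 0) in Pg.
have aux (a b a' b' : R) : a + a' = 0 -> b + b' = 0 -> c * a + b + (c * a' + b') = 0.
  by move=> A B; rewrite addrACA -mulrDr A B mulr0 addr0.
exact: aux.
Qed.

Lemma neumann_closed : lin_closed (fun f : 'rV[R]_d -> R => inH2 O f /\ zero_neumann O f).
Proof.
split=> [a b [Ha Na] [Hb Nb]|c a [Ha Na]].
  rewrite (_ : a + b = (fun y => 1 * a y + b y)); last by apply/funext => y; rewrite mul1r.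
  split; last exact: neumann_linear.
  exact: (inH2D oO (inH2Z oO 1 Ha) Hb).
rewrite (_ : c *: a = (fun y => (c - 1) * a y + a y)); last first.
  by apply/funext => y; rewrite mulrBl mul1r subrK.
split; last exact: neumann_linear.
exact: (inH2D oO (inH2Z oO (c - 1) Ha) Ha).
Qed.

Lemma solenoidal_closed : lin_closed (fun u : 'rV[R]_d -> 'rV[R]_d =>
  (forall j, inH1 O (fun x => u x 0 j)) /\ ae_in O (fun x => wdiv O u x = 0)).
Proof.
have [PD PZ] := components_closed inH1_closed.
split=> [a b [Ha Da] [Hb Db]|c a [Ha Da]].
  have Hab := PD _ _ Ha Hb; split=> //.
  have E : ae_in O (fun x => forall j, wderiv O j (fun y => (a + b) y 0 j) x =
      wderiv O j (fun y => a y 0 j) x + wderiv O j (fun y => b y 0 j) x).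
    apply: ae_in_forall => j; have := wderivD oO j (Ha j) (Hb j).
    by rewrite (_ : (fun y => (a + b) y 0 j) = fun y => a y 0 j + b y 0 j)//;
      apply/funext => y; rewrite mxE.
  have := ae_inI E (ae_inI (wdiv_H1 oO Hab) (ae_inI (ae_inI (wdiv_H1 oO Ha) (wdiv_H1 oO Hb)) (ae_inI Da Db))).
  apply: ae_inS => x _ [Ex [-> [[Ea Eb] [da db]]]].
  by rewrite (eq_bigr _ (fun j _ => Ex j)) big_split /= -Ea -Eb da db addr0.
have Hca := PZ c _ Ha; split=> //.
have E : ae_in O (fun x => forall j, wderiv O j (fun y => (c *: a) y 0 j) x =
    c * wderiv O j (fun y => a y 0 j) x).
  apply: ae_in_forall => j; have := wderivZ oO j c (Ha j).
  by rewrite (_ : (fun y => (c *: a) y 0 j) = fun y => c * a y 0 j)//;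
    apply/funext => y; rewrite mxE.
have := ae_inI E (ae_inI (wdiv_H1 oO Hca) (ae_inI (wdiv_H1 oO Ha) Da)).
apply: ae_inS => x _ [Ex [-> [Ea da]]].
by rewrite (eq_bigr _ (fun j _ => Ex j)) -mulr_sumr -Ea da mulr0.
Qed.

End function_classes.

(** * Long-time stability *)

Unset Implicit Arguments.

Theorem theorem3p2 (R : realType) (d : nat) (hd : d = 2%N \/ d = 3%N)
  (Omega : set 'rV[R]_d) (hOmega : bounded_lipschitz_domain Omega)
  (nu lambda eta M theta eps dt : R)
  (hnu : 0 < nu) (hlambda : 0 < lambda) (heta : 0 < eta) (hM : 0 < M)
  (htheta : 2^-1 < theta <= 1) (heps : 0 <= eps) (hdt : 0 < dt)
  (phi q p mu : nat -> 'rV[R]_d -> R) (u : nat -> 'rV[R]_d -> 'rV[R]_d)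
  (phi_H2 : forall n, inH2 Omega (phi n))
  (mu_H2 : forall n, inH2 Omega (mu n))
  (u_H2 : forall n j, inH2 Omega (fun x => u n x 0 j))
  (p_H1 : forall n, inH1 Omega (p n))
  (q_L2 : forall n, inL2 Omega (q n))
  (phase_eq : forall n, (1 <= n)%N -> ae_in Omega (fun x =>
     Dop theta dt phi n x
     + wdiv Omega (fun y => Hop theta phi n y *: Jop nu eps theta u n y) x
     - M * wlap Omega (Hop theta mu n) x = 0))
  (potential_eq : forall n, (1 <= n)%N -> ae_in Omega (fun x =>
     Hop theta mu n x =
     lambda * (- wlap Omega (Jop nu eps theta phi n) x
               + Hop theta phi n x * Jop nu eps theta q n x)))
  (auxiliary_eq : forall n, (1 <= n)%N -> ae_in Omega (fun x =>
     Dop theta dt q n x =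
     2 / eta ^+ 2 * Hop theta phi n x * Dop theta dt phi n x))
  (momentum_eq : forall n, (1 <= n)%N -> ae_in Omega (fun x =>
     Dop theta dt u n x
     + Hop theta u n x *m wgradv Omega (Jop nu eps theta u n) x
     - nu *: wlapv Omega (Jop nu eps theta u n) x
     + wgrad Omega (Jop nu eps theta p n) x
     + Hop theta phi n x *: wgrad Omega (Hop theta mu n) x = 0))
  (incompressible : forall n, ae_in Omega (fun x => wdiv Omega (u n) x = 0))
  (u_boundary : forall n j, inH10 Omega (fun x => u n x 0 j))
  (phi_boundary : forall n, zero_neumann Omega (phi n))
  (mu_boundary : forall n, zero_neumann Omega (mu n))
  (N : nat) (hN : (2 <= N)%N) :
  lambda * ipL2M Omega (wgrad Omega (phi N)) (wgrad Omega (phi N))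
  + lambda * eta ^+ 2 / 2 * ipL2 Omega (q N) (q N)
  + ipL2M Omega (u N) (u N)
  + lambda / (2 * theta + 1) * \sum_(1 <= n < N)
      sqF nu eps theta (@ipL2M R d Omega 1 d) (wgrad Omega (diff2 phi n))
  + lambda * eta ^+ 2 / (2 * (2 * theta + 1)) * \sum_(1 <= n < N)
      sqF nu eps theta (ipL2 Omega) (diff2 q n)
  + 1 / (2 * theta + 1) * \sum_(1 <= n < N)
      sqF nu eps theta (@ipL2M R d Omega 1 d) (diff2 u n)
  + 4 * dt * nu / (2 * theta + 1) * \sum_(1 <= n < N)
      ipL2M Omega (wgradv Omega (Jop nu eps theta u n))
                  (wgradv Omega (Jop nu eps theta u n))
  + 4 * dt * M / (2 * theta + 1) * \sum_(1 <= n < N)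
      ipL2M Omega (wgrad Omega (Hop theta mu n)) (wgrad Omega (Hop theta mu n))
  <= ((2 * theta - 1) / (2 * theta + 1)) ^+ N *
       (lambda * ipL2M Omega (wgrad Omega (phi 0%N)) (wgrad Omega (phi 0%N))
        + lambda * eta ^+ 2 / 2 * ipL2 Omega (q 0%N) (q 0%N)
        + ipL2M Omega (u 0%N) (u 0%N))
     + 2 * (1 - ((2 * theta - 1) / (2 * theta + 1)) ^+ N) *
       (lambda * sqG nu eps theta (@ipL2M R d Omega 1 d)
                   (wgrad Omega (phi 1%N)) (wgrad Omega (phi 0%N))
        + lambda * eta ^+ 2 / 2 * sqG nu eps theta (ipL2 Omega) (q 1%N) (q 0%N)
        + sqG nu eps theta (@ipL2M R d Omega 1 d) (u 1%N) (u 0%N)).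

Proof.
have [oO _ _ bO _] := hOmega.
have muO := bounded_lebesgue_fin oO bO.
have nu0 := hnu; have dt1 : dt != 0 by rewrite gt_eqF.
have HL2 := semi_inner_L2 oO; have Hvec := semi_inner_vec oO; have Hgrad := semi_inner_grad oO.
have phi_N n : inH2 Omega (phi n) /\ zero_neumann Omega (phi n) by split.
have mu_N n : inH2 Omega (mu n) /\ zero_neumann Omega (mu n) by split.
have phi_H1 n : inH1 Omega (phi n) by case: (phi_H2 n).
have u_L2 n j : L2 (lebesgue_rV R d) Omega (fun x => u n x 0 j) by exact: (inH1_L2 (u_H2 n j).1).
have u_div n : (forall j, inH1 Omega (fun x => u n x 0 j)) /\
    ae_in Omega (fun x => wdiv Omega (u n) x = 0).
  by split=> [j|]; [case: (u_H2 n j)|exact: incompressible].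
(* X is the energy, E the G-energy and s the dissipation of one step. *)
pose ipg := ipgrad Omega; pose ipq := ipL2 Omega; pose ipu := @ipL2M R d Omega 1 d.
pose Wu n := ipL2M Omega (wgradv Omega (Jop nu eps theta u n)) (wgradv Omega (Jop nu eps theta u n)).
pose Wm n := ipg (Hop theta mu n) (Hop theta mu n).
pose X n := lambda * ipg (phi n) (phi n) + lambda * eta ^+ 2 / 2 * ipq (q n) (q n) + ipu (u n) (u n).
pose E n := lambda * sqG nu eps theta ipg (phi n) (phi n.-1)
  + lambda * eta ^+ 2 / 2 * sqG nu eps theta ipq (q n) (q n.-1)
  + sqG nu eps theta ipu (u n) (u n.-1).
pose Fp n := sqF nu eps theta ipg (diff2 phi n).
pose Fq n := sqF nu eps theta ipq (diff2 q n).
pose Fu n := sqF nu eps theta ipu (diff2 u n).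
pose s n := (lambda * Fp n + lambda * eta ^+ 2 / 2 * Fq n + Fu n) / 4
  + dt * nu * Wu n + dt * M * Wm n.
have l0 := ltW hlambda.
have le0 : 0 <= lambda * eta ^+ 2 / 2 by rewrite divr_ge0// mulr_ge0// sqr_ge0.
have X0 n : 0 <= X n.
  apply: addr_ge0; last exact: (semi_inner_ge0 Hvec (u_L2 n)).
  apply: addr_ge0; apply: mulr_ge0 => //; first exact: (semi_inner_ge0 Hgrad (phi_H1 n)).
  exact: (semi_inner_ge0 HL2 (q_L2 n)).
have Wu0 n : 0 <= Wu n.
  rewrite /Wu /ipL2M; apply: sumr_ge0 => i _; apply: sumr_ge0 => j _.
  by apply: Rintegral_ge0 => x _; rewrite -expr2 sqr_ge0.
have Wm0 n : 0 <= Wm n.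
  apply: (semi_inner_ge0 Hgrad); apply: (Hop_in theta (inH1_closed oO)) => k.
  by case: (mu_H2 k).
have Fp0 n : 0 <= Fp n.
  by apply: (sqF_ge0 hnu heps htheta Hgrad); exact: (diff2_in (inH1_closed oO)).
have Fq0 n : 0 <= Fq n.
  by apply: (sqF_ge0 hnu heps htheta HL2); exact: (diff2_in (L2_closed oO)).
have Fu0 n : 0 <= Fu n.
  apply: (sqF_ge0 hnu heps htheta Hvec).
  by apply: (diff2_in (components_closed (L2_closed oO))) => k.
have s0 n : 0 <= s n.
  rewrite /s; apply: addr_ge0; last by apply: mulr_ge0 => //; apply: mulr_ge0; exact: ltW.
  apply: addr_ge0; last by apply: mulr_ge0 => //; apply: mulr_ge0; exact: ltW.
  by apply: divr_ge0 => //; apply: addr_ge0 => //; apply: addr_ge0; exact: mulr_ge0.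
have balance n : (1 <= n)%N ->
    lambda * ipg (Dop theta dt phi n) (Jop nu eps theta phi n)
    + lambda * eta ^+ 2 / 2 * ipq (Dop theta dt q n) (Jop nu eps theta q n)
    + ipu (Dop theta dt u n) (Jop nu eps theta u n)
    + nu * Wu n + M * Wm n = 0.
  move=> n1.
  have [Hjphi Njphi] := Jop_in nu eps theta (neumann_closed oO) phi_N n.
  have [Hhmu Nhmu] := Hop_in theta (neumann_closed oO) mu_N n.
  have [_ div_w] := Jop_in nu eps theta (solenoidal_closed oO) u_div n.
  have [_ div_U] := Hop_in theta (solenoidal_closed oO) u_div n.
  have lam0 : lambda != 0 by rewrite gt_eqF.
  have eta0 : eta != 0 by rewrite gt_eqF.
  exact (energy_balance hd oO muO lam0 eta0
    (Hop_in theta (inH2_closed oO) phi_H2 n) Hhmu Hjphi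
    (Dop_in theta dt (inH1_closed oO) phi_H1 n)
    (Dop_in theta dt (L2_closed oO) q_L2 n) (Jop_in nu eps theta (L2_closed oO) q_L2 n)
    (Jop_in nu eps theta (inH1_closed oO) p_H1 n)
    (Dop_in theta dt (components_closed (L2_closed oO)) u_L2 n)
    (Jop_in nu eps theta (components_closed (inH2_closed oO)) u_H2 n)
    (Jop_in nu eps theta (components_closed (inH10_closed oO)) u_boundary n)
    (Hop_in theta (components_closed (inH10_closed oO)) u_boundary n)
    div_w div_U Njphi Nhmu (phase_eq n n1) (potential_eq n n1) (auxiliary_eq n n1)
    (momentum_eq n n1)).
have Es n : (1 <= n)%N -> E n.+1 + s n = E n.
  move=> n1; have := balance n n1.
  have := G_identity eps theta nu0 hdt Hgrad n phi_H1.
  have := G_identity eps theta nu0 hdt HL2 n q_L2.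
  have := G_identity eps theta nu0 hdt Hvec n u_L2.
  rewrite /E /s /Fp /Fq /Fu -/ipg -/ipq -/ipu /=.
  have aux (iu iq ip gu gu' gq gq' gp gp' fu fq fp W1 W2 : R) :
      dt * iu = gu - gu' + fu / 4 -> dt * iq = gq - gq' + fq / 4 -> dt * ip = gp - gp' + fp / 4 ->
      lambda * ip + lambda * eta ^+ 2 / 2 * iq + iu + nu * W1 + M * W2 = 0 ->
      lambda * gp + lambda * eta ^+ 2 / 2 * gq + gu +
      ((lambda * fp + lambda * eta ^+ 2 / 2 * fq + fu) / 4 + dt * nu * W1 + dt * M * W2) =
      lambda * gp' + lambda * eta ^+ 2 / 2 * gq' + gu'.
    move=> Eu Eq Ep B.
    have : lambda * (dt * ip) + lambda * eta ^+ 2 / 2 * (dt * iq) + dt * iu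
        + dt * (nu * W1) + dt * (M * W2) = 0.
      by rewrite -(mulr0 dt) -B; ring.
    by rewrite Eu Eq Ep => Z; apply/eqP; rewrite -subr_eq0 -[X in _ == X]Z; apply/eqP; ring.
  exact: aux.
have XE n : (1 <= n)%N -> (2 * theta + 1) / 4 * X n - (2 * theta - 1) / 4 * X n.-1 <= E n.
  move=> _.
  have Gp := sqG_lower hnu heps htheta Hgrad (phi_H1 n) (phi_H1 n.-1).
  have Gq := sqG_lower hnu heps htheta HL2 (q_L2 n) (q_L2 n.-1).
  have Gu := sqG_lower hnu heps htheta Hvec (u_L2 n) (u_L2 n.-1).
  have aux (t1 t2 c2 y y' q1 q' v v' gp gq gu : R) : 0 <= c2 ->
      t1 * y - t2 * y' <= gp -> t1 * q1 - t2 * q' <= gq -> t1 * v - t2 * v' <= gu ->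
      t1 * (lambda * y + c2 * q1 + v) - t2 * (lambda * y' + c2 * q' + v') <=
      lambda * gp + c2 * gq + gu.
    move=> c20 A B C.
    have -> : t1 * (lambda * y + c2 * q1 + v) - t2 * (lambda * y' + c2 * q' + v') =
      lambda * (t1 * y - t2 * y') + c2 * (t1 * q1 - t2 * q') + (t1 * v - t2 * v') by ring.
    by apply: lerD => //; apply: lerD; exact: ler_wpM2l.
  exact: aux.
have N1 : (1 <= N)%N by exact: leq_trans hN.
have key := @energy_recursion R theta htheta X E s N X0 (fun n _ => s0 n) Es XE N1.
have sumE (c : R) (fp fq fu w1 w2 : nat -> R) :
    \sum_(1 <= n < N) ((lambda * fp n + c * fq n + fu n) / 4 + dt * nu * w1 n + dt * M * w2 n) =
    (lambda * (\sum_(1 <= n < N) fp n) + c * (\sum_(1 <= n < N) fq n)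
      + \sum_(1 <= n < N) fu n) / 4
    + dt * nu * (\sum_(1 <= n < N) w1 n) + dt * M * (\sum_(1 <= n < N) w2 n).
  by rewrite !big_split /= -!mulr_sumr -mulr_suml !big_split /= -!mulr_sumr.
have sE : \sum_(1 <= n < N) s n = _ := sumE (lambda * eta ^+ 2 / 2) Fp Fq Fu Wu Wm.
rewrite sE in key.
have regroup (x y z a b c v w : R) :
    lambda * x + lambda * eta ^+ 2 / 2 * y + z + lambda / (2 * theta + 1) * a
    + lambda * eta ^+ 2 / (2 * (2 * theta + 1)) * b + 1 / (2 * theta + 1) * c
    + 4 * dt * nu / (2 * theta + 1) * v + 4 * dt * M / (2 * theta + 1) * w =
    lambda * x + lambda * eta ^+ 2 / 2 * y + z + 4 / (2 * theta + 1) *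
      ((lambda * a + lambda * eta ^+ 2 / 2 * b + c) / 4 + dt * nu * v + dt * M * w).
  have t0 : 2 * theta + 1 != 0.
    by case/andP: htheta => t1 _; rewrite gt_eqF//; lra.
  by field.
apply: le_trans key; rewrite le_eqVlt; apply/orP; left; apply/eqP.
exact (regroup (ipg (phi N) (phi N)) (ipq (q N) (q N)) (ipu (u N) (u N))
  (\sum_(1 <= n < N) Fp n) (\sum_(1 <= n < N) Fq n) (\sum_(1 <= n < N) Fu n)
  (\sum_(1 <= n < N) Wu n) (\sum_(1 <= n < N) Wm n)).
Qed.
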